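(* Let $G=(V,E)$ be a finite simple $k$-regular bipartite graph and let $M(G,k)$ be the (simplified) Markov chain on the edge $k$-colorings of $G$ defined in the context. Then the diameter of $M(G,k)$ is upper bounded by $3|E|$, and the inverse of the acceptance ratio in the Metropolis-Hastings algorithm applied to $M(G,k)$ with the uniform distribution (on the edge $k$-colorings of $G$) is upper bounded by $16|V|(|V|-1)$.
   Context: **Colorings.** An edge $k$-coloring of $G=(V,E)$ is a map $C:E\to\{c_1,\dots,c_k\}$ such that no two adjacent edges have the same color. For a map $C:E\to\{c_1,\dots,c_k\}$, a vertex $v$ has a $(+c-c')$-deficiency (and is called deficient) if exactly two $c$-colored edges are incident to $v$, all other edges incident to $v$ have different colors, and no $c'$-colored edge is incident to $v$. An almost edge $k$-coloring is a map $C:E\to\{c_1,\dots,c_k\}$ such that at most two vertices have deficiency and all other vertices have no two incident edges of the same color. Flipping the colors along an alternating path or cycle with colors $a,b$ means interchanging $a$ and $b$ on its edges. Eliminating a $(+a-b)$-deficiency at a vertex $v$ means: select uniformly one of the two $a$-edges at $v$ and flip the colors along the maximal alternating path with colors $a,b$ starting at $v$ with the selected edge. **The Markov chain $M(G,k)$ for $k$-regular graphs.** $G$ is a $k$-regular bipartite graph with equally large vertex classes. The states are the edge $k$-colorings of $G$. From the current coloring $C$, a random edge $k$-coloring is drawn as follows. (1) With probability $\frac12$, do nothing. (2) With probability $\frac14$, select two colors $c,c'$ uniformly among the $\binom{k}{2}$ unordered pairs. Let $H$ be the subgraph of $G$ formed by the edges of colors $c$ and $c'$; it consists of disjoint alternating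 cycles. Select one of the following: (a) with probability $\frac12$, do nothing; (b) with probability $\frac12$, uniformly select one of the possible connected subgraphs of $H$. Flip the colors in the selected subgraph. If there is any deficient vertex, select one of them uniformly, select uniformly one of the edges with the same color incident to the selected vertex, and change its color from $c$ to $c'$ or from $c'$ to $c$. Otherwise, with probability $\frac12$ select an edge uniformly from all edges of color $c$ or $c'$ and change its color to the opposite ($c'$ or $c$), and with probability $\frac12$ do nothing. Finally eliminate all deficiencies by flipping the colors on the appropriate alternating path, selecting uniformly from the two edges with the same color incident to deficient vertices. (3) With probability $\frac14$, select three colors uniformly from all $\binom{k}{3}$ unordered triples, and select uniformly one of the three as distinguished. Let $c''$ be the distinguished color and $c,c'$ the other two. Let $H$ be the subgraph consisting of the edges of colors $c$ and $c'$; its components are again cycles. Select one of the following: (a) with probability $\frac12$, do nothing; (b) with probability $\frac12$, uniformly select a sub-path of $H$ with even length (even number of edges). Flip the colors in the selected sub-path. The number of deficient vertices is then even. If there are two deficient vertices, select one of them uniformly. If there is no deficient vertex, select uniformly a non-deficient vertex. - If a deficient vertex $v$ is selected, let $\tilde c$ be its repeated color. Consider the maximal alternating cycle with colors $\tilde c$ and $c''$ that contains $v$, and flip the colors in this cycle. - If a non-deficient vertex is selected, let $e$ be its incident edge of color $c''$. Select uniformly from its incident edges of color $c$ or $c'$; let the selected edge be $f$ and its color $\tilde c$. Take the maximal alternating cycle with colors $c''$ and $\tilde c$ that contains $e$ and $f$, and flip the colors in this cycle. Finally eliminate all deficiencies by flipping the colors on the appropriate alternating path, selecting uniformly from the two edges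 with the same color incident to deficient vertices. **Diameter.** The diameter of $M(G,k)$ is the maximum, over pairs of states, of the minimum number of positive-probability transitions needed to get from one to the other. **Metropolis-Hastings algorithm (variant used).** A proposal $C_2$ is drawn from the current state $C_1$ by the primary chain via some way $w$; $P(C_2,w\mid C_1)$ is the probability that $C_2$ is proposed from $C_1$ via way $w$, and each way $w$ from $C_1$ to $C_2$ has a corresponding inverse way $w'$ from $C_2$ to $C_1$ (a one-to-one correspondence). For the uniform target distribution the proposal is accepted with probability $\min\left\{1,\frac{P(C_1,w'\mid C_2)}{P(C_2,w\mid C_1)}\right\}$, and otherwise the chain stays at $C_1$. A way $w$ in $M(G,k)$ consists of the selection of 2 or 3 colors (with the distinguished color if there are 3), followed by three consecutive transformations: $\varphi_1^{-1}$ (flipping the colors on the selected subgraph, creating at most two deficient vertices), $f$ (the subsequent perturbation, i.e. the change of color of one edge, the flip along a cycle involving $c''$, or nothing), and $\varphi_2$ (elimination of all deficiencies); the inverse way $w'$ selects the same colors and applies $\varphi_2^{-1}$, $f^{-1}$, $\varphi_1$. If nothing is done, the ratio is $1$. The bound on the inverse of the acceptance ratio means that for all states $C_1,C_2$ and every way $w$ by which $C_2$ can be proposed from $C_1$ the inverse of the acceptance probability is at most the stated quantity.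
   Formalization: A way of step (2) that first flips a whole cycle is taken as its own inverse way, because the literal reversed way has probability 0 (no deficiency to eliminate) and would break the bound; the vertex set is also assumed nonempty. *)

(* Defs.v *)
From HB Require Import structures.
From mathcomp Require Import all_boot all_order all_algebra perm.
Set Implicit Arguments.
Unset Strict Implicit.
Unset Printing Implicit Defensive.

Import GRing.Theory Num.Theory.
Local Open Scope ring_scope.

(* Probability mass functions on finite types, valued in rat. *)

Definition pmf (T : finType) := T -> rat.

Definition ret (T : finType) (x : T) : pmf T := fun y => (y == x)%:R.

(* When A is a singleton this deterministically picks "the" element of A. *)
Definition unif (T : finType) (A : {set T}) : pmf T :=
  fun y => (y \in A)%:R / #|A|%:R.

Definition coin (T : finType) (p q : pmf T) : pmf T :=
  fun y => 1/2 * p y + 1/2 * q y.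

Definition bind (S T : finType) (p : pmf S) (f : S -> pmf T) : pmf T :=
  fun y => \sum_(x : S) p x * f x y.

Section Graph.

Variables (V : finType) (adj : rel V).

Definition simple_graph : Prop := symmetric adj /\ irreflexive adj.

Definition regular (k : nat) : Prop := forall v, #|[set w | adj v w]| = k.

Definition balanced_bipartite : Prop :=
  exists X : {set V},
    (forall u v, adj u v -> (u \in X) != (v \in X)) /\ #|X| = #|~: X|.

Definition is_edge (A : {set V}) : bool :=
  [exists u, exists v, adj u v && (A == [set u; v])].

Definition edge := {A : {set V} | is_edge A}.

Definition incident (v : V) (e : edge) : bool := v \in val e.

Definition adjacent (e f : edge) : bool :=
  (e != f) && [exists v, incident v e && incident v f].

(* The edges joining consecutive vertices of a sequence; in the cyclic version
   the last vertex is also followed by the first one. *)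
Definition walk_edges (s : seq V) : {set edge} :=
  [set e : edge | has (fun p => val e == [set p.1; p.2]) (zip s (behead s))].

Definition cycle_edges (s : seq V) : {set edge} :=
  [set e : edge | has (fun p => val e == [set p.1; p.2]) (zip s (rot 1 s))].

Definition is_path (A : {set edge}) : bool :=
  [exists n : 'I_#|V|.+1, exists s : n.-tuple V,
    [&& uniq s, sorted adj s & A == walk_edges s]].

Definition is_cycle (A : {set edge}) : bool :=
  [exists n : 'I_#|V|.+1, exists s : n.-tuple V,
    [&& (2 < n)%N, uniq s, cycle adj s & A == cycle_edges s]].

(* Connected subgraphs are represented by their edge sets, and have at least one
   edge. *)
Definition is_connected (A : {set edge}) : bool :=
  (A != set0) &&
  [forall e in A, forall f in A,
    connect (fun e f => [&& e \in A, f \in A & adjacent e f]) e f].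

Section Colorings.

Variable k : nat.

Definition precoloring := {ffun edge -> 'I_k}.

Definition proper (D : precoloring) : bool :=
  [forall e, forall f, adjacent e f ==> (D e != D f)].

Definition coloring := {D : precoloring | proper D}.

Definition flip (a b : 'I_k) (A : {set edge}) (D : precoloring) : precoloring :=
  [ffun e => if e \in A then tperm a b (D e) else D e].

Definition two_colored (D : precoloring) (a b : 'I_k) : {set edge} :=
  [set e | (D e == a) || (D e == b)].

Definition colored_at (D : precoloring) (v : V) (c : 'I_k) : {set edge} :=
  [set e | incident v e & D e == c].

(* v has a (+a-b)-deficiency in D *)
Definition deficiency (D : precoloring) (v : V) (a b : 'I_k) : bool :=
  [&& #|colored_at D v a| == 2%N,
      [forall c, (c != a) ==> (#|colored_at D v c| <= 1)%N]
    & colored_at D v b == set0].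

Definition deficients (D : precoloring) : {set V} :=
  [set v | [exists a, exists b, deficiency D v a b]].

(* The two edges of the repeated color at a deficient vertex. *)
Definition repeated_edges (D : precoloring) (v : V) : {set edge} :=
  [set e | incident v e & [exists b, deficiency D v (D e) b]].

Definition alternating (D : precoloring) (a b : 'I_k) (A : {set edge}) : bool :=
  (A \subset two_colored D a b) &&
  [forall e in A, forall f in A, adjacent e f ==> (D e != D f)].

(* Simple alternating cycles are automatically maximal: the edge set of a simple
   cycle is never properly contained in that of another one. *)
Definition alternating_cycle (D : precoloring) (a b : 'I_k) (K : {set edge}) :
    bool :=
  is_cycle K && alternating D a b K.

Definition alternating_path_from (D : precoloring) (a b : 'I_k)
    (v : V) (e : edge) (s : seq V) : bool :=
  if s is x :: y :: _ then
    [&& x == v, val e == [set x; y], uniq s, sorted adj s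
      & alternating D a b (walk_edges s)]
  else false.

Definition max_alternating_path (D : precoloring) (a b : 'I_k)
    (v : V) (e : edge) (B : {set edge}) : bool :=
  [exists n : 'I_#|V|.+1, exists s : n.-tuple V,
    [&& alternating_path_from D a b v e s,
        [forall y, ~~ alternating_path_from D a b v e (rcons s y)]
      & B == walk_edges s]].

(* The first transformation: the edge set to be flipped, in step (2) and in
   step (3). *)

Definition connected_subgraphs (D : precoloring) (c c' : 'I_k) :
    {set {set edge}} :=
  [set A | is_connected A & A \subset two_colored D c c'].

Definition even_subpaths (D : precoloring) (c c' : 'I_k) : {set {set edge}} :=
  [set A | [&& is_path A, A != set0, ~~ odd #|A|
             & A \subset two_colored D c c']].

Definition select2 (D : precoloring) (c c' : 'I_k) : pmf {set edge} :=
  coin (ret set0) (unif (connected_subgraphs D c c')).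

Definition select3 (D : precoloring) (c c' : 'I_k) : pmf {set edge} :=
  coin (ret set0) (unif (even_subpaths D c c')).

(* The second transformation: in step (2) a set of at most one edge on which c
   and c' are exchanged; in step (3) a color ct and a cycle on which ct and c''
   are exchanged. *)

Definition perturb2 (D : precoloring) (c c' : 'I_k) : pmf {set edge} :=
  if deficients D != set0 then
    bind (unif (deficients D)) (fun v =>
    bind (unif (repeated_edges D v)) (fun e => ret [set e]))
  else
    coin (ret set0)
         (bind (unif (two_colored D c c')) (fun e => ret [set e])).

Definition perturb3 (D : precoloring) (c c' c'' : 'I_k) :
    pmf ('I_k * {set edge})%type :=
  if deficients D != set0 then
    bind (unif (deficients D)) (fun v =>
    unif [set x : 'I_k * {set edge} |
      [&& [exists b, deficiency D v x.1 b],
          alternating_cycle D x.1 c'' x.2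
        & [exists e in x.2, incident v e]]])
  else
    bind (unif [set: V]) (fun v =>
    bind (unif [set f in two_colored D c c' | incident v f]) (fun f =>
    unif [set x : 'I_k * {set edge} |
      [&& x.1 == D f,
          alternating_cycle D (D f) c'' x.2,
          f \in x.2
        & [exists e in x.2, incident v e && (D e == c'')]]])).

(* The third transformation: the edge set flipped to eliminate the deficiencies.
   The two deficient vertices lie on one (c, c')-cycle, and eliminating one
   deficiency along either arc also eliminates the other. *)
Definition eliminate (D : precoloring) : pmf {set edge} :=
  if deficients D != set0 then
    bind (unif (deficients D)) (fun v =>
    bind (unif (repeated_edges D v)) (fun e =>
    unif [set B | [exists b, deficiency D v (D e) b &&
                             max_alternating_path D (D e) b v e B]]))
  else ret set0.

(* A way is the selection of colors together with the three transformations, each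
   recorded by the edges it recolors:
   - Idle          step (1);
   - Way2 c c' A F B         step (2), unordered pair {c, c'} with c < c';
   - Way3 c c' c'' A ct F B  step (3), distinguished color c'', other colors
                             c < c', cycle flip on F exchanging ct and c''. *)
Inductive way :=
  | Idle
  | Way2 of 'I_k & 'I_k & {set edge} & {set edge} & {set edge}
  | Way3 of 'I_k & 'I_k & 'I_k & {set edge} & 'I_k & {set edge} & {set edge}.

Definition way_code (w : way) :=
  match w with
  | Idle => None
  | Way2 c c' A F B => Some (inl (c, c', A, F, B))
  | Way3 c c' c'' A ct F B => Some (inr (c, c', c'', A, ct, F, B))
  end.

Definition way_decode x :=
  match x with
  | None => Idle
  | Some (inl (c, c', A, F, B)) => Way2 c c' A F B
  | Some (inr (c, c', c'', A, ct, F, B)) => Way3 c c' c'' A ct F B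
  end.

Lemma way_codeK : cancel way_code way_decode.
Proof. by case. Qed.

HB.instance Definition _ := Finite.copy way (can_type way_codeK).

(* Choosing two (three) colors is impossible for k < 2 (k < 3); the chain then
   does nothing. *)
Definition idle_prob : rat :=
  1/2 + (if (k < 2)%N then 1/4 else 0) + (if (k < 3)%N then 1/4 else 0).

(* P(C2, w | C1) *)
Definition way_prob (C1 : coloring) (w : way) (C2 : coloring) : rat :=
  match w with
  | Idle => idle_prob * (C2 == C1)%:R
  | Way2 c c' A F B =>
      let D1 := flip c c' A (val C1) in
      let D2 := flip c c' F D1 in
      let D3 := flip c c' B D2 in
      1/4 * ((c < c')%N%:R / 'C(k, 2)%:R)
      * select2 (val C1) c c' A
      * perturb2 D1 c c' F
      * eliminate D2 B
      * (val C2 == D3)%:R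
  | Way3 c c' c'' A ct F B =>
      let D1 := flip c c' A (val C1) in
      let D2 := flip ct c'' F D1 in
      let D3 := flip c c' B D2 in
      1/4 * ([&& (c < c')%N, c'' != c & c'' != c']%:R / 'C(k, 3)%:R * (1/3))
      * select3 (val C1) c c' A
      * perturb3 D1 c c' c'' (ct, F)
      * eliminate D2 B
      * (val C2 == D3)%:R
  end.

(* The inverse way applies the inverse transformations in reverse order; every
   flip is its own inverse.  If the first flip of step (2) is along a whole cycle
   it creates no deficiency, so it cannot be undone by an elimination (which
   flips nothing when no vertex is deficient); all flips of such a way commute
   and the way is its own inverse. *)
Definition inverse_way (w : way) : way :=
  match w with
  | Idle => Idle
  | Way2 c c' A F B =>
      if is_cycle A then Way2 c c' A F B else Way2 c c' B F A
  | Way3 c c' c'' A ct F B => Way3 c c' c'' B ct F A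
  end.

Definition acceptance (C1 : coloring) (w : way) (C2 : coloring) : rat :=
  Num.min 1 (way_prob C2 (inverse_way w) C1 / way_prob C1 w C2).

Definition transition (C1 C2 : coloring) : rat :=
  \sum_(w : way) way_prob C1 w C2.

Fixpoint reachable_in (n : nat) (C1 C2 : coloring) : bool :=
  if n is m.+1 then
    [exists C, (0 < transition C1 C) && reachable_in m C C2]
  else C1 == C2.

Definition is_distance (C1 C2 : coloring) (d : nat) : Prop :=
  reachable_in d C1 C2 /\ forall n, reachable_in n C1 C2 -> (d <= n)%N.

Definition distances_le (D : nat) : Prop :=
  forall C1 C2, exists2 d, is_distance C1 C2 d & (d <= D)%N.

(* D is the maximum of all distances; in particular every state is reachable
   from every other one. *)
Definition is_diameter (D : nat) : Prop :=
  distances_le D /\ forall D', distances_le D' -> (D <= D')%N.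

End Colorings.

End Graph.

Arguments coloring {V} adj k.
Arguments way {V} adj k.
Arguments way_prob {V adj k} C1 w C2.
Arguments acceptance {V adj k} C1 w C2.
Arguments is_diameter {V} adj k D.

(* Main.v *)
(* Diameter. The transitions are followed on almost colorings instead of
   colorings. An almost coloring whose two deficient vertices lack or repeat the
   colors a, b becomes proper when an alternating path between these vertices is
   flipped; if D' is a perturbation of D, then any proper coloring obtained in
   this way from D has a transition to any one obtained from D'. Fix a target
   coloring and one of its color classes, say a. A deficient vertex w without
   color a, repeating b, is incident with an edge g = wx of the target class.
   Flip an alternating cycle through w to give g the color b; recolor g from b to
   a; recolor the other a-edge xy at x from a to b. This moves the deficiency
   from w to y, and at most three steps have gained one edge of the target class.
   When y is the other deficient vertex, the coloring is proper. Applied to all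
   color classes in turn, this gives 3|E|.

   Acceptance. A way and its inverse pass through the same almost colorings, and
   every choice other than that of the first flipped subgraph is made among
   boundedly many objects, or O(|V|) when nothing is flipped first. A path
   alternating in two colors of a proper coloring is determined by its first
   vertex, its first color and its length, hence there are at most 2|V|^2
   connected subgraphs and 2|V|(|V|-1) even paths to select from. *)

Require Import Defs.
From mathcomp Require Import all_boot all_order all_algebra.
From mathcomp Require Import perm zify ring lra.
Set Implicit Arguments.
Unset Strict Implicit.
Unset Printing Implicit Defensive.
Import Order.TTheory GRing.Theory Num.Theory.

(** * Walks and cycles as edge sets *)

(** The eliminations are random, so no single coloring can be prescribed as the next state. Only the
    deficient states are planned: the first flip of a transition can undo the elimination of the
    previous one, so the plan can be followed whichever arcs were flipped. The bipartition makes
    alternating walks directed, so that a walk leaving one deficient vertex ends at the other. It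
    also makes the cycle through [w] exist although [w] is deficient: the other deficient vertex
    lies on the same side, where it could be entered only with the color that it lacks. That [w]
    lacks [a] while the other vertex repeats it makes the joining arcs even, as step (3) demands.
    The same parity governs the acceptance ratio: the two deficient vertices repeat different
    colors, so the cycle of step (3) is unique and the inverse way possible. The constant is
    2|V|(|V|-1) for the even path, times 2 for the deficient vertex of the perturbation, times 4 for
    the vertex and edge of the elimination. Step (2) costs at most 8|V|^2, which is no larger
    because |V| is at least 2. *)

Lemma zip_rot (S T : Type) n (s : seq S) (t : seq T) : size s = size t ->
  zip (rot n s) (rot n t) = rot n (zip s t).
Proof.
move=> Es; have := unzip2_zip (eq_leq (esym Es)).
have := unzip1_zip (eq_leq Es); move: (zip s t) => p <- <-.
by rewrite /unzip1 /unzip2 -!map_rot zip_unzip.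
Qed.

Section Walks.

Variables (V : finType) (adj : rel V).
Hypotheses (adjC : symmetric adj) (adjN : irreflexive adj).
Implicit Types (e f g h : edge adj) (A B F T : {set edge adj}).
Implicit Types (u v w x y z p q : V) (s t : seq V).

Lemma edge_ends e : exists u v, adj u v /\ val e = [set u; v].
Proof.
case/existsP: (valP e) => u /existsP[v /andP[uv /eqP ->]].
by exists u, v.
Qed.

Lemma edge_neq e u v : val e = [set u; v] -> u != v.
Proof.
have [x [y [xy Exy]]] := edge_ends e; move=> Euv.
have /eqP : #|[set u; v]| = 2.
  by rewrite -Euv Exy cards2; case: eqP xy => // ->; rewrite adjN.
by rewrite cards2; case: (u != v).
Qed.

Lemma edge_adj e u v : val e = [set u; v] -> adj u v.
Proof.
move=> Euv; have uDv := edge_neq Euv.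
have [x [y [xy Exy]]] := edge_ends e; rewrite {}Euv in Exy.
have: (u \in [set x; y]) && (v \in [set x; y]).
  by rewrite -Exy !inE !eqxx orbT.
by rewrite !inE => /andP[/orP[]/eqP Eu /orP[]/eqP Ev]; subst => //;
  rewrite ?eqxx // in uDv; rewrite adjC.
Qed.

Lemma adj_edge u v : adj u v -> exists e, val e = [set u; v].
Proof.
move=> uv; have Huv : is_edge adj [set u; v].
  by apply/existsP; exists u; apply/existsP; exists v; rewrite uv eqxx.
by exists (Sub [set u; v] Huv).
Qed.

Lemma incidentl e u v : val e = [set u; v] -> incident u e.
Proof. by rewrite /incident => ->; rewrite !inE eqxx. Qed.

Lemma incidentr e u v : val e = [set u; v] -> incident v e.
Proof. by rewrite /incident => ->; rewrite !inE eqxx orbT. Qed.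

Lemma incidentE e u v w : val e = [set u; v] ->
  incident w e = (w == u) || (w == v).
Proof. by rewrite /incident => ->; rewrite !inE. Qed.

Lemma incident_other e v : incident v e -> exists w, val e = [set v; w].
Proof.
have [x [y [_ Exy]]] := edge_ends e.
rewrite (incidentE _ Exy) => /orP[]/eqP->; first by exists y.
by exists x; rewrite Exy setUC.
Qed.

Lemma other_end_inj e u v w : val e = [set u; v] -> val e = [set u; w] -> v = w.
Proof.
move=> Ev Ew; have := incidentr Ev; rewrite (incidentE _ Ew).
by rewrite eq_sym (negPf (edge_neq Ev)) => /eqP.
Qed.

Lemma card_incident v : #|[set e : edge adj | incident v e]| = #|[set w | adj v w]|.
Proof.
rewrite -(card_imset _ val_inj).
rewrite -(card_in_imset (f := fun w => [set v; w]) (D := [set w | adj v w])).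
  apply: eq_card => /= A; apply/imsetP/imsetP => [[e]|[w]]; rewrite inE.
    move=> /incident_other[w Ew] ->; exists w => //.
    by rewrite inE (edge_adj Ew).
  move=> /adj_edge[e Ee] ->; exists e; rewrite ?inE //; exact: incidentl Ee.
move=> w w'; rewrite !inE => /adj_edge[e Ee] _ /= Ew.
exact: other_end_inj Ee (etrans Ee Ew).
Qed.

Lemma walk_edges_cons x y s e : (e \in walk_edges adj [:: x, y & s]) =
  (val e == [set x; y]) || (e \in walk_edges adj (y :: s)).
Proof. by rewrite !inE. Qed.

Lemma walk_edges1 x e : e \in walk_edges adj [:: x] = false.
Proof. by rewrite inE. Qed.

Lemma walk_edges_cat s1 x s2 e : (e \in walk_edges adj (s1 ++ x :: s2)) =
  (e \in walk_edges adj (rcons s1 x)) || (e \in walk_edges adj (x :: s2)).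
Proof.
elim: s1 => [|y [|z s1] IH]; first by rewrite walk_edges1.
  by rewrite /= !walk_edges_cons walk_edges1 orbF.
by rewrite /= !walk_edges_cons [e \in walk_edges _ (z :: s1 ++ _)]IH orbA.
Qed.

Lemma walk_edges_rcons s x y e : (e \in walk_edges adj (rcons (rcons s x) y)) =
  (e \in walk_edges adj (rcons s x)) || (val e == [set x; y]).
Proof.
rewrite -[rcons (rcons s x) y]cats1 cat_rcons.
by rewrite walk_edges_cat walk_edges_cons walk_edges1 orbF.
Qed.

Lemma walk_edges_rev s : walk_edges adj (rev s) = walk_edges adj s.
Proof.
apply/setP => e; elim: s => [|x [|y s] IH] //.
rewrite walk_edges_cons -IH !rev_cons walk_edges_rcons.
by rewrite orbC setUC.
Qed.

Lemma walk_edges_mem s e v : e \in walk_edges adj s -> incident v e -> v \in s.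
Proof.
elim: s => [|x [|y s] IH]; [by rewrite inE | by rewrite inE |].
rewrite walk_edges_cons => /orP[/eqP Ee|es] ve.
  by move: ve; rewrite (incidentE _ Ee) !inE; case/orP=> ->; rewrite ?orbT.
by rewrite in_cons IH ?orbT.
Qed.

Lemma walk_edges_head x y s e : x \notin y :: s ->
  e \in walk_edges adj [:: x, y & s] -> incident x e -> val e = [set x; y].
Proof.
move=> xs; rewrite walk_edges_cons => /orP[/eqP //|es xe].
by rewrite (walk_edges_mem es xe) in xs.
Qed.

Lemma walk_edges_last x s e f : uniq (x :: s) ->
  e \in walk_edges adj (x :: s) -> f \in walk_edges adj (x :: s) ->
  incident (last x s) e -> incident (last x s) f -> e = f.
Proof.
move: s => [|y s]; first by rewrite walk_edges1.
have -> : last x (y :: s) = last y s by [].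
have -> : [:: x, y & s] = rcons (x :: belast y s) (last y s).
  by rewrite rcons_cons -lastI.
rewrite (lastI x (belast y s)) rcons_uniq !walk_edges_rcons => /andP[Us _].
move=> /orP[es|/eqP Ee] /orP[fs|/eqP Ef] ve vf.
- by rewrite (walk_edges_mem es ve) in Us.
- by rewrite (walk_edges_mem es ve) in Us.
- by rewrite (walk_edges_mem fs vf) in Us.
- by apply/val_inj; rewrite Ee Ef.
Qed.

Lemma cycle_edgesE x s : cycle_edges adj (x :: s) =
  walk_edges adj (x :: rcons s x).
Proof.
apply/setP => e; rewrite !inE rot1_cons /=; congr (has _ _).
have -> : x :: rcons s x = (x :: s) ++ [:: x] by rewrite cats1.
rewrite -{2}[rcons s x]cats0 zip_cat ?size_rcons //.
by rewrite cats0.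
Qed.

Lemma cycle_edges_rot n s : cycle_edges adj (rot n s) = cycle_edges adj s.
Proof.
apply/setP => e; rewrite !inE rot_rot.
by rewrite zip_rot ?size_rot // has_rot.
Qed.

Definition edges_at T v : {set edge adj} := [set e in T | incident v e].

Lemma path_edge x s y : path adj x s -> y \in s ->
  exists p, exists2 e, val e = [set p; y] & e \in walk_edges adj (x :: s).
Proof.
move=> xs /splitPr sy; case: sy xs => s1 s2; rewrite cat_path /=.
case/and3P=> _ /adj_edge[e Ee] _; exists (last x s1), e => //.
rewrite -cat_cons walk_edges_cat; apply/orP; left.
by rewrite (lastI x s1) walk_edges_rcons Ee eqxx orbT.
Qed.

(** Interior vertices have both of their [T]-edges on the path, the two ends exactly one, all other
    vertices none. This parity later places the deficiencies at the ends of a flipped path. *)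
Lemma walk_boundary x y s T z e1 e2 :
    uniq [:: x, y & s] -> path adj x (y :: s) ->
    walk_edges adj [:: x, y & s] \subset T ->
    edges_at T z = [set e1; e2] -> e1 != e2 ->
  (e1 \in walk_edges adj [:: x, y & s]) (+)
  (e2 \in walk_edges adj [:: x, y & s]) = (z == x) || (z == last y s).
Proof.
move=> Us Ps sT Ez e12; set B := walk_edges _ _ in sT *.
have one e : e \in B -> incident z e ->
    (forall f, f \in B -> incident z f -> f = e) -> (e1 \in B) (+) (e2 \in B).
  move=> eB ze Be; have: e \in edges_at T z by rewrite inE ze (subsetP sT).
  have /andP[_ z1] : (e1 \in T) && incident z e1.
    by have := set21 e1 e2; rewrite -Ez inE.
  have /andP[_ z2] : (e2 \in T) && incident z e2.
    by have := set22 e1 e2; rewrite -Ez inE.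
  rewrite Ez => /set2P[]Ee; rewrite -Ee eB.
    case e2B: (e2 \in B) => //.
    by move: e12; rewrite (Be _ e2B z2) Ee eqxx.
  case e1B: (e1 \in B) => //.
  by move: e12; rewrite (Be _ e1B z1) Ee eqxx.
have [zs|zs] := boolP (z \in [:: x, y & s]); last first.
  have nB e : e \in edges_at T z -> e \in B = false.
    rewrite inE => /andP[_ ze]; apply: contraNF zs => eB.
    exact: walk_edges_mem eB ze.
  rewrite !nB ?Ez ?set21 ?set22 //=; apply/esym/negbTE.
  by apply: contra zs => /orP[]/eqP->; rewrite ?mem_head // inE mem_last orbT.
have [Ezx|zx] := eqVneq z x.
  subst z; have [e Ee] : exists e, val e = [set x; y].
    by apply: adj_edge; case/andP: Ps.
  apply: (one e).
  - by rewrite walk_edges_cons Ee eqxx.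
  - exact: incidentl Ee.
  - move=> f fB xf; apply/val_inj; rewrite Ee; apply: walk_edges_head fB xf.
    by case/andP: Us.
have zys : z \in y :: s by move: zs; rewrite inE (negPf zx).
have [Ezl|zl] := eqVneq z (last y s).
  have [p [e Ee eB]] := path_edge Ps zys.
  apply: (one e eB (incidentr Ee)) => f fB zf.
  by apply: (walk_edges_last Us fB eB); rewrite /= -Ezl ?(incidentr Ee).
have both: exists g h, [/\ g \in B, h \in B, g != h, incident z g & incident z h].
  rewrite -[last y s]/(last x (y :: s)) in zl.
  move: Us Ps zl; rewrite /B; case/splitPr: zys => s1 [|q s2].
    by rewrite cats1 last_rcons eqxx.
  rewrite -cat_cons cat_path => Us /andP[_ /and3P[/adj_edge[g Eg]]].
  move=> /adj_edge[h Eh] _ _; exists g, h.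
  split; [| | |exact: incidentr Eg | exact: incidentl Eh].
  - by rewrite walk_edges_cat (lastI x s1) walk_edges_rcons Eg eqxx orbT.
  - by rewrite walk_edges_cat walk_edges_cons Eh eqxx orbT.
  apply: contraTneq Us => Egh; rewrite setUC Egh in Eg.
  rewrite cat_uniq (other_end_inj Eh Eg) !negb_and negbK /=.
  by rewrite mem_last !orbT.
case: both => g [h [gB hB gh zg zh]].
have : g \in edges_at T z by rewrite inE zg (subsetP sT).
have : h \in edges_at T z by rewrite inE zh (subsetP sT).
rewrite Ez => /set2P[]Eh /set2P[]Eg; move: gB hB gh; rewrite Eg Eh ?eqxx //.
  by move=> -> ->.
by move=> -> ->.
Qed.

Lemma card_walk_edges x s : path adj x s -> uniq (x :: s) ->
  #|walk_edges adj (x :: s)| = size s.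
Proof.
elim: s x => [|y s IH] x.
  by move=> _ _; apply: eq_card0 => e; rewrite walk_edges1.
move=> /= /andP[/adj_edge[e Ee] ys] /andP[xs Us]; rewrite -(IH y ys Us).
have -> : walk_edges adj [:: x, y & s] = e |: walk_edges adj (y :: s).
  by apply/setP => f; rewrite walk_edges_cons in_setU1 -Ee (inj_eq val_inj).
rewrite cardsU1 (contraNN _ xs) // => es.
exact: walk_edges_mem es (incidentl Ee).
Qed.

Lemma edges_at_pair T z g h f : #|edges_at T z| <= 2 ->
  g \in edges_at T z -> h \in edges_at T z -> f \in edges_at T z ->
  g != h -> f = g \/ f = h.
Proof.
move=> T2 gz hz fz gh; apply/set2P; suff -> : [set g; h] = edges_at T z by [].
apply/eqP; rewrite eqEcard cards2 gh T2 andbT.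
by apply/subsetP => e /set2P[]->.
Qed.

(** After entering a vertex of degree at most 2 there is only one way on, so the two paths cannot
    branch. The degree bound leaves out the start [p], which may be a deficient vertex with three
    edges in [T]. *)
Lemma walk_prefix T p q s1 s2 :
    {in q :: s1, forall z, #|edges_at T z| <= 2} ->
    uniq [:: p, q & s1] -> uniq [:: p, q & s2] ->
    path adj p (q :: s1) -> path adj p (q :: s2) ->
    walk_edges adj [:: p, q & s1] \subset T ->
    walk_edges adj [:: p, q & s2] \subset T ->
  (exists r, s2 = s1 ++ r) \/ (exists r, s1 = s2 ++ r).
Proof.
elim: s1 s2 p q => [|r1 s1 IH] s2 p q; first by left; exists s2.
case: s2 => [|r2 s2] T2 U1 U2 P1 P2 sT1 sT2; first by right; exists (r1 :: s1).
have tl r s : walk_edges adj [:: p, q, r & s] \subset T ->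
    walk_edges adj [:: q, r & s] \subset T.
  apply: subset_trans; apply/subsetP => e.
  by rewrite [e \in walk_edges _ (p :: _)]walk_edges_cons orbC => ->.
have Er : r1 = r2.
  case/and3P: P1 => /adj_edge[e Ee] /adj_edge[f1 Ef1] _.
  case/and3P: P2 => _ /adj_edge[f2 Ef2] _.
  have eT : e \in edges_at T q.
    rewrite inE (incidentr Ee) (subsetP sT1) //.
    by rewrite walk_edges_cons Ee eqxx.
  have f1T : f1 \in edges_at T q.
    rewrite inE (incidentl Ef1) (subsetP (tl _ _ sT1)) //.
    by rewrite walk_edges_cons Ef1 eqxx.
  have f2T : f2 \in edges_at T q.
    rewrite inE (incidentl Ef2) (subsetP (tl _ _ sT2)) //.
    by rewrite walk_edges_cons Ef2 eqxx.
  have neq r f s : val f = [set q; r] -> uniq [:: p, q, r & s] -> e != f.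
    move=> Ef; apply: contraTneq => eEf.
    rewrite setUC eEf in Ee; rewrite (other_end_inj Ef Ee).
    by rewrite /= !inE eqxx !orbT.
  have := edges_at_pair (T2 q (mem_head _ _)) eT f1T f2T (neq _ _ _ Ef1 U1).
  case=> Ef; first by move: (neq _ _ _ Ef2 U2); rewrite Ef eqxx.
  by apply: other_end_inj Ef1 _; rewrite -Ef.
subst r2; case: (IH s2 q r1) => //.
- by move=> z zs; apply: T2; rewrite inE zs orbT.
- by case/andP: U1.
- by case/andP: U2.
- by case/andP: P1.
- by case/andP: P2.
- exact: tl sT1.
- exact: tl sT2.
- by case=> r ->; left; exists r.
- by case=> r ->; right; exists r.
Qed.

Lemma closed_walk_at v q t z e : uniq [:: v, q & rcons t z] ->
  e \in walk_edges adj [:: v, q & rcons (rcons t z) v] -> incident v e ->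
  val e = [set v; q] \/ val e = [set v; z].
Proof.
move=> Uv; rewrite walk_edges_cons -!rcons_cons walk_edges_rcons.
move=> /or3P[/eqP->|es|/eqP->]; [by left| |by right; rewrite setUC].
by move=> /(walk_edges_mem es) vs; rewrite cons_uniq vs in Uv.
Qed.

(** Rotating the cycle to start at [v] makes [g] its first or its last edge; in the second case the
    cycle is reversed. Writing the rest as [rcons t z] displays the neighbor [z] through which the
    cycle returns. *)
Lemma cycle_from v g F : is_cycle F -> g \in F -> incident v g ->
  exists q t z, [/\ val g = [set v; q], uniq [:: v, q & rcons t z],
    path adj v (q :: rcons (rcons t z) v) &
    F = walk_edges adj [:: v, q & rcons (rcons t z) v]].
Proof.
case/existsP=> n /existsP[[s /= /eqP Ss]] /and4P[n2 Us Cs /eqP->].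
move=> gF vg; have vs: v \in s.
  case: (s) gF => [|x t]; first by rewrite inE.
  rewrite cycle_edgesE => /walk_edges_mem/(_ vg).
  by rewrite !(inE, mem_rcons) => /or3P[]->; rewrite ?orbT.
have [i t0 Es] := rot_to vs.
move: gF; rewrite -(cycle_edges_rot i s) Es cycle_edgesE.
have : uniq (v :: t0) by rewrite -Es rot_uniq.
have : cycle adj (v :: t0) by rewrite -Es rot_cycle.
have : 2 < size (v :: t0) by rewrite -Es size_rot Ss.
case: t0 {Es} => [|q t0] //; case/lastP: t0 => [|t z] // _ Pv Uv gF.
case: (closed_walk_at Uv gF vg) => Eg; first by exists q, t, z.
have Er : z :: rcons (rev t) q = rev (q :: rcons t z).
  by rewrite rev_cons rev_rcons.
have U' : uniq [:: v, z & rcons (rev t) q].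
  by rewrite Er cons_uniq mem_rev rev_uniq.
have P' : path adj v (z :: rcons (rcons (rev t) q) v).
  have := rev_path adj v (q :: rcons (rcons t z) v).
  rewrite -!rcons_cons last_rcons belast_rcons rev_cons -Er.
  by move=> ->; rewrite (eq_path (e' := adj)) // => x y; rewrite adjC.
exists z, (rev t), q; split=> //.
rewrite -walk_edges_rev rev_cons rev_rcons rev_cons.
by rewrite rev_rcons !rcons_cons.
Qed.

Lemma cycle_edges_at F v g : is_cycle F -> g \in F -> incident v g ->
  exists2 h, g != h & edges_at F v = [set g; h].
Proof.
move=> cF gF vg; have [q [t [z [Eg Uv Pv EF]]]] := cycle_from cF gF vg.
have [h Eh] : exists h, val h = [set v; z].
  move: Pv => /=; rewrite rcons_path last_rcons => /and3P[_ _].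
  by rewrite adjC => /adj_edge.
exists h.
  apply: contraTneq Uv => gh; rewrite -gh in Eh.
  by rewrite (other_end_inj Eg Eh) /= mem_rcons !inE eqxx andbF.
apply/setP => f; rewrite !inE; apply/andP/orP=> [[fF vf]|].
  rewrite EF in fF; rewrite -!(inj_eq val_inj) /= Eg Eh.
  by case: (closed_walk_at Uv fF vf) => ->; rewrite eqxx; [left|right].
case=> /eqP->; first by [].
rewrite (incidentl Eh) EF -!rcons_cons walk_edges_rcons Eh [[set v; z]]setUC.
by rewrite eqxx orbT.
Qed.

(** The exception at [v] is the point: a deficient vertex has degree 3 in its repeated color and the
    distinguished color together. Having to use the edge [g] there makes the cycle unique all the
    same. *)
Lemma cycle_uniq (S F1 F2 : {set edge adj}) v g : is_cycle F1 -> is_cycle F2 ->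
    F1 \subset S -> F2 \subset S ->
    (forall z, z != v -> #|edges_at S z| <= 2) ->
    g \in F1 -> g \in F2 -> incident v g ->
  F1 = F2.
Proof.
move=> c1 c2 s1 s2 S2 g1 g2 vg.
have [q1 [t1 [z1 [Eg1 U1 P1 E1]]]] := cycle_from c1 g1 vg.
have [q2 [t2 [z2 [Eg2 U2 P2 E2]]]] := cycle_from c2 g2 vg.
have Eq := other_end_inj Eg1 Eg2; rewrite -{}Eq {q2 Eg2} in U2 P2 E2.
suff step t z t' z' : uniq [:: v, q1 & rcons t z] ->
    uniq [:: v, q1 & rcons t' z'] ->
    path adj v (q1 :: rcons (rcons t z) v) ->
    path adj v (q1 :: rcons (rcons t' z') v) ->
    walk_edges adj [:: v, q1 & rcons (rcons t z) v] \subset S ->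
    walk_edges adj [:: v, q1 & rcons (rcons t' z') v] \subset S ->
    forall r, rcons t' z' = rcons t z ++ r -> rcons t' z' = rcons t z.
  have inS t z : walk_edges adj [:: v, q1 & rcons (rcons t z) v] \subset S ->
      walk_edges adj [:: v, q1 & rcons t z] \subset S.
    apply: subset_trans; apply/subsetP => e es.
    by rewrite -!rcons_cons walk_edges_rcons !rcons_cons es.
  rewrite E1 E2 in s1 s2 *.
  have [] := @walk_prefix S v q1 (rcons t1 z1) (rcons t2 z2) _ U1 U2 _ _
    (inS _ _ s1) (inS _ _ s2).
  - move=> z zs; apply: S2; apply: contraTneq U1 => <-.
    by rewrite cons_uniq zs.
  - by move: P1; rewrite -rcons_cons rcons_path => /andP[].
  - by move: P2; rewrite -rcons_cons rcons_path => /andP[].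
  - by case=> r Er; rewrite (step _ _ _ _ U1 U2 P1 P2 s1 s2 _ Er).
  - by case=> r Er; rewrite (step _ _ _ _ U2 U1 P2 P1 s2 s1 _ Er).
(* If one path extended the other properly, then [z], where the shorter cycle closes, would have
   three edges in [S]: back along the path, to [v], and on to [y]. *)
move=> Ut Ut' Pt Pt' sS sS' [|y r] Er; first by rewrite Er cats0.
exfalso; rewrite {}Er in Ut' Pt' sS'.
have E' : [:: v, q1 & rcons (rcons t z ++ y :: r) v] =
    [:: v, q1 & t] ++ [:: z, y & rcons r v].
  by rewrite rcons_cat cat_rcons.
have E : [:: v, q1 & rcons (rcons t z) v] = [:: v, q1 & t] ++ [:: z; v].
  by rewrite -!cats1 -catA.
have := Pt; rewrite -!rcons_cons !rcons_path last_rcons.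
move=> /andP[/andP[_ az] zv].
have zy : adj z y.
  move: Pt'; rewrite -[q1 :: _]/(behead [:: v, q1 & _]) E' /=.
  by rewrite cat_path /= => /and3P[_ _ /andP[_ /andP[]]].
have [e1 Ee1] := adj_edge az; have [e2 Ee2] := adj_edge zv.
have [e3 Ee3] := adj_edge zy.
have e1S : e1 \in edges_at S z.
  rewrite inE (incidentr Ee1) (subsetP sS) // E walk_edges_cat.
  by rewrite (lastI v (q1 :: t)) walk_edges_rcons Ee1 eqxx orbT.
have e2S : e2 \in edges_at S z.
  rewrite inE (incidentl Ee2) (subsetP sS) // E walk_edges_cat.
  by rewrite walk_edges_cons Ee2 eqxx orbT.
have e3S : e3 \in edges_at S z.
  rewrite inE (incidentl Ee3) (subsetP sS') // E' walk_edges_cat.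
  by rewrite walk_edges_cons Ee3 eqxx orbT.
have zDv : z != v by rewrite (edge_neq Ee2).
move: Ut'; have -> : [:: v, q1 & rcons t z ++ y :: r] =
    [:: v, q1 & t] ++ [:: z, y & r] by rewrite cat_rcons.
rewrite cat_uniq => /and3P[Ua Ub _].
rewrite setUC in Ee1.
have n12 : e1 != e2.
  apply: contraTneq Ua => e12; rewrite e12 in Ee1.
  move: (other_end_inj Ee1 Ee2) => /= Ev.
  by rewrite -{1}Ev /= mem_last.
have yUb : y \notin [:: v, q1 & t].
  by have /hasPn-> := Ub; rewrite // !inE eqxx orbT.
have [Ee|Ee] := edges_at_pair (S2 z zDv) e1S e2S e3S n12; rewrite Ee in Ee3.
  by rewrite -(other_end_inj Ee1 Ee3) mem_last in yUb.
by rewrite -(other_end_inj Ee2 Ee3) mem_head in yUb.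
Qed.

Lemma walk_connect A x y s e0 e : walk_edges adj [:: x, y & s] \subset A ->
    path adj x (y :: s) ->
    val e0 = [set x; y] -> e \in walk_edges adj [:: x, y & s] ->
  connect (fun e f => [&& e \in A, f \in A & adjacent e f]) e0 e.
Proof.
elim: s x y e0 => [|z s IH] x y e0 sA P E0; rewrite walk_edges_cons.
  by rewrite walk_edges1 orbF -E0 => /eqP/val_inj->; apply: connect0.
case/orP=> [|es]; first by rewrite -E0 => /eqP/val_inj->; apply: connect0.
case/and3P: (P) => _ /adj_edge[e1 E1] _.
have sA' : walk_edges adj [:: y, z & s] \subset A.
  apply: subset_trans sA; apply/subsetP => f fs.
  by rewrite walk_edges_cons fs orbT.
have P' : path adj y (z :: s) by case/andP: P.
apply: connect_trans (IH y z e1 sA' P' E1 es).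
have [->|e01] := eqVneq e0 e1; first exact: connect0.
apply/connect1/and3P; split.
- by apply: (subsetP sA); rewrite walk_edges_cons E0 eqxx.
- by apply: (subsetP sA'); rewrite walk_edges_cons E1 eqxx.
rewrite /adjacent e01; apply/existsP; exists y.
by rewrite (incidentr E0) (incidentl E1).
Qed.

Lemma adjacentC e f : adjacent e f = adjacent f e.
Proof.
by rewrite /adjacent eq_sym; congr (_ && _); apply: eq_existsb => v; rewrite andbC.
Qed.

Lemma walk_connected x y s : path adj x (y :: s) ->
  is_connected (walk_edges adj [:: x, y & s]).
Proof.
move=> P; set A := walk_edges _ _; case/andP: (P) => /adj_edge[e0 E0] _.
have e0A : e0 \in A by rewrite walk_edges_cons E0 eqxx.
apply/andP; split; first by apply/set0Pn; exists e0.
apply/forall_inP => e eA; apply/forall_inP => f fA.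
apply: connect_trans (walk_connect (subxx _) P E0 fA).
rewrite (sym_connect_sym _) ?(walk_connect (subxx _) P E0 eA) // => e1 e2.
by rewrite adjacentC andbCA.
Qed.

Lemma connected_closed A B e : is_connected A -> e \in A -> e \in B ->
    (forall v f g, f \in A -> f \in B -> g \in A -> incident v f ->
       incident v g -> g \in B) ->
  A \subset B.
Proof.
case/andP=> _ /forall_inP cA eA eB cl; apply/subsetP => f fA.
have /forall_inP/(_ f fA)/connectP[s sP ->] := cA e eA.
elim: s e eA eB sP {fA f} => //= f s IH e eA eB /andP[/and3P[_ fA]].
case/andP=> _ /existsP[v /andP[ve vf]]; apply: IH => //.
exact: cl ve vf.
Qed.

(** The relation need not be symmetric: below it is either adjacency through an edge set or an
    orientation of two color classes. *)
Lemma maximal_path (r : rel V) v : exists s,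
  [/\ path r v s, uniq (v :: s) & forall y, r (last v s) y -> y \in v :: s].
Proof.
suff H n s : path r v s -> uniq (v :: s) -> #|V| <= size s + n ->
    exists s, [/\ path r v s, uniq (v :: s) &
      forall y, r (last v s) y -> y \in v :: s].
  exact: (H #|V| [::]).
elim: n s => [|n IH] s Ps Us le_n.
  have := max_card (mem (v :: s)); rewrite (card_uniqP Us) => /leq_trans.
  by move=> /(_ _ le_n); rewrite addn0 ltnn.
have [/forallP cl|] := boolP [forall y, r (last v s) y ==> (y \in v :: s)].
  by exists s; split=> // y; apply/implyP.
rewrite negb_forall => /existsP[y]; rewrite negb_imply => /andP[ry ys].
apply: (IH (rcons s y)); first by rewrite rcons_path Ps.
  by rewrite -rcons_cons rcons_uniq ys.
by rewrite size_rcons addSnnS.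
Qed.

Lemma size_uniq_lt s : uniq s -> size s < #|V|.+1.
Proof. by move=> /card_uniqP <-; rewrite ltnS max_card. Qed.

(** A maximal path is started at a vertex of degree 1 if there is one. An edge of [A] outside the
    path at its last vertex can only return to the start, which closes a cycle; otherwise both ends
    have degree 1 and the path is all of [A]. *)
Lemma connected_path_or_cycle A T : (forall z, #|edges_at T z| <= 2) ->
    A \subset T -> is_connected A ->
  is_cycle A \/ exists x y s, [/\ uniq [:: x, y & s], path adj x (y :: s) &
    A = walk_edges adj [:: x, y & s]].
Proof.
move=> T2 sAT cA; pose r x y := [exists e in A, val e == [set x; y]].
have rP x y : reflect (exists2 e, e \in A & val e = [set x; y]) (r x y).
  by apply: (iffP exists_inP) => -[e eA /eqP Ee]; exists e => //; apply/eqP.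
have [v [[e0 e0A ve0] Hv]] : exists v, (exists2 e, e \in A & incident v e) /\
   ((exists z, #|edges_at A z| = 1) -> #|edges_at A v| = 1).
  have [/existsP[v /eqP Av]|] := boolP [exists v, #|edges_at A v| == 1].
    have /set0Pn[e] : edges_at A v != set0 by rewrite -card_gt0 Av.
    by rewrite inE => /andP[eA ve]; exists v; split; first exists e.
  rewrite negb_exists => /forallP no1; case/andP: (cA) => /set0Pn[e eA] _.
  have [x [y [_ Ee]]] := edge_ends e; exists x; split.
    by exists e; last exact: incidentl Ee.
  by case=> z /eqP; rewrite (negPf (no1 z)).
have [s [Ps Us Ms]] := maximal_path r v.
have Pa : path adj v s.
  by apply: sub_path Ps => x y /rP[e _ /edge_adj].
case: s Ps Us Ms Pa => [|y s] Ps Us Ms Pa.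
  have [w Ew] := incident_other ve0.
  have /Ms : r v w by apply/rP; exists e0.
  by rewrite inE => /eqP Ewv; have := edge_neq Ew; rewrite Ewv eqxx.
set B := walk_edges adj [:: v, y & s].
have sBA : B \subset A.
  apply/subsetP=> e; rewrite {}/B => es.
  elim: s y {Us Ms Pa} v es Ps {Hv e0 e0A ve0} => [|z s IH] y v.
    rewrite walk_edges_cons walk_edges1 orbF /= andbT => Ee /rP[f fA Ef].
    by move: Ee; rewrite -Ef => /eqP/val_inj->.
  rewrite walk_edges_cons => /orP[|es /andP[_]]; last exact: IH.
  by move=> Ee /andP[/rP[f fA Ef] _]; move: Ee; rewrite -Ef => /eqP/val_inj->.
have sBT := subset_trans sBA sAT; set z := last y s.
have B2 u f g : f \in B -> incident u f -> g \in A -> incident u g ->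
    g \notin B -> (u == v) || (u == z).
  move=> fB uf gA ug gB; have fg : f != g by apply: contraNneq gB => <-.
  have fT : f \in edges_at T u by rewrite inE uf (subsetP sBT).
  have gT : g \in edges_at T u by rewrite inE ug (subsetP sAT).
  have Eu : edges_at T u = [set f; g].
    apply/setP => h; apply/idP/set2P => [hT|[]->//].
    exact: edges_at_pair (T2 u) fT gT hT fg.
  have := walk_boundary Us Pa sBT Eu fg; rewrite -/B fB (negPf gB).
  by move=> /= <-.
have [e Ee] : exists e, val e = [set v; y] by apply: adj_edge; case/andP: Pa.
have eB : e \in B by rewrite walk_edges_cons Ee eqxx.
have zs : z \in y :: s by apply: mem_last.
have vz : v != z by case/andP: Us => vs _; apply: contraNneq vs => ->.
have [p [f Ef fB]] := path_edge Pa zs.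
have [/existsP[h /and3P[hA zh hB]]|] :=
    boolP [exists h, [&& h \in A, incident z h & h \notin B]].
  have [w Ew] := incident_other zh.
  have ws : w \in [:: v, y & s] by apply: Ms; apply/rP; exists h.
  have Ewv : w = v.
    apply/eqP; apply: contraTT ws => wv; rewrite inE negb_or wv.
    apply/negP => /(path_edge Pa)[p' [f' Ef' f'B]].
    have := B2 w f' h f'B (incidentr Ef') hA (incidentr Ew) hB.
    by rewrite (negPf wv) eq_sym (negPf (edge_neq Ew)).
  left; rewrite {}Ewv in Ew ws.
  (* With [s] empty, [h] would join the same two vertices as [e] and so equal it, since edges are
     sets of vertices. Hence the cycle has at least three vertices. *)
  have s0 : 0 < size s.
    rewrite lt0n; apply: contraNneq hB => /eqP/nilP s0.
    by rewrite -(val_inj (etrans Ee (etrans _ (esym Ew)))) //= setUC /z s0.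
  set F := cycle_edges adj [:: v, y & s].
  have EF g : g \in F = (g \in B) || (val g == [set z; v]).
    rewrite /F cycle_edgesE -rcons_cons (lastI v (y :: s)) walk_edges_rcons.
    by rewrite -lastI.
  have cF : is_cycle F.
    apply/existsP; exists (Ordinal (size_uniq_lt Us)); apply/existsP.
    exists (in_tuple [:: v, y & s]); apply/and4P; split=> //.
    have : path adj v (rcons (y :: s) v).
      by rewrite rcons_path Pa; apply: edge_adj Ew.
    by [].
  suff -> : A = F by [].
  have sFA : F \subset A.
    apply/subsetP => g; rewrite EF => /orP[/(subsetP sBA)//|].
    by rewrite -Ew => /eqP/val_inj->.
  apply/eqP; rewrite eqEsubset sFA andbT.
  apply: (connected_closed cA (subsetP sBA _ eB)); first by rewrite EF eB.
  move=> u g1 g2 g1A g1F g2A ug1 ug2.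
  have [g3 g13 Eu] := cycle_edges_at cF g1F ug1.
  have g1T : g1 \in edges_at T u by rewrite inE ug1 (subsetP sAT).
  have g2T : g2 \in edges_at T u by rewrite inE ug2 (subsetP sAT).
  have : g3 \in edges_at F u by rewrite Eu set22.
  rewrite inE => /andP[g3F ug3].
  have g3T : g3 \in edges_at T u.
    by rewrite inE ug3 (subsetP sAT) // (subsetP sFA).
  by have [->|->] := edges_at_pair (T2 u) g1T g3T g2T g13.
rewrite negb_exists => /forallP no; right; exists v, y, s; split=> //.
have Bz g : g \in A -> incident z g -> g \in B.
  by move=> gA zg; have := no g; rewrite gA zg negbK.
(* The last vertex [z] has degree 1 in [A], hence so does [v] by its choice, and no edge of [A]
   leaves the path at either end. *)
have A1 : #|edges_at A v| = 1.
  apply: Hv; exists z; apply/eqP/cards1P; exists f.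
  apply/setP => g; rewrite !inE; apply/andP/eqP => [[gA zg]|->].
    exact: walk_edges_last Us (Bz _ gA zg) fB zg (incidentr Ef).
  by rewrite (subsetP sBA) ?(incidentr Ef).
apply/eqP; rewrite eqEsubset sBA andbT.
apply: (connected_closed cA (subsetP sBA _ eB) eB).
move=> u g1 g2 g1A g1B g2A ug1 ug2; apply: contraT => g2B.
have /orP[/eqP Eu|/eqP Eu] := B2 u g1 g2 g1B ug1 g2A ug2 g2B; last first.
  by rewrite (Bz g2) // -Eu in g2B.
move: A1 => /eqP/cards1P[g3 /setP Eg3].
have := Eg3 g1; have := Eg3 g2; rewrite !inE g1A g2A -Eu ug1 ug2.
by move=> /esym/eqP E2 /esym/eqP E1; rewrite E2 -E1 g1B in g2B.
Qed.

End Walks.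

(** * Almost colorings *)

Lemma cards_pair_cond (T : finType) (e f : T) (P : pred T) : e != f ->
  #|[set g in [set e; f] | P g]| = P e + P f.
Proof.
move=> ef; rewrite -sum1_card (eq_bigl (fun g => (g \in [set e; f]) && P g)).
  by rewrite big_mkcondr big_setU1 ?inE //= big_set1; case: (P e); case: (P f).
by move=> g; rewrite inE.
Qed.

Section AlmostColorings.

Variables (V : finType) (adj : rel V) (k : nat).
Hypotheses (adjC : symmetric adj) (adjN : irreflexive adj).
Hypothesis (regG : regular adj k).
Implicit Types (e f g h : edge adj) (A B F T : {set edge adj}).
Implicit Types (u v w x y z : V) (s t : seq V) (a b c d : 'I_k).
Implicit Types (C D : precoloring adj k).

Lemma sum_colored_at D v : \sum_c #|colored_at D v c| = k.
Proof.
rewrite -[RHS](regG v) -card_incident // -sum1_card.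
rewrite (partition_big (fun e => D e) xpredT) //=; apply: eq_bigr => c _.
by rewrite -sum1_card; apply: eq_bigl => e; rewrite !inE.
Qed.

(** A vertex has [k] edges and there are [k] colors, so the absence of repetitions forces every
    color to occur. *)
Lemma proper_colored_at D : reflect (forall v c, #|colored_at D v c| = 1) (Defs.proper D).
Proof.
apply: (iffP forallP) => [pD v c|D1 e].
  have le1 d : #|colored_at D v d| <= 1.
    apply/card_le1_eqP => e f; rewrite !inE => /andP[ve /eqP De] /andP[vf /eqP Df].
    apply: contraTeq isT => ef; have /forallP/(_ f)/implyP := pD e.
    rewrite De Df eqxx; apply; rewrite /adjacent eq_sym ef.
    by apply/existsP; exists v; rewrite ve.
  have [_] := leqif_sum (fun d (_ : true) => leqif_eq (le1 d)).
  rewrite sum_colored_at sum1_card card_ord eqxx => /esym/forallP/(_ c)/eqP.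
  exact.
apply/forallP => f; apply/implyP => /andP[ef /existsP[v /andP[ve vf]]].
apply: contraNneq ef => Def; have /eqP/cards1P[g /setP Eg] := D1 v (D f).
have := Eg e; have := Eg f; rewrite !inE Def ve vf !eqxx.
by move=> /esym/eqP-> /esym.
Qed.

(** A bound on the number of deficient vertices is kept apart, because every exchange of [a] and [b]
    preserves this condition but not such a bound. *)
Definition almost D a b :=
  forall v d, d != a -> d != b -> #|colored_at D v d| = 1.

Lemma proper_almost D a b : Defs.proper D -> almost D a b.
Proof. by move/proper_colored_at => D1 v d _ _. Qed.

Lemma almost_sum D a b v : a != b -> almost D a b ->
  #|colored_at D v a| + #|colored_at D v b| = 2.
Proof.
move=> ab aD; have : \sum_d #|colored_at D v d| = \sum_(d < k) 1.
  by rewrite sum_colored_at sum1_card card_ord.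
rewrite (bigD1 a) // [in RHS](bigD1 a) //=.
rewrite (bigD1 b) 1?eq_sym // [in RHS](bigD1 b) 1?eq_sym //= !addnA.
rewrite (eq_bigr (fun=> 1)) => [/addIn //|d /andP[da db]].
exact: aD.
Qed.

Lemma edges_at_two_colored D a b v :
  edges_at (two_colored D a b) v = colored_at D v a :|: colored_at D v b.
Proof. by apply/setP => e; rewrite !inE andbC -andb_orr. Qed.

Lemma almost_edges_at D a b v : a != b -> almost D a b ->
  #|edges_at (two_colored D a b) v| = 2.
Proof.
move=> ab aD; rewrite edges_at_two_colored cardsU (almost_sum _ ab aD).
suff -> : colored_at D v a :&: colored_at D v b = set0 by rewrite cards0.
apply/setP => e; rewrite !inE; apply/negbTE.
by apply: contraNN ab => /andP[/andP[_ /eqP<-] /andP[_ /eqP<-]].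
Qed.

Lemma almost_pair D a b v : a != b -> almost D a b ->
  exists e1 e2, e1 != e2 /\ edges_at (two_colored D a b) v = [set e1; e2].
Proof.
move=> ab aD; have /eqP/cards2P[e1 [e2]] := almost_edges_at v ab aD.
by exists e1, e2.
Qed.

Lemma almost_other D a b v e : a != b -> almost D a b ->
  e \in two_colored D a b -> incident v e ->
  exists2 f, e != f & edges_at (two_colored D a b) v = [set e; f].
Proof.
move=> ab aD eT ve; have [e1 [e2 [e12 E]]] := almost_pair v ab aD.
have : e \in edges_at (two_colored D a b) v by rewrite inE eT.
rewrite E => /set2P[]->; first by exists e2.
by exists e1; rewrite 1?eq_sym // setUC.
Qed.

Lemma flipK a b A D : flip a b A (flip a b A D) = D.
Proof. by apply/ffunP => e; rewrite !ffunE; case: (e \in A); rewrite ?tpermK. Qed.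

Lemma flipC a b A D : flip a b A D = flip b a A D.
Proof. by apply/ffunP => e; rewrite !ffunE tpermC. Qed.

Lemma flip0 a b D : flip a b set0 D = D.
Proof. by apply/ffunP => e; rewrite ffunE inE. Qed.

Lemma two_coloredC D a b : two_colored D a b = two_colored D b a.
Proof. by apply/setP => e; rewrite !inE orbC. Qed.

Lemma two_colored_flip a b A D :
  two_colored (flip a b A D) a b = two_colored D a b.
Proof.
apply/setP => e; rewrite !inE ffunE; case: ifP => // _.
by case: tpermP => [->|->|//]; rewrite !eqxx orbT.
Qed.

Lemma colored_at_flip a b A D v d : d != a -> d != b ->
  colored_at (flip a b A D) v d = colored_at D v d.
Proof.
move=> da db; apply/setP => e; rewrite !inE ffunE; case: ifP => // _.
case: tpermP => [->|->|//]; rewrite [a == d]eq_sym [b == d]eq_sym.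
  by rewrite (negPf da) (negPf db).
by rewrite (negPf da) (negPf db).
Qed.

Lemma almost_flip a b A D : almost D a b -> almost (flip a b A D) a b.
Proof. by move=> aD v d da db; rewrite colored_at_flip // aD. Qed.

Lemma almostC D a b : almost D a b -> almost D b a.
Proof. by move=> aD v d db da; apply: aD. Qed.

Lemma flip_eq a b A D e f : a != b -> e \in two_colored D a b ->
  f \in two_colored D a b ->
  (flip a b A D e == flip a b A D f) =
    (D e == D f) (+) ((e \in A) (+) (f \in A)).
Proof.
move=> ab; rewrite !inE !ffunE => /orP[]/eqP-> /orP[]/eqP->;
  by case: (e \in A); case: (f \in A); rewrite ?tpermL ?tpermR ?eqxx //
    ?(negPf ab) // eq_sym (negPf ab).
Qed.

Lemma almost_properP D a b : a != b -> almost D a b ->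
  reflect (forall v e f, e \in edges_at (two_colored D a b) v ->
     f \in edges_at (two_colored D a b) v -> e != f -> D e != D f)
   (Defs.proper D).
Proof.
move=> ab aD; apply: (iffP idP) => [/proper_colored_at D1 v e f|H].
  rewrite !inE => /andP[_ ve] /andP[_ vf]; apply: contraNneq => Def.
  have /eqP/cards1P[g /setP Eg] := D1 v (D f).
  have := Eg e; have := Eg f; rewrite !inE Def ve vf !eqxx.
  by move=> /esym/eqP-> /esym.
apply/forallP => e; apply/forallP => f; apply/implyP.
move=> /andP[ef /existsP[v /andP[ve vf]]].
have [eT|eT] := boolP (e \in two_colored D a b); last first.
  apply: contraNneq ef => Def; rewrite inE negb_or in eT.
  have /andP[ea eb] := eT; have /eqP/cards1P[g /setP Eg] := aD v _ ea eb.
  have := Eg e; have := Eg f; rewrite !inE Def ve vf !eqxx.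
  by move=> /esym/eqP-> /esym.
have [fT|] := boolP (f \in two_colored D a b).
  by apply: (H v); rewrite // inE ?eT ?fT.
by apply: contraNneq => Def; rewrite inE -Def; rewrite inE in eT.
Qed.

Lemma proper_flipP D a b A : a != b -> almost D a b ->
  (forall v e f, e \in edges_at (two_colored D a b) v ->
     f \in edges_at (two_colored D a b) v -> e != f ->
     (D e == D f) = (e \in A) (+) (f \in A)) ->
  Defs.proper (flip a b A D).
Proof.
move=> ab aD H; apply/(almost_properP ab (almost_flip A aD)) => v e f.
rewrite two_colored_flip => eT fT ef.
rewrite flip_eq // ?(H v e f) ?addbb //.
  by move: eT; rewrite inE => /andP[].
by move: fT; rewrite inE => /andP[].
Qed.

Lemma proper_deficients D : Defs.proper D -> deficients D = set0.
Proof.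
move/proper_colored_at=> D1; apply/setP => v; rewrite !inE; apply/negbTE/existsPn => a.
by apply/existsPn => b; rewrite /deficiency D1.
Qed.

Lemma almost_deficiency D a b v c d : a != b -> almost D a b ->
  deficiency D v c d = (#|colored_at D v c| == 2) &&
    ((c == a) && (d == b) || (c == b) && (d == a)).
Proof.
move=> ab aD; have ab2 := almost_sum v ab aD; rewrite /deficiency.
case: eqP => //= c2.
have cab : (c == a) || (c == b).
  apply: contra_eqT c2 => /norP[ca cb]; by rewrite aD.
apply/andP/orP => [[_ d0]|].
  have dab : (d == a) || (d == b).
    apply: contraTT d0 => /norP[da db].
    by rewrite -cards_eq0 aD.
  move: d0; rewrite -cards_eq0 => /eqP d0.
  case/orP: cab => /eqP Ec; case/orP: dab => /eqP Ed; subst; rewrite !eqxx ?andbT.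
  - by rewrite c2 in d0.
  - by left.
  - by right.
  - by rewrite c2 in d0.
case=> /andP[/eqP Ec /eqP Ed]; subst.
  have b0 : #|colored_at D v b| = 0 by move: ab2; rewrite c2 => -[].
  split; last by rewrite -cards_eq0 b0.
  apply/forall_inP => d da; have [->|db] := eqVneq d b; first by rewrite b0.
  by rewrite aD.
have a0 : #|colored_at D v a| = 0 by move: ab2; rewrite c2 addn2 => -[].
split; last by rewrite -cards_eq0 a0.
apply/forall_inP => d db; have [->|da] := eqVneq d a; first by rewrite a0.
by rewrite aD.
Qed.

Lemma almost_deficient D a b v : a != b -> almost D a b ->
  (v \in deficients D) = (#|colored_at D v a| != 1).
Proof.
move=> ab aD; have ab2 := almost_sum v ab aD; rewrite inE.
apply/existsP/idP => [[c /existsP[d]]|a1].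
  rewrite (almost_deficiency _ _ _ ab aD) => /andP[/eqP c2].
  case/orP=> /andP[/eqP Ec _]; subst; first by rewrite c2.
  by move: ab2; rewrite c2; lia.
have [a2|b2] : #|colored_at D v a| = 2 \/ #|colored_at D v b| = 2 by lia.
  by exists a; apply/existsP; exists b; rewrite (almost_deficiency _ _ _ ab aD) a2 !eqxx.
exists b; apply/existsP; exists a.
by rewrite (almost_deficiency _ _ _ ab aD) b2 !eqxx orbT.
Qed.

(** The working form of deficiency: together with [flip_eq] it reduces questions about deficient
    vertices to counting flipped edges modulo 2. *)
Lemma almost_deficient_pair D a b v e f : a != b -> almost D a b ->
  edges_at (two_colored D a b) v = [set e; f] -> e != f ->
  (v \in deficients D) = (D e == D f).
Proof.
move=> ab aD E ef; rewrite (almost_deficient _ ab aD).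
have [eT fT] : e \in edges_at (two_colored D a b) v /\
    f \in edges_at (two_colored D a b) v by rewrite E set21 set22.
have Ea c : (c == a) || (c == b) -> colored_at D v c =
    [set g in [set e; f] | D g == c].
  move=> cab; apply/setP => g; rewrite -E !inE.
  by case: (D g =P c) => [->|_]; rewrite ?andbF // !andbT cab.
rewrite Ea ?eqxx // cards_pair_cond //.
have ba : (b == a) = false by rewrite eq_sym (negPf ab).
by move: eT fT; rewrite !inE => /andP[/orP[]/eqP-> _] /andP[/orP[]/eqP-> _];
  rewrite ?eqxx ?(negPf ab) ?ba.
Qed.

Lemma deficiency_edge D a b v e : a != b -> almost D a b ->
  v \in deficients D -> e \in edges_at (two_colored D a b) v ->
  forall d, deficiency D v (D e) d = (d == tperm a b (D e)).
Proof.
move=> ab aD vD; rewrite inE => /andP[eT ve] d.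
have [f ef E] := almost_other ab aD eT ve.
have := almost_deficient_pair ab aD E ef; rewrite vD => /esym/eqP Def.
have fT : f \in edges_at (two_colored D a b) v by rewrite E set22.
have D2 : 1 < #|colored_at D v (D e)|.
  have <- : #|[set e; f]| = 2 by rewrite cards2 ef.
  apply: subset_leq_card; apply/subsetP => g /set2P[]->; rewrite inE ?ve ?eqxx //.
  by move: fT; rewrite inE Def eqxx => /andP[_ ->].
have ab2 := almost_sum v ab aD.
have {}D2 : #|colored_at D v (D e)| = 2.
  by move: eT D2; rewrite inE => /orP[]/eqP->; lia.
rewrite (almost_deficiency _ _ _ ab aD) D2 eqxx /=.
move: eT; rewrite inE => /orP[]/eqP->; rewrite eqxx ?tpermL ?tpermR /=.
  by rewrite (negPf ab) orbF.
by rewrite eq_sym (negPf ab).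
Qed.

Lemma repeated_edgesE D a b v : a != b -> almost D a b ->
  v \in deficients D -> repeated_edges D v = edges_at (two_colored D a b) v.
Proof.
move=> ab aD vD; apply/setP => e; apply/idP/idP => [|eT].
  rewrite !inE => /andP[-> /existsP[d]]; rewrite (almost_deficiency _ _ _ ab aD).
  by case/andP=> _ /orP[]/andP[/eqP-> _]; rewrite eqxx ?orbT.
have := eT; rewrite !inE => /andP[_ ->]; apply/existsP; exists (tperm a b (D e)).
by rewrite (deficiency_edge ab aD vD).
Qed.

End AlmostColorings.

(** * Elimination of deficiencies *)

Section Subprobabilities.

Local Open Scope ring_scope.

(** Mass at most 1 is what holds in general, since [unif set0] has mass 0. *)
Definition subprob (T : finType) (p : pmf T) :=
  (forall y, 0 <= p y) /\ \sum_y p y <= 1.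

Variables (S T : finType).
Implicit Types (p q : pmf T) (A : {set T}).

Lemma subprob_le1 p y : subprob p -> p y <= 1.
Proof.
case=> p0 p1; apply: le_trans p1; rewrite (bigD1 y) //= lerDl.
exact: sumr_ge0.
Qed.

Lemma subprob_ret (x : T) : subprob (ret x).
Proof.
split=> [y|]; first by rewrite /ret ler0n.
rewrite (bigD1 x) //= /ret eqxx big1 ?addr0 // => y /negPf->.
by [].
Qed.

Lemma subprob_unif A : subprob (unif A).
Proof.
split=> [y|]; first by rewrite /unif divr_ge0 ?ler0n.
rewrite /unif -mulr_suml -natr_sum -big_mkcond sum1_card.
have [->|A0] := posnP #|A|; first by rewrite mul0r.
by rewrite divff // pnatr_eq0 -lt0n.
Qed.

Lemma subprob_coin p q : subprob p -> subprob q -> subprob (coin p q).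
Proof.
move=> [p0 p1] [q0 q1]; split=> [y|].
  by rewrite /coin; have := p0 y; have := q0 y; lra.
by rewrite /coin big_split /= -!mulr_sumr; lra.
Qed.

Lemma subprob_bind (p : pmf S) (f : S -> pmf T) :
  subprob p -> (forall x, subprob (f x)) -> subprob (bind p f).
Proof.
move=> [p0 p1] fP; split=> [y|].
  by apply: sumr_ge0 => x _; rewrite mulr_ge0 //; case: (fP x).
rewrite /bind exchange_big /=; apply: le_trans p1; apply: ler_sum => x _.
by rewrite -mulr_sumr ler_piMr //; case: (fP x).
Qed.

Lemma bind_ge (p : pmf S) (f : S -> pmf T) x y :
  subprob p -> (forall x, subprob (f x)) -> p x * f x y <= bind p f y.
Proof.
move=> [p0 p1] fP; rewrite /bind (bigD1 x) //= lerDl.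
by apply: sumr_ge0 => z _; rewrite mulr_ge0 //; case: (fP z).
Qed.

Lemma bind_gt0 (p : pmf S) (f : S -> pmf T) y :
  subprob p -> (forall x, subprob (f x)) -> 0 < bind p f y ->
  exists x, 0 < p x /\ 0 < f x y.
Proof.
move=> [p0 p1] fP py.
have [/existsP[x /andP[px fx]]|] := boolP [exists x, (0 < p x) && (0 < f x y)].
  by exists x.
rewrite negb_exists => /forallP H; move: py; rewrite /bind big1 ?ltxx // => x _.
have [fx0 _] := fP x; have := H x; rewrite !lt0r p0 fx0 !andbT negb_and !negbK.
by case/orP=> /eqP->; rewrite ?mulr0 ?mul0r.
Qed.

Lemma unif_gt0 A y : (0 < unif A y) = (y \in A).
Proof.
rewrite /unif; case: (boolP (y \in A)) => yA; last by rewrite mul0r ltxx.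
by rewrite mul1r invr_gt0 ltr0n card_gt0; apply/set0Pn; exists y.
Qed.

Lemma unif_ge A y n : y \in A -> (#|A| <= n)%N -> n%:R^-1 <= unif A y.
Proof.
move=> yA le_n; rewrite /unif yA mul1r lef_pV2 ?ler_nat // posrE ltr0n.
  by apply: leq_trans le_n; rewrite card_gt0; apply/set0Pn; exists y.
by rewrite card_gt0; apply/set0Pn; exists y.
Qed.

Lemma ret_gt0 (x y : T) : (0 < ret x y) = (y == x).
Proof. by rewrite /ret; case: eqP; rewrite ?ltr01 ?ltxx. Qed.

End Subprobabilities.

(** * Flipped paths and the eliminations that undo them *)

Section Elimination.

Variables (V : finType) (adj : rel V) (k : nat).
Hypotheses (adjC : symmetric adj) (adjN : irreflexive adj).
Hypothesis (regG : regular adj k).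
Implicit Types (e f g h : edge adj) (A B F T : {set edge adj}).
Implicit Types (u v w x y z : V) (s t : seq V) (a b c d : 'I_k).
Implicit Types (C D : precoloring adj k).

Definition walk_in T x y s := [/\ uniq [:: x, y & s], path adj x (y :: s) &
  walk_edges adj [:: x, y & s] \subset T].

Lemma deficients_flip_walk C a b x y s : a != b -> Defs.proper C ->
  walk_in (two_colored C a b) x y s ->
  deficients (flip a b (walk_edges adj [:: x, y & s]) C) = [set x; last y s].
Proof.
move=> ab pC [Us Ps sT]; have aC := proper_almost adjC adjN regG pC (a := a) (b := b).
set B := walk_edges _ _ in sT *; apply/setP => z.
have [e [f [ef E]]] := almost_pair adjC adjN regG z ab aC.
rewrite (almost_deficient_pair adjC adjN regG ab (almost_flip B aC) _ ef).
  have eT : e \in edges_at (two_colored C a b) z by rewrite E set21.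
  have fT : f \in edges_at (two_colored C a b) z by rewrite E set22.
  have /negPf Cef : C e != C f.
    by have /(almost_properP adjC adjN regG ab aC)/(_ z e f) := pC; apply.
  rewrite flip_eq // ?Cef; last 2 first.
  - by move: eT; rewrite inE => /andP[].
  - by move: fT; rewrite inE => /andP[].
  by rewrite (walk_boundary adjN Us Ps sT E ef) !inE.
by rewrite two_colored_flip.
Qed.

Lemma two_colored_edge D a b e : e \in two_colored D a b ->
  two_colored D (D e) (tperm a b (D e)) = two_colored D a b.
Proof.
rewrite inE => /orP[]/eqP->; first by rewrite tpermL.
by rewrite tpermR two_coloredC.
Qed.

Lemma walk_edges_prefix s x t :
  walk_edges adj (rcons s x) \subset walk_edges adj (rcons s x ++ t).
Proof. by apply/subsetP => e; rewrite cat_rcons walk_edges_cat => ->. Qed.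

(** At the far end the other edge of the two colors was not flipped and now repeats the color of the
    last path edge, so the path cannot be continued. In use, [c] and [d] are [a] and [b] in the
    order dictated by the deficiency. *)
Lemma max_alternating_walk C a b c d x y s e : a != b -> Defs.proper C ->
    walk_in (two_colored C a b) x y s -> val e = [set x; y] ->
    two_colored (flip a b (walk_edges adj [:: x, y & s]) C) c d =
      two_colored C a b ->
  max_alternating_path (flip a b (walk_edges adj [:: x, y & s]) C) c d x e
    (walk_edges adj [:: x, y & s]).
Proof.
move=> ab pC [Us Ps sT] Ee Tcd; set B := walk_edges _ _ in sT Tcd *.
have pC' f g : adjacent f g -> C f != C g.
  by have /forallP/(_ f)/forallP/(_ g)/implyP := pC.
apply/existsP; exists (Ordinal (size_uniq_lt Us)).
apply/existsP; exists (in_tuple [:: x, y & s]); apply/and3P; split=> //.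
  apply/and5P; split=> //; first exact/eqP.
  apply/andP; split; first by rewrite Tcd.
  apply/forall_inP => f fB; apply/forall_inP => g gB; apply/implyP => fg.
  by rewrite flip_eq ?(subsetP sT) // fB gB (negPf (pC' _ _ fg)).
apply/forallP => z; apply/negP => /and5P[_ _ Uz Pz /andP[Bz /forall_inP alt]].
have Pz' : path adj x (rcons (y :: s) z) by [].
have Uz' : uniq (rcons [:: x, y & s] z) by [].
have [p [f Ef fB]] := path_edge Ps (mem_last y s).
rewrite -/B in fB.
move: Pz'; rewrite rcons_path => /andP[_ /adj_edge[g Eg]].
rewrite [last _ _]/= in Eg.
have Wz h : (h \in walk_edges adj [:: x, y & rcons s z]) =
    (h \in B) || (val h == [set last y s; z]).
  by rewrite -!rcons_cons (lastI x (y :: s)) walk_edges_rcons -lastI.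
have fBz : f \in walk_edges adj [:: x, y & rcons s z] by rewrite Wz fB.
have gBz : g \in walk_edges adj [:: x, y & rcons s z] by rewrite Wz Eg eqxx orbT.
have gB : g \notin B.
  move: Uz'; rewrite rcons_uniq => /andP[zs _]; apply: contra zs => gB.
  exact: walk_edges_mem gB (incidentr Eg).
have fg : adjacent f g.
  apply/andP; split; first by apply: contraNneq gB => <-.
  by apply/existsP; exists (last y s); rewrite (incidentr Ef) (incidentl Eg).
have /forall_inP/(_ g gBz)/implyP/(_ fg) := alt f fBz.
have gT : g \in two_colored C a b by rewrite -Tcd; apply: (subsetP Bz).
have fT := subsetP sT _ fB.
by rewrite flip_eq // fB (negPf gB) (negPf (pC' _ _ fg)).
Qed.

Lemma max_alternating_path_from D a b v e B : max_alternating_path D a b v e B ->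
  exists y s, [/\ val e = [set v; y], walk_in (two_colored D a b) v y s,
    B = walk_edges adj [:: v, y & s], alternating D a b B &
    forall z, ~~ alternating_path_from D a b v e (rcons [:: v, y & s] z)].
Proof.
case/existsP=> n /existsP[[t /= _]] /and3P[+ /forallP maxt /eqP EB].
case: t EB maxt => [|x [|y s]] EB maxt //= /and5P[/eqP Ex /eqP Ee Us Ps Bs].
subst x; exists y, s; split=> //; last by rewrite EB.
by case/andP: (Bs).
Qed.

(** By [walk_prefix] one of the two paths extends the other, and maximality rules out a proper
    extension. *)
Lemma max_alternating_path_uniq D a b v e B1 B2 :
    (forall z, #|edges_at (two_colored D a b) z| <= 2) ->
    max_alternating_path D a b v e B1 -> max_alternating_path D a b v e B2 ->
  B1 = B2.
Proof.
move=> T2 /max_alternating_path_from[y1 [s1 [E1 [U1 P1 S1] -> alt1 max1]]].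
case/max_alternating_path_from=> [y2 [s2 [E2 [U2 P2 S2] -> alt2 max2]]].
have Ey := other_end_inj adjN E1 E2; subst y2.
suff prefix s t r : uniq [:: v, y1 & t] -> path adj v (y1 :: t) ->
    alternating D a b (walk_edges adj [:: v, y1 & t]) ->
    (forall z, ~~ alternating_path_from D a b v e (rcons [:: v, y1 & s] z)) ->
    t = s ++ r -> t = s.
  have [[r Er]|[r Er]] := walk_prefix adjN (fun z _ => T2 z) U1 U2 P1 P2 S1 S2.
    by rewrite (prefix s1 s2 r).
  by rewrite (prefix s2 s1 r).
case: r => [|z r] Ut Pt At maxs Et; first by rewrite Et cats0.
have Et' : [:: v, y1 & t] = rcons [:: v, y1 & s] z ++ r by rewrite Et -cat_rcons.
case/negP: (maxs z); apply/and5P; split=> //; first exact/eqP.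
- by move: Ut; rewrite Et' cat_uniq => /and3P[].
- by move: Pt; rewrite Et -cat_rcons -cat_cons cat_path => /andP[].
have sW : walk_edges adj (rcons [:: v, y1 & s] z) \subset
    walk_edges adj [:: v, y1 & t] by rewrite Et' walk_edges_prefix.
case/andP: At => At1 /forall_inP At2; apply/andP; split.
  exact: subset_trans At1.
apply/forall_inP => f fs; apply/forall_inP => g gs.
by have /forall_inP := At2 f (subsetP sW _ fs); apply; apply: (subsetP sW).
Qed.

Local Open Scope ring_scope.

Lemma subprob_eliminate D : subprob (eliminate D).
Proof.
rewrite /eliminate; case: ifP => _; last exact: subprob_ret.
by do 2![apply: subprob_bind => [|?]; first exact: subprob_unif];
  apply: subprob_unif.
Qed.

(** What an elimination can flip: nothing if the coloring is proper, otherwise a path with at least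
    one edge, but never a whole cycle. *)
Definition open_arc T B :=
  B = set0 \/ exists x y s, walk_in T x y s /\ B = walk_edges adj [:: x, y & s].

(** Choosing the deficient vertex [x] and the first edge of the path costs a factor 1/2 each; the
    maximal path is then forced. *)
Lemma eliminate_arc_ge C a b B : a != b -> Defs.proper C ->
  open_arc (two_colored C a b) B -> 1 / 4 <= eliminate (flip a b B C) B.
Proof.
move=> ab pC [->|[x [y [s [W EB]]]]].
  rewrite flip0 /eliminate (proper_deficients adjC adjN regG) // eqxx /= /ret eqxx.
  by rewrite ler_pdivrMr ?mul1r ?ltr0n // ler1n.
have aC := proper_almost adjC adjN regG pC (a := a) (b := b); have aD := almost_flip B aC.
have Dx := deficients_flip_walk ab pC W; rewrite -EB in Dx.
have xD : x \in deficients (flip a b B C) by rewrite Dx set21.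
rewrite /eliminate; case: ifP => [_|]; last first.
  by move/negbFE => /eqP D0; rewrite D0 inE in xD.
have [Us Ps sT] := W; case/andP: (Ps) => /adj_edge[e Ee] _.
have eB : e \in B by rewrite EB walk_edges_cons Ee eqxx.
have eT : e \in edges_at (two_colored (flip a b B C) a b) x.
  by rewrite inE two_colored_flip (incidentl Ee) (subsetP sT) // -EB.
apply: le_trans (bind_ge x _ _ _); last 2 first.
- exact: subprob_unif.
- by move=> v; apply: subprob_bind => [|f]; apply: subprob_unif.
have p1 : 1 / 2 <= unif (deficients (flip a b B C)) x.
  by rewrite div1r unif_ge // Dx cards2; case: (_ != _).
set q := bind _ _ _; suff : 1 / 2 <= q by rewrite /q in p1 *; nra.
apply: le_trans (bind_ge e _ _ _); last 2 first.
- exact: subprob_unif.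
- by move=> f; apply: subprob_unif.
rewrite (repeated_edgesE adjC adjN regG ab aD xD).
have p2 : 1 / 2 <= unif (edges_at (two_colored (flip a b B C) a b) x) e.
  by rewrite div1r unif_ge // (almost_edges_at adjC adjN regG).
rewrite -[1 / 2]mulr1; apply: ler_pM => //.
apply: le_trans (unif_ge (n := 1) _ _); first by rewrite invr1.
  rewrite inE; apply/existsP; exists (tperm a b (flip a b B C e)).
  rewrite (deficiency_edge adjC adjN regG ab aD xD eT) eqxx /= EB.
  apply: max_alternating_walk => //; rewrite two_colored_edge ?two_colored_flip //.
  by move: eT; rewrite inE two_colored_flip => /andP[].
apply/card_le1_eqP => B1 B2.
rewrite !inE => /existsP[d1 /andP[]] + m1 /existsP[d2 /andP[]] + m2.
rewrite !(deficiency_edge adjC adjN regG ab aD xD eT) => /eqP E1 /eqP E2; subst.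
apply: max_alternating_path_uniq m2 m1 => z.
rewrite two_colored_edge; last by move: eT; rewrite inE => /andP[].
by rewrite (almost_edges_at adjC adjN regG).
Qed.

Lemma eliminate_gt0 D a b B : a != b -> almost D a b -> 0 < eliminate D B ->
  if deficients D == set0 then B = set0 else
  exists x y s, walk_in (two_colored D a b) x y s /\
    B = walk_edges adj [:: x, y & s].
Proof.
move=> ab aD; rewrite /eliminate; case: ifP => [/negPf->|/negbFE->]; last first.
  by rewrite ret_gt0 => /eqP.
case/bind_gt0 => [||v [vD]]; first exact: subprob_unif.
  by move=> v; apply: subprob_bind => [|f]; apply: subprob_unif.
rewrite unif_gt0 in vD; case/bind_gt0 => [||e [eD]]; first exact: subprob_unif.
  by move=> f; apply: subprob_unif.
rewrite unif_gt0 (repeated_edgesE adjC adjN regG ab aD vD) in eD.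
rewrite unif_gt0 inE => /existsP[d /andP[]].
rewrite (deficiency_edge adjC adjN regG ab aD vD eD) => /eqP->.
case/max_alternating_path_from=> [y [s [_ + -> _ _]]].
rewrite two_colored_edge; last by move: eD; rewrite inE => /andP[].
by move=> W; exists v, y, s.
Qed.

End Elimination.

(** * Flipping cycles; counting walks *)

(** An object may have several codes, as a path has one from each end; it only matters that a code
    determines its object. *)
Lemma card_le_codes (S T : finType) (A : {set S}) (R : S -> T -> Prop) :
    (forall x, x \in A -> exists c, R x c) ->
    (forall x y c, R x c -> R y c -> x = y) ->
  #|A| <= #|T|.
Proof.
move=> exR injR; have [|f fP] := @fin_all_exists {x | x \in A} _
  (fun x c => R (val x) c); first by move=> [x xA]; apply: exR.
rewrite -[#|A|]card_sig; apply: (@leq_card _ _ f) => x y Ef.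
by apply/val_inj/(injR _ _ (f x)) => //; rewrite Ef.
Qed.

Lemma cat_same_size (T : Type) (s r : seq T) : size (s ++ r) = size s ->
  s ++ r = s.
Proof. by rewrite size_cat -[RHS]addn0 => /addnI/size0nil->; rewrite cats0. Qed.

Section CycleFlips.

Variables (V : finType) (adj : rel V) (k : nat).
Hypotheses (adjC : symmetric adj) (adjN : irreflexive adj).
Hypothesis (regG : regular adj k).
Implicit Types (e f g h : edge adj) (A B F T : {set edge adj}).
Implicit Types (u v w x y z : V) (s t : seq V) (a b c d : 'I_k).
Implicit Types (C D : precoloring adj k).

Lemma alternating_cycle_at D a b F v e : alternating_cycle D a b F ->
    e \in F -> incident v e ->
  exists f, [/\ e != f, edges_at F v = [set e; f], D f = tperm a b (D e) &
    D e = tperm a b (D f)].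
Proof.
case/andP=> cF /andP[sF /forall_inP alt] eF ve.
have [f ef E] := cycle_edges_at adjC adjN cF eF ve.
have : f \in edges_at F v by rewrite E set22.
rewrite inE => /andP[fF vf]; exists f.
have Def : D e != D f.
  have /forall_inP/(_ f fF)/implyP := alt e eF; apply.
  by rewrite /adjacent ef; apply/existsP; exists v; rewrite ve.
move: (subsetP sF e eF) (subsetP sF f fF) Def; rewrite !inE.
by move=> /orP[]/eqP-> /orP[]/eqP->; rewrite ?eqxx ?tpermL ?tpermR.
Qed.

(** The flip interchanges the colors of the two cycle edges at [v], so transposing these edges
    carries the color classes at [v] before the flip to those after it. This holds at deficient
    vertices too, so cycle flips do not move deficiencies. *)
Lemma card_colored_at_cycle D a b F v d : alternating_cycle D a b F ->
  #|colored_at (flip a b F D) v d| = #|colored_at D v d|.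
Proof.
move=> aF; have [/existsP[e /andP[eF ve]]|no] :=
    boolP [exists e, (e \in F) && incident v e]; last first.
  apply: eq_card => e; rewrite !inE ffunE; case: (boolP (incident v e)) => // ve.
  case: ifP => // eF; case/negP: no; apply/existsP; exists e; by rewrite eF.
have [f [ef E Df De]] := alternating_cycle_at aF eF ve.
have : f \in edges_at F v by rewrite E set22.
rewrite inE => /andP[fF vf].
rewrite -(card_preimset _ (@perm_inj _ (tperm e f))); apply: eq_card => g.
rewrite !inE; case: tpermP => [->|->|/eqP ge /eqP gf].
- by rewrite ve vf ffunE fF -De.
- by rewrite ve vf ffunE eF -Df.
rewrite ffunE; case: (boolP (incident v g)) => // vg; case: ifP => // gF.
have : g \in edges_at F v by rewrite inE gF.
by rewrite E !inE (negPf ge) (negPf gf).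
Qed.

Lemma alternating_cycle_flip D a b F : alternating_cycle D a b F ->
  alternating_cycle (flip a b F D) a b F.
Proof.
case/andP=> cF /andP[sF /forall_inP alt]; apply/and3P; split=> //.
  by rewrite two_colored_flip.
apply/forall_inP => e eF; apply/forall_inP => f fF; apply/implyP => ef.
rewrite !ffunE eF fF (inj_eq perm_inj).
by have /forall_inP/(_ f fF)/implyP := alt e eF; apply.
Qed.

Lemma deficiency_flip_cycle D a b F v c d : alternating_cycle D a b F ->
  deficiency (flip a b F D) v c d = deficiency D v c d.
Proof.
move=> aF; rewrite /deficiency -!cards_eq0 !card_colored_at_cycle //.
by congr [&& _, _ & _]; apply: eq_forallb => x; rewrite card_colored_at_cycle.
Qed.

Lemma deficients_flip_cycle D a b F : alternating_cycle D a b F ->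
  deficients (flip a b F D) = deficients D.
Proof.
move=> aF; apply/setP => v; rewrite !inE; apply: eq_existsb => c.
by apply: eq_existsb => d; rewrite deficiency_flip_cycle.
Qed.

Lemma almost_flip_cycle D a b c d F : alternating_cycle D c d F ->
  almost D a b -> almost (flip c d F D) a b.
Proof. by move=> aF aD v x xa xb; rewrite card_colored_at_cycle ?aD. Qed.

Lemma proper_flip_cycle D a b F : alternating_cycle D a b F ->
  Defs.proper D -> Defs.proper (flip a b F D).
Proof.
move=> aF /(proper_colored_at adjC adjN regG) D1.
apply/(proper_colored_at adjC adjN regG) => v c.
by rewrite card_colored_at_cycle.
Qed.

Lemma proper_adjacent C e f : Defs.proper C -> adjacent e f -> C e != C f.
Proof. by move/forallP/(_ e)/forallP/(_ f)/implyP. Qed.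

Lemma proper_alternating C a b A : Defs.proper C -> A \subset two_colored C a b ->
  alternating C a b A.
Proof.
move=> pC sA; apply/andP; split=> //; apply/forall_inP => e _.
by apply/forall_inP => f _; apply/implyP; apply: proper_adjacent.
Qed.

Lemma proper_color_inj C v e f : Defs.proper C -> incident v e ->
  incident v f -> C e = C f -> e = f.
Proof.
move=> pC ve vf Cef; apply: contra_eq Cef => ef; apply: proper_adjacent => //.
by rewrite /adjacent ef; apply/existsP; exists v; rewrite ve.
Qed.

Lemma proper_edges_at C a b z : a != b -> Defs.proper C ->
  #|edges_at (two_colored C a b) z| <= 2.
Proof.
by move=> ab pC; rewrite (almost_edges_at adjC adjN regG) //; apply: proper_almost.
Qed.

(** * Counting alternating paths and cycles *)

Lemma edge_path_adj x y s : path adj x (y :: s) -> exists e, val e = [set x; y].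
Proof. by case/andP => /adj_edge. Qed.

(** A path has at most [#|V|] vertices and [s] omits two of them. This leaves [#|V|.-1] possible
    lengths, the origin of the factor |V|-1 in the bound. *)
Lemma walk_size T x y s : walk_in T x y s -> size s < #|V|.-1.
Proof. by case=> /size_uniq_lt /=; lia. Qed.

(** In a proper coloring the first vertex and the color of the first edge determine that edge; by
    [walk_prefix] only the length is then left open. *)
Lemma walk_code C a b x y1 y2 s1 s2 e1 e2 : a != b -> Defs.proper C ->
    walk_in (two_colored C a b) x y1 s1 -> walk_in (two_colored C a b) x y2 s2 ->
    val e1 = [set x; y1] -> val e2 = [set x; y2] ->
    (C e1 == a) = (C e2 == a) -> size s1 = size s2 ->
  walk_edges adj [:: x, y1 & s1] = walk_edges adj [:: x, y2 & s2].
Proof.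
move=> ab pC [U1 P1 S1] [U2 P2 S2] E1 E2 Ca Es.
have C1 : e1 \in two_colored C a b.
  by apply: (subsetP S1); rewrite walk_edges_cons E1 eqxx.
have C2 : e2 \in two_colored C a b.
  by apply: (subsetP S2); rewrite walk_edges_cons E2 eqxx.
have Ce : C e1 = C e2.
  move: C1 C2 Ca; rewrite !inE.
  by move=> /orP[]/eqP-> /orP[]/eqP->; rewrite ?eqxx // eq_sym (negPf ab).
have Ee := proper_color_inj pC (incidentl E1) (incidentl E2) Ce; subst e2.
have Ey := other_end_inj adjN E1 E2; subst y2.
have [[r Er]|[r Er]] := walk_prefix adjN (fun z _ => proper_edges_at z ab pC)
  U1 U2 P1 P2 S1 S2.
  by rewrite Er cat_same_size // -Er.
by rewrite Er cat_same_size // -Er.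
Qed.

Lemma is_path_walk T A : is_path A -> A != set0 -> A \subset T ->
  exists x y s, walk_in T x y s /\ A = walk_edges adj [:: x, y & s].
Proof.
case/existsP=> n /existsP[[t /= _]] /and3P[Ut Pt /eqP->] /set0Pn[e].
case: t Ut Pt => [|x [|y s]] U P; rewrite ?inE // => _ sT.
by exists x, y, s.
Qed.

Lemma walk_is_path T x y s : walk_in T x y s ->
  is_path (walk_edges adj [:: x, y & s]).
Proof.
case=> U P _; apply/existsP; exists (Ordinal (size_uniq_lt U)).
by apply/existsP; exists (in_tuple [:: x, y & s]); rewrite U eqxx andbT.
Qed.

Lemma card_even_subpaths C a b : a != b -> Defs.proper C ->
  #|even_subpaths C a b| <= 2 * #|V| * #|V|.-1.
Proof.
move=> ab pC; have -> : 2 * #|V| * #|V|.-1 = #|{: V * bool * 'I_#|V|.-1}|.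
  by rewrite !card_prod card_bool card_ord; lia.
apply: (card_le_codes (R := fun A (c : V * bool * 'I_#|V|.-1) =>
  exists y s e, [/\
  walk_in (two_colored C a b) c.1.1 y s, A = walk_edges adj [:: c.1.1, y & s],
  val e = [set c.1.1; y], c.1.2 = (C e == a) & c.2 = size s :> nat])).
  move=> A; rewrite inE => /and4P[pA A0 _ sA].
  have [x [y [s [W EA]]]] := is_path_walk pA A0 sA.
  have [_ P _] := W; have [e Ee] := edge_path_adj P.
  by exists (x, C e == a, Ordinal (walk_size W)), y, s, e; split.
move=> A1 A2 [[x ca] i] /= [y1 [s1 [e1 [W1 -> E1 C1 S1]]]].
case=> y2 [s2 [e2 [W2 -> E2 C2 S2]]].
by apply: walk_code W1 W2 E1 E2 _ _ => //; rewrite -?C1 -?S1.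
Qed.

Lemma card_connected_subgraphs C a b : a != b -> Defs.proper C ->
  #|connected_subgraphs C a b| <= 2 * #|V| * #|V|.
Proof.
move=> ab pC; have -> : 2 * #|V| * #|V| = #|{: V * bool * 'I_#|V|}|.
  by rewrite !card_prod card_bool card_ord; lia.
(* No walk has length code |V| - 1, which is therefore free for cycles. *)
pose R A (c : V * bool * 'I_#|V|) :=
  (exists y s e, [/\
    walk_in (two_colored C a b) c.1.1 y s, A = walk_edges adj [:: c.1.1, y & s],
    val e = [set c.1.1; y], c.1.2 = (C e == a) & c.2 = size s :> nat]) \/
  [/\ is_cycle A, A \subset two_colored C a b,
      exists e, [/\ e \in A, incident c.1.1 e & c.1.2 = (C e == a)] &
      c.2 = #|V|.-1 :> nat].
apply: (card_le_codes (R := R)).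
  move=> A; rewrite inE => /andP[cA sA].
  have T2 z := proper_edges_at z ab pC.
  have [cycA|[x [y [s [U P EA]]]]] := connected_path_or_cycle adjC adjN T2 sA cA.
    case/andP: (cA) => /set0Pn[e eA] _; have [x [y [_ Ee]]] := edge_ends e.
    have V0 : #|V|.-1 < #|V| by rewrite prednK //; apply/card_gt0P; exists x.
    exists (x, C e == a, Ordinal V0); right; split=> //.
    by exists e; split=> //; apply: incidentl Ee.
  have W : walk_in (two_colored C a b) x y s by split=> //; rewrite -EA.
  have [e Ee] := edge_path_adj P; have sV := walk_size W.
  have {}sV : size s < #|V| by lia.
  by exists (x, C e == a, Ordinal sV); left; exists y, s, e; split.
move=> A1 A2 [[x ca] i] [[y1 [s1 [e1 [W1 -> E1 C1 S1]]]]|]; last first.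
  case=> c1 s1 [e1 [e1A x1 C1]] S1; case=> [[y2 [s2 [e2 [W2 _ _ _ S2]]]]|].
    by have := walk_size W2; rewrite -S2 S1 ltnn.
  case=> c2 s2 [e2 [e2A x2 C2]] S2.
  have Ce : C e1 = C e2.
    move: (subsetP s1 _ e1A) (subsetP s2 _ e2A) C1; rewrite C2 !inE.
    by move=> /orP[]/eqP-> /orP[]/eqP->; rewrite ?eqxx // eq_sym (negPf ab).
  have Ee := proper_color_inj pC x1 x2 Ce; subst e2.
  by apply: (cycle_uniq adjC adjN c1 c2 s1 s2 _ e1A e2A x1) => z _;
    apply: proper_edges_at.
case=> [[y2 [s2 [e2 [W2 -> E2 C2 S2]]]]|[_ _ _ S2]]; last first.
  by have := walk_size W1; rewrite -S1 S2 ltnn.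
by apply: walk_code W1 W2 E1 E2 _ _ => //; rewrite -?C1 -?S1.
Qed.

(** An edge is determined by one of its ends and its color, which leaves two candidates per
    vertex. *)
Lemma card_two_colored C a b : a != b -> Defs.proper C ->
  #|two_colored C a b| <= 2 * #|V|.
Proof.
move=> ab pC; have -> : 2 * #|V| = #|{: V * bool}|.
  by rewrite card_prod card_bool; lia.
apply: (card_le_codes (R := fun e (c : V * bool) => [/\ e \in two_colored C a b,
  incident c.1 e & c.2 = (C e == a)])).
  move=> e eT; have [x [y [_ Ee]]] := edge_ends e.
  by exists (x, C e == a); split=> //; apply: incidentl Ee.
move=> e1 e2 [x ca] [T1 x1 C1] [T2 x2 C2]; apply: (proper_color_inj pC x1 x2).
move: T1 T2 C1; rewrite C2 !inE.
by move=> /orP[]/eqP-> /orP[]/eqP->; rewrite ?eqxx // eq_sym (negPf ab).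
Qed.

(** * Parity of a path and the kinds of its two deficiencies *)

Lemma walk_last_color C a b x y s e f : a != b -> Defs.proper C ->
    walk_in (two_colored C a b) x y s -> val e = [set x; y] ->
    f \in walk_edges adj [:: x, y & s] -> incident (last y s) f ->
  (C e == C f) = ~~ odd (size s).
Proof.
move=> ab pC; elim: s x y e => [|z s IH] x y e [U P S] Ee.
  by rewrite walk_edges_cons walk_edges1 orbF -Ee => /eqP/val_inj->; rewrite eqxx.
rewrite walk_edges_cons => /orP[/eqP Ef|fs] lf.
  move: lf; rewrite (incidentE _ Ef) /= => /orP[]/eqP El; move: U => /=.
    by rewrite -El inE mem_last orbT.
  by rewrite -El mem_last andbF.
have sS : walk_edges adj [:: y, z & s] \subset two_colored C a b.
  apply: subset_trans S; apply/subsetP => g gs.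
  by rewrite walk_edges_cons gs orbT.
have P' : path adj y (z :: s) by case/andP: P.
have U' : uniq [:: y, z & s] by case/andP: U.
have [g Eg] := edge_path_adj P'.
have := IH y z g (And3 U' P' sS) Eg fs lf.
have gT : g \in two_colored C a b.
  by apply: (subsetP sS); rewrite walk_edges_cons Eg eqxx.
have eT : e \in two_colored C a b.
  by apply: (subsetP S); rewrite walk_edges_cons Ee eqxx.
have fT := subsetP sS f fs.
have Ceg : C e != C g.
  apply: proper_adjacent => //; apply/andP; split.
    apply: contraTneq U => eg; rewrite eg setUC in Ee.
    by rewrite (other_end_inj adjN Eg Ee) /= !inE eqxx !orbT.
  by apply/existsP; exists y; rewrite (incidentr Ee) (incidentl Eg).
rewrite /=; move: eT fT gT Ceg; rewrite !inE.
by move=> /orP[]/eqP-> /orP[]/eqP-> /orP[]/eqP->;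
  rewrite ?eqxx ?(negPf ab) ?[b == a]eq_sym ?(negPf ab) //= => _ <-.
Qed.

(** After the flip an end has no [a]-edge or two of them, according to whether its path edge had
    color [a] or not. As the path has one edge more than [size s], an even path has ends of opposite
    kinds. *)
Lemma walk_ends_count C a b x y s : a != b -> Defs.proper C ->
    walk_in (two_colored C a b) x y s ->
  let D := flip a b (walk_edges adj [:: x, y & s]) C in
  (#|colored_at D x a| == #|colored_at D (last y s) a|) = ~~ odd (size s).
Proof.
move=> ab pC W; have aC := proper_almost adjC adjN regG pC (a := a) (b := b).
set B := walk_edges _ _ => D; have aD : almost D a b := almost_flip B aC.
have def := deficients_flip_walk adjC adjN regG ab pC W.
have [_ P S] := W; have [e Ee] := edge_path_adj P.
have [p [f Ef fB]] := path_edge P (mem_last y s).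
have eB : e \in B by rewrite walk_edges_cons Ee eqxx.
rewrite -(walk_last_color ab pC W Ee fB (incidentr Ef)).
have cnt g v : v \in deficients D -> g \in B -> incident v g ->
    #|colored_at D v a| = if C g == a then 0 else 2.
  move=> vD gB vg; have gT : g \in two_colored C a b by apply: (subsetP S).
  have gTv : g \in edges_at (two_colored D a b) v.
    by rewrite inE two_colored_flip gT.
  have := deficiency_edge adjC adjN regG ab aD vD gTv (tperm a b (D g)).
  rewrite eqxx (almost_deficiency adjC adjN regG _ _ _ ab aD) => /andP[/eqP + _].
  have := almost_sum adjC adjN regG v ab aD.
  rewrite ffunE gB; move: gT; rewrite inE => /orP[]/eqP->.
    by rewrite tpermL eqxx => + b2; rewrite b2 => /(@addIn 2 _ 0).
  by rewrite tpermR eq_sym (negPf ab).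
rewrite (cnt e x) ?def ?set21 ?(incidentl Ee) //.
rewrite (cnt f (last y s)) ?def ?set22 ?(incidentr Ef) //.
move: (subsetP S _ eB) (subsetP S _ fB); rewrite !inE.
by move=> /orP[]/eqP-> /orP[]/eqP->; 
  rewrite ?eqxx ?(negPf ab) ?[b == a]eq_sym ?(negPf ab).
Qed.

(** Step (3) selects only even paths. Here the admissibility of an arc is read off from its
    deficient ends, whichever of the two arcs was taken. *)
Lemma uneven_ends_odd C a b x y s v w : a != b -> Defs.proper C ->
    walk_in (two_colored C a b) x y s -> [set v; w] = [set x; last y s] ->
  let D := flip a b (walk_edges adj [:: x, y & s]) C in
  #|colored_at D v a| != #|colored_at D w a| -> odd (size s).
Proof.
move=> ab pC W vw D cnt; rewrite -[odd _]negbK -(walk_ends_count ab pC W) -/D.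
have xl : x != last y s.
  have [U _ _] := W; case/andP: U => + _; apply: contraNneq => ->.
  exact: mem_last.
have : x \in [set v; w] by rewrite vw set21.
have : last y s \in [set v; w] by rewrite vw set22.
move=> /set2P[]El /set2P[]Ex; move: xl; rewrite Ex El ?eqxx // => _.
by rewrite eq_sym.
Qed.

End CycleFlips.

(** * Acceptance ratios *)

Section Ratios.

Local Open Scope ring_scope.

Implicit Types (p q r M : rat).

(** Positivity of [q] is drawn from the inequality itself, so a ratio bound also shows that the
    inverse way has positive probability. *)
Lemma min1_ratio_bound p q M : 0 < p -> p <= M * q -> 1 <= M ->
  0 < Num.min 1 (q / p) /\ (Num.min 1 (q / p))^-1 <= M.
Proof.
move=> p0 pMq M1; have M0 : 0 < M by lra.
have q0 : 0 < q by rewrite -(pmulr_rgt0 _ M0); apply: lt_le_trans pMq.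
split; first by rewrite lt_min ltr01 divr_gt0.
rewrite minElt; case: ifP => _; first by rewrite invr1.
by rewrite invf_div ler_pdivrMr.
Qed.

Lemma mulr_gt0_both p q : 0 <= p -> 0 <= q -> 0 < p * q -> 0 < p /\ 0 < q.
Proof.
rewrite !le0r => /orP[/eqP->|p0]; first by rewrite mul0r ltxx.
by case/orP=> [/eqP->|q0]; first by rewrite mulr0 ltxx.
Qed.

(** One factor per kind of choice: selection, perturbation and elimination are each compared with
    the same kind of choice on the inverse way. *)
Lemma ler_prod3 x y z M (s p e s' p' e' : rat) :
    0 <= s -> 0 <= p -> 0 <= e -> 0 <= s' -> 0 <= p' -> 0 <= e' ->
    s <= x * s' -> p <= y * p' -> e <= z * e' -> x * y * z <= M ->
  s * p * e <= M * (s' * p' * e').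
Proof.
move=> s0 p0 e0 s0' p0' e0' sx py ez M0.
apply: le_trans (_ : (x * s') * (y * p') * (z * e') <= _).
  by apply: ler_pM; rewrite ?mulr_ge0 //; apply: ler_pM.
have -> : (x * s') * (y * p') * (z * e') = x * y * z * (s' * p' * e') by ring.
by rewrite ler_wpM2r // !mulr_ge0.
Qed.

Lemma way3_factor p : 2 * p * (p - 1) * 2 * 4 = 16 * p * (p - 1). Proof. by ring. Qed.

Lemma way2_factor p : 2 * p * p * 4 * 1 = 8 * p * p. Proof. by ring. Qed.

Lemma cycle_factor p : 1 * (2 * p) * 1 = 2 * p. Proof. by ring. Qed.

(** The critical comparison is 8n^2 <= 16n(n-1), which for positive n says exactly that n is at
    least 2. *)
Lemma bound_lower (n : rat) (M := 16 * n * (n - 1)) : 2 <= n ->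
  [/\ 1 <= M, 16 <= M, 16 * n <= M, 8 * n * n <= M & 2 * n <= M].
Proof. by move=> n2; rewrite /M; split; nra. Qed.

Lemma invn_ge0 m : 0 <= 1 / m%:R :> rat.
Proof. by rewrite divr_ge0 ?ler01 ?ler0n. Qed.

Lemma bool_gt0 (b : bool) : 0 < b%:R :> rat -> b.
Proof. by case: b; rewrite ?ltxx. Qed.

Lemma half_select p q : 1 <= p * q -> 1 / 2 <= q * (1 / 2 * p).
Proof. lra. Qed.

Lemma half_inv p q : 0 < p -> p^-1 * (1 / 2) <= q -> 1 <= 2 * p * q.
Proof.
move=> p0 H; have := ler_wpM2l (ltW p0) H.
by rewrite mulVKf ?gt_eqF //; lra.
Qed.

Lemma ler_ratio (K s p e s' p' e' M : rat) : 0 <= K ->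
  s * p * e <= M * (s' * p' * e') ->
  K * s * p * e * 1 <= M * (K * s' * p' * e' * 1).
Proof.
move=> K0 H; have -> : K * s * p * e * 1 = K * (s * p * e) by ring.
have -> : M * (K * s' * p' * e' * 1) = K * (M * (s' * p' * e')) by ring.
exact: ler_wpM2l.
Qed.

End Ratios.

Section Acceptance.

Local Open Scope ring_scope.

Variables (V : finType) (adj : rel V) (k : nat).
Hypotheses (adjC : symmetric adj) (adjN : irreflexive adj).
Hypothesis (regG : regular adj k).
Hypothesis (V2 : (1 < #|V|)%N).
Implicit Types (e f g h : edge adj) (A B F T : {set edge adj}).
Implicit Types (u v w x y z : V) (s t : seq V) (a b c d : 'I_k).
Implicit Types (D : precoloring adj k).

(** * Masses of the transformations; step (2) and its inverse ways *)

Lemma subprob_select2 D a b : subprob (select2 D a b).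
Proof. by apply: subprob_coin; [apply: subprob_ret | apply: subprob_unif]. Qed.

Lemma subprob_select3 D a b : subprob (select3 D a b).
Proof. by apply: subprob_coin; [apply: subprob_ret | apply: subprob_unif]. Qed.

Lemma subprob_perturb2 D a b : subprob (perturb2 D a b).
Proof.
rewrite /perturb2; case: ifP => _.
  by do 2![apply: subprob_bind => [|?]; first exact: subprob_unif];
    apply: subprob_ret.
apply: subprob_coin; first exact: subprob_ret.
by apply: subprob_bind => [|?]; [apply: subprob_unif | apply: subprob_ret].
Qed.

Lemma subprob_perturb3 D a b c : subprob (perturb3 D a b c).
Proof.
rewrite /perturb3; case: ifP => _.
  by apply: subprob_bind => [|?]; apply: subprob_unif.
by do 2![apply: subprob_bind => [|?]; first exact: subprob_unif];
  apply: subprob_unif.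
Qed.

(* The sets that perturb2 selects with positive probability. *)
Definition perturb2_support D a b F :=
  if deficients D == set0 then
    F = set0 \/ exists2 e, e \in two_colored D a b & F = [set e]
  else exists v e, [/\ v \in deficients D, e \in edges_at (two_colored D a b) v &
    F = [set e]].

Lemma perturb2_gt0 D a b F : a != b -> almost D a b -> 0 < perturb2 D a b F ->
  perturb2_support D a b F.
Proof.
move=> ab aD; rewrite /perturb2_support /perturb2.
case: (deficients D =P set0) => [->|_] /=.
  rewrite /coin; case: (F =P set0) => [|F0]; first by left.
  have -> : ret set0 F = 0 by rewrite /ret (negPf (introN eqP F0)).
  rewrite mulr0 add0r => H; right.
  have b0 := (subprob_bind (subprob_unif (two_colored D a b))
    (fun e => subprob_ret [set e])).1 F.
  have [_] := mulr_gt0_both (invn_ge0 2) b0 H.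
  case/bind_gt0 => [||e []]; [exact: subprob_unif|by move=> e; exact: subprob_ret|].
  by rewrite unif_gt0 ret_gt0 => eT /eqP->; exists e.
case/bind_gt0 => [||v []]; first exact: subprob_unif.
  by move=> v; apply: subprob_bind => [|e]; [apply: subprob_unif|apply: subprob_ret].
rewrite unif_gt0 => vD.
case/bind_gt0 => [||e []]; first exact: subprob_unif.
  by move=> e; apply: subprob_ret.
rewrite unif_gt0 ret_gt0 (repeated_edgesE adjC adjN regG ab aD vD) => eT /eqP->.
by exists v, e.
Qed.

(** A factor 1/2 for the deficient vertex and 1/2 for one of its two repeated edges. *)
Lemma perturb2_ge D a b F : a != b -> almost D a b -> (#|deficients D| <= 2)%N ->
  deficients D != set0 -> perturb2_support D a b F -> 1 / 4 <= perturb2 D a b F.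
Proof.
move=> ab aD D2 D0; rewrite /perturb2_support /perturb2 (negPf D0) /=.
case=> v [e [vD eT ->]].
apply: le_trans (bind_ge v _ _ _); last 2 first.
- exact: subprob_unif.
- by move=> w; apply: subprob_bind => [|f]; [apply: subprob_unif|apply: subprob_ret].
have -> : (1 / 4 : rat) = 1 / 2 * (1 / 2) by [].
apply: ler_pM; [exact: invn_ge0|exact: invn_ge0|by rewrite div1r unif_ge|].
apply: le_trans (bind_ge e _ _ _); last 2 first.
- exact: subprob_unif.
- by move=> f; apply: subprob_ret.
rewrite (repeated_edgesE adjC adjN regG ab aD vD) /ret eqxx mulr1.
by rewrite div1r unif_ge // (almost_edges_at adjC adjN regG).
Qed.

(** The coin costs a factor 2 and the edge at most 2|V|, whence 4|V|; doing nothing has probability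
    at least 1/2. *)
Lemma perturb2_ge0 D a b F : a != b -> deficients D = set0 ->
  (#|two_colored D a b| <= 2 * #|V|)%N ->
  perturb2_support D a b F -> 1 <= 4 * #|V|%:R * perturb2 D a b F.
Proof.
move=> ab D0 T2; rewrite /perturb2_support /perturb2 D0 eqxx /= /coin.
have V2' : 2 <= #|V|%:R :> rat by rewrite (ler_nat _ 2).
have b0 := (subprob_bind (subprob_unif (two_colored D a b))
  (fun e => subprob_ret [set e])).1.
case=> [->|[e eT ->]].
  have := b0 set0; set p := bind _ _ _ => p0.
  have -> : ret set0 set0 = 1 by move=> S; rewrite /ret eqxx.
  by nra.
have := bind_ge e [set e] (subprob_unif (two_colored D a b))
  (fun e => subprob_ret [set e]); set p := bind _ _ _.
rewrite {1}/ret eqxx mulr1 => Hp.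
have Hu := unif_ge eT T2; have p2 := le_trans Hu Hp.
have r0 : 0 <= ret set0 [set e] by rewrite /ret ler0n.
have n0 : 0 < (2 * #|V|)%N%:R :> rat by rewrite ltr0n; lia.
have : 1 <= 2 * #|V|%:R * p by rewrite -natrM mulrC -ler_pdivrMr // div1r.
by move: r0; set r := ret _ _; nra.
Qed.

(** At each end of [e] exactly one of the two edges of colors [a] and [b] is recolored, which
    toggles whether they agree. *)
Lemma deficient_flip1 D a b e v : a != b -> almost D a b ->
  e \in two_colored D a b ->
  (v \in deficients (flip a b [set e] D)) = (v \in deficients D) (+) incident v e.
Proof.
move=> ab aD eT; have [g [h [gh E]]] := almost_pair adjC adjN regG v ab aD.
have E' : edges_at (two_colored (flip a b [set e] D) a b) v = [set g; h].
  by rewrite two_colored_flip.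
have gTv : g \in edges_at (two_colored D a b) v by rewrite E set21.
have hTv : h \in edges_at (two_colored D a b) v by rewrite E set22.
have [gT vg] : g \in two_colored D a b /\ incident v g.
  by move: gTv; rewrite inE => /andP[].
have [hT vh] : h \in two_colored D a b /\ incident v h.
  by move: hTv; rewrite inE => /andP[].
rewrite !(almost_deficient_pair adjC adjN regG ab _ _ gh) //;
  last exact: almost_flip.
rewrite flip_eq //; congr (_ (+) _); rewrite !inE.
case: (boolP (incident v e)) => ve.
  have : e \in edges_at (two_colored D a b) v by rewrite inE eT.
  rewrite E => /set2P[]->; rewrite eqxx ?(negPf gh) //.
    by rewrite eq_sym (negPf gh).
by case: eqP => [Eg|_]; case: eqP => [Eh|_] //; move: ve; rewrite -?Eg -?Eh ?vg ?vh.
Qed.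

(** The recolored edge must be eligible again. If neither of its ends is deficient afterwards, both
    were before; being at most two, these were all the deficient vertices, so none is left and every
    edge of the two colors is eligible. *)
Lemma perturb2_inv D a b F : a != b -> almost D a b -> (#|deficients D| <= 2)%N ->
  perturb2_support D a b F -> perturb2_support (flip a b F D) a b F.
Proof.
move=> ab aD D2; rewrite {1}/perturb2_support.
have single e : e \in two_colored D a b ->
    (deficients D != set0 ->
     exists2 v, v \in deficients D & incident v e) ->
    perturb2_support (flip a b [set e] D) a b [set e].
  move=> eT De; rewrite /perturb2_support two_colored_flip.
  case: ifPn => [_|D'0]; first by right; exists e.
  suff [v vD' ve] : exists2 v, v \in deficients (flip a b [set e] D) & incident v e.
    by exists v, e; split=> //; rewrite inE eT.
  have [v [w [vw Ee]]] := edge_ends e.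
  have ve := incidentl Ee; have we := incidentr Ee.
  have def u := deficient_flip1 u ab aD eT.
  have [vD'|] := boolP (v \in deficients (flip a b [set e] D)); first by exists v.
  rewrite def ve addbT negbK => vD.
  have [wD'|] := boolP (w \in deficients (flip a b [set e] D)); first by exists w.
  rewrite def we addbT negbK => wD.
  case/set0Pn: D'0 => u; rewrite def.
  have -> : deficients D = [set v; w].
    apply/esym/eqP; rewrite eqEcard cards2 (edge_neq adjN Ee) D2 andbT.
    by apply/subsetP => x /set2P[]->.
  by rewrite (incidentE _ Ee) !inE addbb.
case: ifPn => [/eqP D0|D0].
  case=> [->|[e eT ->]]; last by apply: single => //; rewrite D0 eqxx.
  by rewrite flip0 /perturb2_support D0 eqxx; left.
case=> v [e [vD]]; rewrite inE => /andP[eT ve] ->; apply: single => // _.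
by exists v.
Qed.

Lemma flip_comm a b A B D :
  flip a b A (flip a b B D) = flip a b B (flip a b A D).
Proof.
apply/ffunP => e; rewrite !ffunE.
by case: (e \in A); case: (e \in B).
Qed.

Lemma card_deficients_arc D a b B : a != b -> Defs.proper D ->
  open_arc (two_colored D a b) B -> (#|deficients (flip a b B D)| <= 2)%N.
Proof.
move=> ab pD [->|[x [y [s [W ->]]]]].
  by rewrite flip0 (proper_deficients adjC adjN regG) // cards0.
by rewrite (deficients_flip_walk adjC adjN regG) // cards2; case: (_ != _).
Qed.

Lemma select2_0 D a b : select2 D a b set0 = 1 / 2.
Proof.
rewrite /select2 /coin /ret eqxx /unif inE /is_connected eqxx /=.
by rewrite mul0r mulr0 addr0 mulr1.
Qed.

Lemma select2E D a b A : A != set0 ->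
  select2 D a b A = 1 / 2 * unif (connected_subgraphs D a b) A.
Proof. by move=> A0; rewrite /select2 /coin /ret (negPf A0) mulr0 add0r. Qed.

Lemma select2_connected D a b A : A != set0 -> 0 < select2 D a b A ->
  A \in connected_subgraphs D a b.
Proof.
by move=> A0; rewrite (select2E _ _ _ A0) -unif_gt0; move: (unif _ _) => u; lra.
Qed.

Lemma select2_le D a b A : A != set0 -> select2 D a b A <= 1 / 2.
Proof.
move=> A0; rewrite (select2E _ _ _ A0).
have := subprob_le1 A (subprob_unif (connected_subgraphs D a b)).
by move: (unif _ _) => u; lra.
Qed.

Lemma connected_subgraphs_eq D D' a b : two_colored D a b = two_colored D' a b ->
  connected_subgraphs D a b = connected_subgraphs D' a b.
Proof. by move=> ET; apply/setP => A; rewrite !inE ET. Qed.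

Lemma select2_eq D D' a b : two_colored D a b = two_colored D' a b ->
  select2 D a b = select2 D' a b.
Proof. by move=> ET; rewrite /select2 (connected_subgraphs_eq ET). Qed.

Lemma walk_edges_neq0 T x y s : walk_in T x y s ->
  walk_edges adj [:: x, y & s] != set0.
Proof.
case=> _ /edge_path_adj[e Ee] _; apply/set0Pn; exists e.
by rewrite walk_edges_cons Ee eqxx.
Qed.

Lemma walk_not_proper D a b x y s : a != b -> Defs.proper D ->
  walk_in (two_colored D a b) x y s ->
  deficients (flip a b (walk_edges adj [:: x, y & s]) D) != set0.
Proof.
move=> ab pD W; rewrite (deficients_flip_walk adjC adjN regG) //.
by apply/set0Pn; exists x; rewrite set21.
Qed.

Lemma walk_connected_subgraph D a b x y s : walk_in (two_colored D a b) x y s ->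
  walk_edges adj [:: x, y & s] \in connected_subgraphs D a b.
Proof. by case=> _ P S; rewrite inE S walk_connected. Qed.

Let n : rat := #|V|%:R.

Lemma bound_ge : 2 <= n. Proof. by rewrite /n (ler_nat _ 2). Qed.

Lemma cycle_neq0 A : is_cycle A -> A != set0.
Proof.
case/existsP=> m /existsP[[[|x [|y t]] /= /eqP <-]] //= /and4P[_ _ + /eqP->].
case/andP=> /adj_edge[e Ee] _; apply/set0Pn; exists e.
by rewrite cycle_edgesE rcons_cons walk_edges_cons Ee eqxx.
Qed.

Lemma select2_ge D a b B : a != b -> Defs.proper D ->
  B \in connected_subgraphs D a b -> 1 / 2 <= 2 * n * n * select2 D a b B.
Proof.
move=> ab pD conB; have B0 : B != set0.
  by move: conB; rewrite inE => /andP[/andP[]].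
rewrite (select2E _ _ _ B0).
have := unif_ge conB (card_connected_subgraphs adjC adjN regG ab pD).
have N0 : (0 < 2 * #|V| * #|V|)%N by rewrite !muln_gt0 (ltnW V2).
rewrite -(ltr0n rat) in N0.
by rewrite -[_^-1]div1r (ler_pdivrMr _ _ N0) !natrM -/n => /half_select.
Qed.

(** If [A] is not a cycle, [A] and [B] are both open arcs, and the cases are whether each is empty.
    On the way back the selection of [B] is expensive only when [A] is empty, the recoloring only
    when [B] is empty. *)
Lemma way2_core (c1 c2 : precoloring adj k) a b A F B (M := 16 * n * (n - 1))
    (D1 := flip a b A c1) (D2 := flip a b F D1) :
    a != b -> Defs.proper c1 -> Defs.proper c2 -> c2 = flip a b B D2 ->
    0 < select2 c1 a b A -> 0 < perturb2 D1 a b F -> 0 < eliminate D2 B ->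
  let w := if is_cycle A then (A, B) else (B, A) in
  let D1' := flip a b w.1 c2 in
  let D2' := flip a b F D1' in
  c1 = flip a b w.2 D2' /\
  select2 c1 a b A * perturb2 D1 a b F * eliminate D2 B <=
    M * (select2 c2 a b w.1 * perturb2 D1' a b F * eliminate D2' w.2).
Proof.
have n2 := bound_ge; have [M1 M16 M16n M8 M2] := bound_lower n2.
move=> ab p1 p2 EC2 spos qpos epos.
have T2 : two_colored c2 a b = two_colored c1 a b.
  by rewrite EC2 !two_colored_flip.
have a1 := proper_almost adjC adjN regG p1 (a := a) (b := b).
have aD1 : almost D1 a b by apply: almost_flip.
have aD2 : almost D2 a b by apply: almost_flip.
have [sge _] := subprob_select2 c1 a b; have [sge' _] := subprob_select2 c2 a b.
have qle := subprob_le1 F (subprob_perturb2 D1 a b).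
have qge D := (subprob_perturb2 D a b).1.
have ele D X := subprob_le1 X (subprob_eliminate D).
have ege D := (subprob_eliminate D).1.
have arcB : open_arc (two_colored c2 a b) B.
  have := eliminate_gt0 adjC adjN regG ab aD2 epos.
  rewrite !two_colored_flip -T2; case: ifP => _ H; [by left|by right].
have e4 D X : Defs.proper D -> open_arc (two_colored D a b) X ->
    1 <= 4 * eliminate (flip a b X D) X.
  move=> pD aX; rewrite mulrC -ler_pdivrMr; last by [].
  exact: eliminate_arc_ge.
case: ifP => cA /=.
  have sA : A \subset two_colored c1 a b.
    have A0 := cycle_neq0 cA.
    have := select2_connected A0 spos; rewrite inE => /andP[_].
    exact.
  have altA D : Defs.proper D -> A \subset two_colored D a b ->
      alternating_cycle D a b A.
    by move=> pc sc; rewrite /alternating_cycle cA proper_alternating.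
  have pD1 : Defs.proper D1.
    by apply: proper_flip_cycle => //; apply: altA.
  have pD1' : Defs.proper (flip a b A c2).
    by apply: proper_flip_cycle => //; apply: altA; rewrite ?T2.
  (* All flips exchange a and b, hence commute: the way back undoes A first. *)
  have ED2' : flip a b F (flip a b A c2) = flip a b B c1.
    rewrite EC2 /D2 /D1 (flip_comm _ _ A B) (flip_comm _ _ A F) flipK.
    by rewrite (flip_comm _ _ F B) flipK.
  split; first by rewrite ED2' flipK.
  rewrite (select2_eq T2) ED2'.
  have -> : perturb2 (flip a b A c2) a b = perturb2 D1 a b.
    rewrite /perturb2 !(proper_deficients adjC adjN regG) // eqxx /=.
    by rewrite !two_colored_flip T2.
  apply: (ler_prod3 (x := 1) (y := 1) (z := 4));
    [exact: sge|exact: qge|exact: ege|exact: sge|exact: qge|exact: ege|..].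
  - by rewrite mul1r lexx.
  - by rewrite mul1r lexx.
  - by apply: le_trans (ele _ _) _; apply: e4; rewrite -?T2.
  - by rewrite !mul1r; apply: le_trans M16; rewrite ler_nat.
have ED2 : flip a b B c2 = D2 by rewrite EC2 flipK.
have ED1 : flip a b F D2 = D1 by rewrite flipK.
have EC1 : flip a b A D1 = c1 by rewrite flipK.
rewrite ED2 ED1 EC1; split; first exact: erefl.
have arcA : open_arc (two_colored c1 a b) A.
  have [->|A0] := eqVneq A set0; first by left.
  have := select2_connected A0 spos; rewrite inE => /andP[conA sA].
  case: (connected_path_or_cycle adjC adjN (fun z =>
    proper_edges_at adjC adjN regG z ab p1) sA conA); first by rewrite cA.
  case=> [x [y [s [U P EA]]]]; right; exists x, y, s; split=> //.
  by split=> //; rewrite -EA.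
have sup1 := perturb2_gt0 ab aD1 qpos.
have def1 : (#|deficients D1| <= 2)%N by apply: card_deficients_arc.
have sup2 := perturb2_inv ab aD1 def1 sup1; rewrite -/D2 in sup2.
have def2 : (#|deficients D2| <= 2)%N by rewrite -ED2 card_deficients_arc.
have eA := e4 _ _ p1 arcA; rewrite -/D1 in eA.
have [EB|B0] := eqVneq B set0.
  have D2E : D2 = c2 by rewrite EC2 EB flip0.
  have def2' : deficients D2 = set0.
    by rewrite D2E (proper_deficients adjC adjN regG).
  have cT : (#|two_colored D2 a b| <= 2 * #|V|)%N.
    by rewrite D2E card_two_colored.
  have q2 := perturb2_ge0 ab def2' cT sup2; rewrite -/n in q2.
  rewrite EB select2_0.
  (* With both arcs empty, the two perturbations start from proper colorings with the same
     two-colored edges and have equal probabilities. *)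
  have [EA|A0] := eqVneq A set0.
    have D1E : D1 = c1 by rewrite /D1 EA flip0.
    have -> : perturb2 D1 a b F = perturb2 D2 a b F.
      rewrite /perturb2 def2' D1E (proper_deficients adjC adjN regG) // eqxx /=.
      by rewrite -T2 D2E.
    have -> : eliminate D1 A = 1.
      by rewrite D1E EA /eliminate (proper_deficients adjC adjN regG) // eqxx /=
        /ret eqxx.
    rewrite EA select2_0.
    apply: (ler_prod3 (x := 1) (y := 1) (z := 1));
      [exact: invn_ge0|exact: qge|exact: ege|exact: invn_ge0|exact: qge|exact: ler01|..].
    - by rewrite mul1r lexx.
    - by rewrite mul1r lexx.
    - by rewrite mul1r; apply: ele.
    - by rewrite !mul1r.
  have sle := select2_le c1 a b A0.
  (* On the way back the edge is chosen among all edges of the two colors, a factor 4n, and [A] is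
     recovered by an elimination, a factor 4. *)
  apply: (ler_prod3 (x := 1) (y := 4 * n) (z := 4));
    [exact: sge|exact: qge|exact: ege|exact: invn_ge0|exact: qge|exact: ege|..].
  - by rewrite mul1r.
  - exact: le_trans qle q2.
  - exact: le_trans (ele _ _) eA.
  - by rewrite mul1r mulrAC -natrM.
have [x [y [s [W EB]]]] : exists x y s, walk_in (two_colored c2 a b) x y s /\
    B = walk_edges adj [:: x, y & s].
  by case: arcB => // EB; rewrite EB eqxx in B0.
have def2' : deficients D2 != set0 by rewrite -ED2 EB walk_not_proper.
have q2 : 1 <= 4 * perturb2 D2 a b F.
  by rewrite mulrC -ler_pdivrMr; [apply: perturb2_ge|].
have conB : B \in connected_subgraphs c2 a b by rewrite EB walk_connected_subgraph.
have [EA|A0] := eqVneq A set0; last first.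
  have conA := select2_connected A0 spos.
  (* Exchanging the two colors does not change the subgraph that they form, so both selections are
     uniform over the same connected subgraphs. *)
  have -> : select2 c1 a b A = select2 c2 a b B.
    rewrite (select2E _ _ _ A0) (select2E _ _ _ B0) /unif.
    rewrite (connected_subgraphs_eq T2) conA.
    by rewrite -(connected_subgraphs_eq T2) conB.
  apply: (ler_prod3 (x := 1) (y := 4) (z := 4));
    [exact: sge'|exact: qge|exact: ege|exact: sge'|exact: qge|exact: ege|..].
  - by rewrite mul1r lexx.
  - exact: le_trans qle q2.
  - exact: le_trans (ele _ _) eA.
  - by rewrite mul1r -natrM.
have D1E : D1 = c1 by rewrite /D1 EA flip0.
have -> : eliminate D1 A = 1.
  by rewrite D1E EA /eliminate (proper_deficients adjC adjN regG) // eqxx /=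
    /ret eqxx.
rewrite EA select2_0.
(* Nothing was flipped first, yet an elimination was needed: the way back must select [B] itself
   among up to 2n^2 connected subgraphs. *)
apply: (ler_prod3 (x := 2 * n * n) (y := 4) (z := 1));
  [exact: invn_ge0|exact: qge|exact: ege|exact: sge'|exact: qge|exact: ler01|..].
- exact: select2_ge.
- exact: le_trans qle q2.
- by rewrite mul1r; apply: ele.
- by rewrite way2_factor.
Qed.

Lemma way_prob2E (C1 C2 : coloring adj k) a b A F B
    (D1 := flip a b A (val C1)) (D2 := flip a b F D1) :
  way_prob C1 (Way2 a b A F B) C2 =
    1 / 4 * ((a < b)%N%:R / 'C(k, 2)%:R) * select2 (val C1) a b A *
    perturb2 D1 a b F * eliminate D2 B * (val C2 == flip a b B D2)%:R.
Proof. by []. Qed.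

(** The probability [K] of the color choice is common to both directions and cancels. *)
Lemma way2_ratio (C1 C2 : coloring adj k) a b A F B :
    0 < way_prob C1 (Way2 a b A F B) C2 ->
  way_prob C1 (Way2 a b A F B) C2 <=
    16 * n * (n - 1) * way_prob C2 (inverse_way (Way2 a b A F B)) C1.
Proof.
have p1 : Defs.proper (val C1) := valP C1.
have p2 : Defs.proper (val C2) := valP C2.
rewrite [way_prob C1 _ _]way_prob2E; set K := 1 / 4 * _.
have K0 : 0 <= K by rewrite /K mulr_ge0 ?invn_ge0 // divr_ge0 ?ler0n.
have Kab : 0 < K -> a != b.
  rewrite /K; case: (ltngtP a b) => [lt_ab _|_|_]; rewrite ?mul0r ?mulr0 ?ltxx //.
  by apply: contraTneq lt_ab => ->; rewrite ltnn.
set D1 := flip a b A _; set D2 := flip a b F D1.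
have [s0 _] := subprob_select2 (val C1) a b.
have [q0 _] := subprob_perturb2 D1 a b; have [e0 _] := subprob_eliminate D2.
move=> H; have [{}H /bool_gt0 C2E] := mulr_gt0_both
  (mulr_ge0 (mulr_ge0 (mulr_ge0 K0 (s0 A)) (q0 F)) (e0 B)) (ler0n _ _) H.
rewrite C2E; have EC2 := eqP C2E.
have [{}H epos] := mulr_gt0_both (mulr_ge0 (mulr_ge0 K0 (s0 A)) (q0 F)) (e0 B) H.
have [{}H qpos] := mulr_gt0_both (mulr_ge0 K0 (s0 A)) (q0 F) H.
have [Kpos spos] := mulr_gt0_both K0 (s0 A) H.
have := way2_core (Kab Kpos) p1 p2 EC2 spos qpos epos.
rewrite /inverse_way; case: (is_cycle A); lazy zeta beta iota delta [fst snd].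
  by case=> EC1 le12; rewrite way_prob2E -/K -EC1 eqxx; apply: ler_ratio.
by case=> EC1 le12; rewrite way_prob2E -/K -EC1 eqxx; apply: ler_ratio.
Qed.

(** * Step (3) and its inverse ways *)

Lemma select3_0 D a b : select3 D a b set0 = 1 / 2.
Proof.
rewrite /select3 /coin /ret eqxx /unif inE eqxx andbF /=.
by rewrite mul0r mulr0 addr0 mulr1.
Qed.

Lemma select3E D a b A : A != set0 ->
  select3 D a b A = 1 / 2 * unif (even_subpaths D a b) A.
Proof. by move=> A0; rewrite /select3 /coin /ret (negPf A0) mulr0 add0r. Qed.

Lemma select3_even D a b A : A != set0 -> 0 < select3 D a b A ->
  A \in even_subpaths D a b.
Proof.
by move=> A0; rewrite (select3E _ _ _ A0) -unif_gt0; move: (unif _ _) => u; lra.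
Qed.

Lemma select3_le D a b A : A != set0 -> select3 D a b A <= 1 / 2.
Proof.
move=> A0; rewrite (select3E _ _ _ A0).
have := subprob_le1 A (subprob_unif (even_subpaths D a b)).
by move: (unif _ _) => u; lra.
Qed.

Lemma perturb3_proper_gt0 D a b c d F : deficients D = set0 ->
    0 < perturb3 D a b c (d, F) ->
  exists v f, [/\ f \in edges_at (two_colored D a b) v, d = D f,
    alternating_cycle D d c F, f \in F &
    exists e, [/\ e \in F, incident v e & D e = c]].
Proof.
move=> D0; rewrite /perturb3 D0 eqxx /=.
case/bind_gt0 => [||v [_]]; first exact: subprob_unif.
  by move=> v; apply: subprob_bind => [|e]; apply: subprob_unif.
case/bind_gt0 => [||f []]; first exact: subprob_unif.
  by move=> e; apply: subprob_unif.
rewrite !unif_gt0 => fT; rewrite inE /= => /and4P[/eqP-> aF fF].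
by case/exists_inP=> e eF /andP[ve /eqP De]; exists v, f; split=> //; exists e.
Qed.

(** A factor 1/n for the vertex and 1/2 for the edge [f]; the cycle through [f] is then unique
    because the coloring is proper. *)
Lemma perturb3_proper_ge D a b c v f F : a != b -> c != a -> c != b ->
    Defs.proper D -> f \in edges_at (two_colored D a b) v -> 
    alternating_cycle D (D f) c F -> f \in F ->
    (exists e, [/\ e \in F, incident v e & D e = c]) ->
  1 <= 2 * n * perturb3 D a b c (D f, F).
Proof.
move=> ab ca cb pD fT aF fF [e [eF ve De]].
have n2 := bound_ge.
rewrite /perturb3 (proper_deficients adjC adjN regG) // eqxx /=.
set R := bind _ _ _.
have : n^-1 * (1 / 2) <= R.
  apply: le_trans (bind_ge v _ _ _); last 2 first.
  - exact: subprob_unif.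
  - by move=> w; apply: subprob_bind => [|g]; apply: subprob_unif.
  apply: ler_pM; [by rewrite invr_ge0 ler0n|exact: invn_ge0| |].
    by apply: unif_ge; rewrite ?inE // cardsT.
  apply: le_trans (bind_ge f _ _ _); last 2 first.
  - exact: subprob_unif.
  - by move=> g; apply: subprob_unif.
  rewrite -[1 / 2]mulr1; apply: ler_pM; [exact: invn_ge0|exact: ler01| |].
    by rewrite div1r unif_ge // (proper_edges_at adjC adjN regG).
  apply: le_trans (unif_ge (n := 1) _ _); first by rewrite invr1.
    rewrite inE /= eqxx aF fF; apply/exists_inP; exists e => //.
    by rewrite ve De eqxx.
  apply/card_le1_eqP => -[d1 F1] [d2 F2]; rewrite !inE /=.
  move=> /and4P[/eqP-> /andP[c1 /andP[s1 _]] f1 _].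
  move=> /and4P[/eqP-> /andP[c2 /andP[s2 _]] f2 _]; congr (_, _).
  have [_ vf] : f \in two_colored D a b /\ incident v f.
    by move: fT; rewrite inE => /andP[].
  apply: (cycle_uniq adjC adjN c2 c1 s2 s1 _ f2 f1 vf) => z _.
  apply: (proper_edges_at adjC adjN regG) => //.
  move: fT; rewrite !inE => /andP[/orP[]/eqP-> _]; first by rewrite eq_sym.
  by rewrite eq_sym.
by apply: half_inv; rewrite ltr0n ltnW.
Qed.

Lemma perturb3_deficient_gt0 D a b c d F : deficients D != set0 ->
    0 < perturb3 D a b c (d, F) ->
  exists v, [/\ v \in deficients D, exists d', deficiency D v d d',
    alternating_cycle D d c F & exists2 e, e \in F & incident v e].
Proof.
move=> D0; rewrite /perturb3 D0.
case/bind_gt0 => [||v []]; first exact: subprob_unif.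
  by move=> v; apply: subprob_unif.
rewrite !unif_gt0 => vD; rewrite inE /= => /and3P[/existsP[d' vd] aF].
case/exists_inP=> e eF ve; exists v; split=> //; first by exists d'.
by exists e.
Qed.

(** In the colors [d] and [c] the vertex [v] has degree 3, but a cycle through it must use its only
    [c]-edge. The last hypothesis keeps all other degrees at most 2, so [cycle_uniq] leaves a single
    cycle and only the choice of [v] costs a factor 2. *)
Lemma perturb3_deficient_ge D a b c d v d' F : a != b -> c != a -> c != b ->
    almost D a b -> (#|deficients D| <= 2)%N ->
    v \in deficients D -> deficiency D v d d' -> alternating_cycle D d c F ->
    (exists2 e, e \in F & incident v e) ->
    (forall u, u != v -> #|colored_at D u d| <= 1)%N ->
  1 <= 2 * perturb3 D a b c (d, F).
Proof.
move=> ab ca cb aD D2 vD vd aF [e eF ve] d1.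
have D0 : deficients D != set0 by apply/set0Pn; exists v.
suff : 1 / 2 * 1 <= perturb3 D a b c (d, F).
  by move: (perturb3 _ _ _ _ _) => p; lra.
rewrite /perturb3 D0; apply: le_trans (bind_ge v _ _ _); last 2 first.
- exact: subprob_unif.
- by move=> w; apply: subprob_unif.
apply: ler_pM; [exact: invn_ge0|exact: ler01|by rewrite div1r unif_ge|].
apply: le_trans (unif_ge (n := 1) _ _); first by rewrite invr1.
  rewrite inE /= aF; apply/and3P; split=> //; first by apply/existsP; exists d'.
  by apply/exists_inP; exists e.
have only_d c1 : [exists c2, deficiency D v c1 c2] -> c1 = d.
  case/existsP=> c2 vc; apply: contraTeq isT => cd.
  case/and3P: vd => _ /forall_inP/(_ c1 cd) + _.
  by case/and3P: vc => /eqP->.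
have cedge F' : alternating_cycle D d c F' -> [exists e in F', incident v e] ->
    exists g, [/\ g \in F', incident v g & D g = c].
  move=> aF' /exists_inP[h hF vh].
  have [f [_ E Df _]] := alternating_cycle_at adjC adjN aF' hF vh.
  have : f \in edges_at F' v by rewrite E set22.
  rewrite inE => /andP[fF vf]; case/and3P: aF' => _ /subsetP/(_ h hF).
  rewrite inE => /orP[]/eqP Dh _; last by exists h.
  by exists f; rewrite Df Dh tpermL.
apply/card_le1_eqP => -[x1 F1] [x2 F2]; rewrite !inE /=.
move=> /and3P[/only_d-> a1 v1] /and3P[/only_d-> a2 v2]; congr (_, _).
have [g1 [g1F vg1 Dg1]] := cedge _ a1 v1.
have [g2 [g2F vg2 Dg2]] := cedge _ a2 v2.
have Eg : g1 = g2.
  have /eqP/cards1P[g /setP Eg] := aD v c ca cb.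
  have := Eg g1; have := Eg g2; rewrite !inE vg1 vg2 Dg1 Dg2 eqxx.
  by move=> /esym/eqP-> /esym/eqP.
subst g2; case/and3P: a1 => c1 s1 _; case/and3P: a2 => c2 s2 _.
apply: (cycle_uniq adjC adjN c2 c1 s2 s1 _ g2F g1F vg1) => z zv.
rewrite edges_at_two_colored; apply: leq_trans (leq_card_setU _ _) _.
by have := d1 z zv; rewrite (aD z c ca cb) addn1.
Qed.

Lemma select3_ge D a b B : a != b -> Defs.proper D ->
  B \in even_subpaths D a b -> 1 / 2 <= 2 * n * (n - 1) * select3 D a b B.
Proof.
move=> ab pD evB; have B0 : B != set0 by move: evB; rewrite inE => /and4P[].
rewrite (select3E _ _ _ B0).
have := unif_ge evB (card_even_subpaths adjC adjN regG ab pD).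
have N0 : (0 < 2 * #|V| * #|V|.-1)%N.
  by rewrite !muln_gt0 (ltnW V2) -subn1 subn_gt0 V2.
have En : (#|V|.-1)%:R = n - 1 :> rat.
  by rewrite /n -[in RHS](prednK (n := #|V|)) 1?ltnW // -natr1 addrK.
rewrite -(ltr0n rat) in N0.
by rewrite -[_^-1]div1r (ler_pdivrMr _ _ N0) !natrM -/n En => /half_select.
Qed.

(** Deficient vertices with different counts of [a] repeat different colors. This supplies the last
    hypothesis of [perturb3_deficient_ge]. *)
Lemma deficient_count D a b u v c d : a != b -> almost D a b ->
    deficiency D v c d ->
    (u \in deficients D -> #|colored_at D u a| != #|colored_at D v a|) ->
  (#|colored_at D u c| <= 1)%N.
Proof.
move=> ab aD; rewrite (almost_deficiency adjC adjN regG _ _ _ ab aD).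
move=> /andP[/eqP vc cab] uv.
have := almost_sum adjC adjN regG u ab aD.
have := almost_sum adjC adjN regG v ab aD.
move: uv vc; rewrite (almost_deficient adjC adjN regG _ ab aD).
by case/orP: cab => /andP[/eqP-> _]; lia.
Qed.

(** A nonempty even path [A] creates deficiencies of opposite kinds, and the cycle flip preserves
    all color counts. So [B] joins the same two vertices, still of opposite kinds, and is an even
    path too; hence it can be selected on the way back. *)
Lemma way3_core (c1 c2 : precoloring adj k) a b c A d F B (M := 16 * n * (n - 1))
    (D1 := flip a b A c1) (D2 := flip d c F D1) :
    a != b -> c != a -> c != b ->
    Defs.proper c1 -> Defs.proper c2 -> c2 = flip a b B D2 ->
    0 < select3 c1 a b A -> 0 < perturb3 D1 a b c (d, F) -> 0 < eliminate D2 B ->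
  let D1' := flip a b B c2 in
  let D2' := flip d c F D1' in
  c1 = flip a b A D2' /\
  select3 c1 a b A * perturb3 D1 a b c (d, F) * eliminate D2 B <=
    M * (select3 c2 a b B * perturb3 D1' a b c (d, F) * eliminate D2' A).
Proof.
have n2 := bound_ge; have [M1 M16 M16n M8 M2] := bound_lower n2.
move=> ab ca cb p1 p2 EC2 spos qpos epos /=.
have a1 := proper_almost adjC adjN regG p1 (a := a) (b := b).
have aD1 : almost D1 a b by apply: almost_flip.
have [sge _] := subprob_select3 c1 a b; have [sge' _] := subprob_select3 c2 a b.
have qle := subprob_le1 (d, F) (subprob_perturb3 D1 a b c).
have qge D := (subprob_perturb3 D a b c).1.
have ele D X := subprob_le1 X (subprob_eliminate D).
have ege D := (subprob_eliminate D).1.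
have e4 D X : Defs.proper D -> open_arc (two_colored D a b) X ->
    1 <= 4 * eliminate (flip a b X D) X.
  move=> pD aX; rewrite mulrC -ler_pdivrMr; last by [].
  exact: eliminate_arc_ge.
have ED2 : flip a b B c2 = D2 by rewrite EC2 flipK.
have ED1 : flip d c F D2 = D1 by rewrite flipK.
have EC1 : flip a b A D1 = c1 by rewrite flipK.
rewrite ED2 ED1 EC1; split; first exact: erefl.
have [EA|A0] := eqVneq A set0.
  have D1E : D1 = c1 by rewrite /D1 EA flip0.
  have def1 : deficients D1 = set0 by rewrite D1E (proper_deficients adjC adjN regG).
  have [v [f [fT Ed aF fF [e [eF ve De]]]]] := perturb3_proper_gt0 def1 qpos.
  have aF2 := alternating_cycle_flip aF; rewrite -/D2 in aF2.
  have pD2 : Defs.proper D2.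
    by apply: (proper_flip_cycle adjC adjN regG aF); rewrite D1E.
  have EB : B = set0.
    move: epos; rewrite /eliminate (proper_deficients adjC adjN regG) //.
    by rewrite eqxx ret_gt0 => /eqP.
  rewrite EA EB !select3_0.
  have -> : eliminate D1 set0 = 1 by rewrite /eliminate def1 eqxx /= /ret eqxx.
  have dab : d \in [:: a; b].
    by move: fT; rewrite Ed !inE => /andP[].
  (* The flip exchanges the colors of [e] and [f]: on the way back [e] is the selected edge and [f]
     the one of the distinguished color. *)
  have q2 : 1 <= 2 * n * perturb3 D2 a b c (d, F).
    have D2e : D2 e = d by rewrite /D2 ffunE eF De tpermR.
    have D2f : D2 f = c by rewrite /D2 ffunE fF -Ed tpermL.
    rewrite -D2e in aF2 *; apply: (perturb3_proper_ge (v := v)) => //.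
      by rewrite !inE D2e ve andbT; move: dab; rewrite !inE.
    by exists f; split=> //; move: fT; rewrite inE => /andP[].
  apply: (ler_prod3 (x := 1) (y := 2 * n) (z := 1));
    [exact: invn_ge0|exact: qge|exact: ege|exact: invn_ge0|exact: qge|exact: ler01|..].
  - by rewrite mul1r lexx.
  - exact: le_trans qle q2.
  - by rewrite mul1r; apply: ele.
  - by rewrite cycle_factor.
have Aeven := select3_even A0 spos.
have := Aeven; rewrite inE => /and4P[pA _ oA sA].
have [x [y [s [W EA]]]] := is_path_walk pA A0 sA.
have def1 := deficients_flip_walk adjC adjN regG ab p1 W.
rewrite -EA -/D1 in def1.
have cnt1 := walk_ends_count adjC adjN regG ab p1 W.
rewrite /= -EA -/D1 in cnt1.
have odds : odd (size s).
  have [U P _] := W; move: oA.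
  by rewrite EA (card_walk_edges P U) /= negbK.
rewrite odds /= in cnt1.
have def1' : deficients D1 != set0.
  by rewrite def1; apply/set0Pn; exists x; rewrite set21.
have [v [vD [d' vd] aF [e eF ve]]] := perturb3_deficient_gt0 def1' qpos.
have aF2 := alternating_cycle_flip aF; rewrite -/D2 in aF2.
have cnt2 u c3 : #|colored_at D2 u c3| = #|colored_at D1 u c3|.
  exact: card_colored_at_cycle.
have def2 : deficients D2 = deficients D1 by apply: deficients_flip_cycle.
have aD2 : almost D2 a b by apply: almost_flip_cycle.
have [x' [y' [s' [W' EB]]]] : exists x y s,
    walk_in (two_colored c2 a b) x y s /\ B = walk_edges adj [:: x, y & s].
  have := eliminate_gt0 adjC adjN regG ab aD2 epos.
  by rewrite def2 (negPf def1') -ED2 two_colored_flip.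
have def2' := deficients_flip_walk adjC adjN regG ab p2 W'.
rewrite -EB ED2 def2 def1 in def2'.
have odds' : odd (size s').
  apply: (uneven_ends_odd adjC adjN regG ab p2 W' def2').
  by rewrite -EB ED2 !cnt2 cnt1.
have Beven : B \in even_subpaths c2 a b.
  have [U' P' S'] := W'; rewrite inE EB (walk_is_path W') (walk_edges_neq0 W') S'.
  by rewrite (card_walk_edges P' U') /= odds'.
have B0 : B != set0 by rewrite EB (walk_edges_neq0 W').
have defle : (#|deficients D2| <= 2)%N by rewrite def2 def1 cards2; case: (_ != _).
have q2 : 1 <= 2 * perturb3 D2 a b c (d, F).
  have vD2 : v \in deficients D2 by rewrite def2.
  have vd2 : deficiency D2 v d d' by rewrite deficiency_flip_cycle.
  have eF2 : exists2 e, e \in F & incident v e by exists e.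
  apply: (perturb3_deficient_ge ab ca cb aD2 defle vD2 vd2 aF2 eF2) => u uv.
   rewrite cnt2.
  apply: (deficient_count ab aD1 vd) => uD.
  move: uD vD uv; rewrite def1 => /set2P[]-> /set2P[]->; rewrite ?eqxx ?cnt1 //.
  by move=> _; rewrite eq_sym cnt1.
have eA : 1 <= 4 * eliminate D1 A.
  by apply: (e4 _ _ p1); right; exists x, y, s.
have sle := select3_le c1 a b A0.
apply: (ler_prod3 (x := 2 * n * (n - 1)) (y := 2) (z := 4));
  [exact: sge|exact: qge|exact: ege|exact: sge'|exact: qge|exact: ege|..].
- exact: le_trans sle (select3_ge ab p2 Beven).
- exact: le_trans qle q2.
- exact: le_trans (ele _ _) eA.
- by rewrite way3_factor lexx.
Qed.

Lemma way_prob3E (C1 C2 : coloring adj k) a b c A d F B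
    (D1 := flip a b A (val C1)) (D2 := flip d c F D1) :
  way_prob C1 (Way3 a b c A d F B) C2 =
    1 / 4 * ([&& (a < b)%N, c != a & c != b]%:R / 'C(k, 3)%:R * (1 / 3)) *
    select3 (val C1) a b A * perturb3 D1 a b c (d, F) * eliminate D2 B *
    (val C2 == flip a b B D2)%:R.
Proof. by []. Qed.

Lemma way3_ratio (C1 C2 : coloring adj k) a b c A d F B :
    0 < way_prob C1 (Way3 a b c A d F B) C2 ->
  way_prob C1 (Way3 a b c A d F B) C2 <=
    16 * n * (n - 1) * way_prob C2 (inverse_way (Way3 a b c A d F B)) C1.
Proof.
have p1 : Defs.proper (val C1) := valP C1.
have p2 : Defs.proper (val C2) := valP C2.
rewrite [way_prob C1 _ _]way_prob3E; set K := 1 / 4 * _.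
have K0 : 0 <= K by rewrite /K !mulr_ge0 ?invn_ge0 ?invr_ge0 ?ler0n.
have Kab : 0 < K -> [/\ a != b, c != a & c != b].
  rewrite /K; case: (ltngtP a b) => [lt_ab|_|_]; rewrite ?mul0r ?mulr0 ?ltxx //.
  have ab : a != b by apply: contraTneq lt_ab => ->; rewrite ltnn.
  by rewrite /=; case: (c != a); case: (c != b);
    rewrite /= ?mul0r ?mulr0 ?ltxx // => _.
set D1 := flip a b A _; set D2 := flip d c F D1.
have [s0 _] := subprob_select3 (val C1) a b.
have [q0 _] := subprob_perturb3 D1 a b c; have [e0 _] := subprob_eliminate D2.
move=> H; have [{}H /bool_gt0 C2E] := mulr_gt0_both
  (mulr_ge0 (mulr_ge0 (mulr_ge0 K0 (s0 A)) (q0 (d, F))) (e0 B)) (ler0n _ _) H.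
rewrite C2E; have EC2 := eqP C2E.
have [{}H epos] :=
  mulr_gt0_both (mulr_ge0 (mulr_ge0 K0 (s0 A)) (q0 (d, F))) (e0 B) H.
have [{}H qpos] := mulr_gt0_both (mulr_ge0 K0 (s0 A)) (q0 (d, F)) H.
have [Kpos spos] := mulr_gt0_both K0 (s0 A) H.
have [ab ca cb] := Kab Kpos.
have := way3_core ab ca cb p1 p2 EC2 spos qpos epos.
rewrite /inverse_way; lazy zeta beta.
by case=> EC1 le12; rewrite way_prob3E -/K -EC1 eqxx; apply: ler_ratio.
Qed.

Lemma acceptance_bound (C1 C2 : coloring adj k) (w : way adj k) :
  0 < way_prob C1 w C2 ->
  0 < acceptance C1 w C2 /\ (acceptance C1 w C2)^-1 <= 16 * n * (n - 1).
Proof.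
have [M1 _ _ _ _] := bound_lower bound_ge => w0.
rewrite /acceptance; apply: (min1_ratio_bound w0 _ M1).
case: w w0 => [|a b A F B|a b c A d F B]; last 2 first.
- exact: way2_ratio.
- exact: way3_ratio.
(* The idle way is equally probable in both directions. *)
rewrite [way_prob C1 _ _]/(_ * _) eq_sym => H; apply: ler_peMl.
  exact: ltW.
by have [] := bound_lower bound_ge.
Qed.

End Acceptance.

(** * Eliminating deficiencies along directed walks *)

Section Realizations.

Variables (V : finType) (adj : rel V) (k : nat).
Hypotheses (adjC : symmetric adj) (adjN : irreflexive adj).
Hypothesis (regG : regular adj k).
Variable X : {set V}.
Hypothesis bipX : forall u v, adj u v -> (u \in X) != (v \in X).
Implicit Types (e f g h : edge adj) (A B F T : {set edge adj}).
Implicit Types (u v w x y z p q : V) (s t : seq V) (a b c d : 'I_k).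
Implicit Types (D : precoloring adj k) (C : coloring adj k).

Lemma edge_sides e u v : val e = [set u; v] -> (u \in X) = ~~ (v \in X).
Proof.
by move=> Ee; have := bipX (edge_adj adjC adjN Ee); case: (u \in X); case: (v \in X).
Qed.

Lemma path_rel_edge (r : rel V) x s e : 
    (forall p q, r p q -> exists f, val f = [set p; q]) ->
    path r x s -> e \in walk_edges adj (x :: s) ->
  exists p q, val e = [set p; q] /\ r p q.
Proof.
move=> rE; elim: s x => [|y s IH] x; first by rewrite walk_edges1.
case/andP=> rxy Ps; rewrite walk_edges_cons => /orP[/eqP Ee|]; last exact: IH.
by exists x, y.
Qed.

Lemma colored_at_gt0 D v c :
  reflect (exists e, incident v e /\ D e = c) (0 < #|colored_at D v c|).
Proof.
rewrite card_gt0; apply: (iffP (set0Pn _)) => [[e]|[e [ve De]]].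
  by rewrite inE => /andP[ve /eqP De]; exists e.
by exists e; rewrite inE ve De eqxx.
Qed.

Lemma colored_at_le1 D v c e f : #|colored_at D v c| <= 1 ->
  incident v e -> incident v f -> D e = c -> D f = c -> e = f.
Proof.
move=> /card_le1_eqP le1 ve vf De Df.
by apply: le1; rewrite inE ?ve ?vf ?De ?Df eqxx.
Qed.

Lemma colored_at_gt1 D v c e f : e != f ->
  incident v e -> incident v f -> D e = c -> D f = c -> 1 < #|colored_at D v c|.
Proof.
move=> ef ve vf De Df; apply: contraNltn ef => le1.
by rewrite (colored_at_le1 le1 ve vf De Df).
Qed.

(* Edges of color c point away from the side of v and edges of color c' towards
   it, so that alternating walks leaving v become directed. *)
Definition orient (c c' : 'I_k) v y := if (y \in X) == (v \in X) then c else c'.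

Definition arrow D c c' v x y :=
  [exists e, (val e == [set x; y]) && (D e == orient c c' v x)].

Lemma arrowP D c c' v x y :
  reflect (exists e, val e = [set x; y] /\ D e = orient c c' v x)
    (arrow D c c' v x y).
Proof.
apply: (iffP existsP) => [[e /andP[/eqP Ee /eqP De]]|[e [Ee De]]]; exists e => //.
by rewrite Ee De !eqxx.
Qed.

Lemma orient_other c c' v e x y : val e = [set x; y] ->
  orient c c' v x = orient c' c v y.
Proof.
move=> /edge_sides; rewrite /orient => ->.
by case: (y \in X); case: (v \in X).
Qed.

(** Maximality puts [y] on the walk. Unless it is the start, [y] is then entered by a walk edge as
    well as by [e], both of the color pointing into [y]; and since [e] is no loop, [y] is not the
    last vertex, so the walk also leaves it. *)
Lemma directed_walk D c c' v : exists s,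
  [/\ path (arrow D c c' v) v s, uniq (v :: s), path adj v s &
    forall e y, val e = [set last v s; y] -> D e = orient c c' v (last v s) ->
    y = v \/ (exists2 f, e != f & incident y f /\ D f = D e) /\
      (exists q, arrow D c c' v y q)].
Proof.
have [s [Ps Us Ms]] := maximal_path (arrow D c c' v) v; exists s; split=> //.
  by apply: sub_path Ps => x y /arrowP[e [/(edge_adj adjC adjN)]].
move=> e y Ee De; have ys : y \in v :: s by apply: Ms; apply/arrowP; exists e.
have [|yv] := eqVneq y v; [by left|right].
have {}ys : y \in s by move: ys; rewrite inE (negPf yv).
move: Ps Us Ee De; case/splitPr: ys => s1 s2; rewrite last_cat cat_path.
rewrite [last _ (y :: s2)]/= => /andP[_ /andP[/arrowP[f [Ef Df]] P2]] Us Ee De.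
have Dfe : D f = D e by rewrite De Df (orient_other _ _ _ Ee) (orient_other _ _ _ Ef).
split.
  exists f; last by split=> //; apply: incidentr Ef.
  apply: contraTneq Us => ef; rewrite ef setUC in Ee.
  rewrite -cat_cons cat_uniq !negb_and; apply/orP; right; apply/orP; left.
  rewrite negbK.
  apply/hasP; exists (last y s2); first exact: mem_last.
  rewrite setUC in Ef; rewrite -(other_end_inj adjN Ef Ee).
  exact: mem_last.
case: s2 P2 {Us De Dfe} Ee => [_ Ee|q s2 /andP[yq _] _]; last by exists q.
by have := edge_neq adjN Ee; rewrite eqxx.
Qed.

(* C arises from D by eliminating its deficiencies. *)
Definition realizes a b D C :=
  exists2 B, D = flip a b B (val C) & open_arc (two_colored (val C) a b) B.

Lemma realizesC a b D C : realizes a b D C -> realizes b a D C.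
Proof. by case=> B -> arcB; exists B; rewrite 1?flipC // two_coloredC. Qed.

Lemma proper_realizes a b C : realizes a b (val C) C.
Proof. by exists set0; [rewrite flip0 | left]. Qed.

(** The directed walk from [v] can stop only at [w]. From any other last vertex an edge leads on,
    and it cannot close up: [v] lacks the color [b] of entering edges, a vertex entered twice is
    deficient, and [w] has no edge leading out. *)
Lemma realization_exists D a b v w : a != b -> almost D a b ->
    deficients D = [set v; w] -> #|colored_at D v a| = 2 ->
    #|colored_at D w (orient a b v w)| = 0 ->
  exists C, realizes a b D C.
Proof.
move=> ab aD defD va w0.
have [s [Ps Us Pa Ms]] := directed_walk D a b v.
have sum u := almost_sum adjC adjN regG u ab aD.
have nd u : u \notin [set v; w] ->
    #|colored_at D u a| = 1 /\ #|colored_at D u b| = 1.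
  rewrite -defD (almost_deficient adjC adjN regG _ ab aD) negbK => /eqP u1.
  by have := sum u; rewrite u1 add1n => -[].
have vb : #|colored_at D v b| = 0 by have := sum v; rewrite va !addSn => -[].
have ovv : orient a b v v = a by rewrite /orient eqxx.
have vw : v != w by apply/eqP => vw; move: w0; rewrite -vw ovv va.
have lw : last v s = w.
  apply/eqP; apply: contraT => lw.
  have /colored_at_gt0[e [le De]] : 0 < #|colored_at D (last v s)
      (orient a b v (last v s))|.
    have [->|lv] := eqVneq (last v s) v; first by rewrite ovv va.
    have [|a1 b1] := nd (last v s); first by rewrite !inE negb_or lv.
    by rewrite /orient; case: ifP; rewrite ?a1 ?b1.
  have [y Ey] := incident_other le.
  have Dy : D e = orient b a v y by rewrite De (orient_other _ _ _ Ey).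
  have ye := incidentr Ey.
  case: (Ms e y Ey De) => [yv|[[f ef [yf Df]] [q /arrowP[g [Eg Dg]]]]].
    have : 0 < #|colored_at D v b|.
      apply/colored_at_gt0; exists e; rewrite -yv; split=> //.
      by rewrite Dy yv /orient eqxx.
    by rewrite vb.
  have y2 := colored_at_gt1 ef ye yf (erefl _) Df.
  have yD : y \in [set v; w].
    apply: contraLR y2 => /nd[a1 b1]; rewrite Dy /orient.
    by case: ifP; rewrite ?a1 ?b1.
  case/set2P: yD => yE.
    by move: y2; rewrite Dy yE /orient eqxx vb.
  have : 0 < #|colored_at D w (orient a b v w)|.
    by apply/colored_at_gt0; exists g; rewrite -yE (incidentl Eg).
  by rewrite w0.
case: s => [|y s] in Ps Us Pa Ms lw; first by rewrite /= in lw; rewrite lw eqxx in vw.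
set B := walk_edges adj [:: v, y & s].
have sB : B \subset two_colored D a b.
  apply/subsetP => e /(path_rel_edge _ Ps)[].
    by move=> p q /arrowP[f [Ef _]]; exists f.
  move=> p [q [Ee /arrowP[f [Ef Df]]]].
  have -> : e = f by apply/val_inj; rewrite Ee Ef.
  by rewrite inE Df /orient; case: ifP; rewrite eqxx ?orbT.
(* The flip toggles agreement of the two edges exactly at the ends of the path, which are the
   deficient vertices. *)
have pC : Defs.proper (flip a b B D).
  apply: (proper_flipP adjC adjN regG) => // u e f eT fT ef.
  have E : edges_at (two_colored D a b) u = [set e; f].
    apply/esym/eqP; rewrite eqEcard cards2 ef.
    rewrite (almost_edges_at adjC adjN regG _ ab aD) andbT.
    by apply/subsetP => g /set2P[]->.
  rewrite -(almost_deficient_pair adjC adjN regG ab aD E ef) defD.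
  by rewrite (walk_boundary adjN Us Pa sB E ef) -lw in_set2.
exists (exist (@Defs.proper V adj k) _ pC); exists B; first by rewrite flipK.
right; exists v, y, s; split=> //; rewrite two_colored_flip.
by split.
Qed.

(** On the side of [v] and [w], edges of color [b] point in and those of color [d] out, and only
    this side has deficiencies. So each vertex is left by exactly one edge, each vertex but [w] is
    entered by at most one, and [v] by none. The directed walk from [w] can therefore only return to
    [w]. *)
Lemma directed_cycle D a b d v w : a != b -> d != a -> d != b -> almost D a b ->
    deficients D = [set v; w] -> (v \in X) = (w \in X) ->
    #|colored_at D v b| = 0 -> #|colored_at D w b| = 2 ->
  exists F g, [/\ alternating_cycle D b d F, g \in F, incident w g & D g = d].
Proof.
move=> ab da db aD defD vwX vb wb.
have [s [Ps Us Pa Ms]] := directed_walk D d b w.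
have sum u := almost_sum adjC adjN regG u ab aD.
have ud u : #|colored_at D u d| = 1 by apply: aD.
have ub u : u != w -> #|colored_at D u b| <= 1.
  have [->|uv uw] := eqVneq u v; first by rewrite vb.
  have : u \notin deficients D by rewrite defD !inE negb_or uv.
  rewrite (almost_deficient adjC adjN regG _ ab aD) negbK => /eqP u1.
  by have := sum u; rewrite u1 add1n => -[->].
have uo u : #|colored_at D u (orient d b w u)| = 1.
  rewrite /orient; case: eqP => // uX.
  have : u \notin deficients D.
    by rewrite defD; apply/set2P => -[]Eu; apply: uX; rewrite Eu.
  rewrite (almost_deficient adjC adjN regG _ ab aD) negbK => /eqP u1.
  by have := sum u; rewrite u1 add1n => -[].
have ui u : u != w -> #|colored_at D u (orient b d w u)| <= 1.
  by move=> uw; rewrite /orient; case: ifP; rewrite ?ub ?ud.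
have owd : orient d b w w = d by rewrite /orient eqxx.
have db' : (b == d) = false by rewrite eq_sym (negPf db).
have [e [le De]] : exists e, incident (last w s) e /\
    D e = orient d b w (last w s) by apply/colored_at_gt0; rewrite uo.
have [y Ey] := incident_other le.
have yw : y = w.
  case: (Ms e y Ey De) => // -[[f ef [yf Df]] _]; apply/eqP; apply: contraT => yw.
  have Dy : D e = orient b d w y by rewrite De (orient_other _ _ _ Ey).
  have := colored_at_gt1 ef (incidentr Ey) yf (erefl _) Df.
  by rewrite Dy ltnNge ui.
subst y; have Deb : D e = b.
  by rewrite De (orient_other _ _ _ Ey) /orient eqxx.
case: s => [|q s] in Ps Us Pa Ms le De Ey.
  by have := edge_neq adjN Ey; rewrite eqxx.
have /andP[/arrowP[g [Eg Dg]] _] := Ps; rewrite owd in Dg.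
have s0 : 0 < size s.
  rewrite lt0n size_eq0; apply: contraPneq Dg => s0.
  rewrite s0 /= setUC in Ey; have -> : g = e := val_inj (etrans Eg (esym Ey)).
  by rewrite Deb => /eqP; rewrite db'.
have Pw : path (arrow D d b w) w (rcons (q :: s) w).
  by rewrite rcons_path Ps; apply/arrowP; exists e.
set F := cycle_edges adj [:: w, q & s].
have EF f : f \in F -> exists x y, val f = [set x; y] /\ D f = orient d b w x.
  rewrite /F cycle_edgesE => /(path_rel_edge _ Pw)[].
    by move=> x y /arrowP[f' [Ef' _]]; exists f'.
  move=> x [y [Ef /arrowP[f' [Ef' Df']]]]; exists x, y; split=> //.
  by have -> : f = f' by apply/val_inj; rewrite Ef Ef'.
have gF : g \in F by rewrite /F cycle_edgesE rcons_cons walk_edges_cons Eg eqxx.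
exists F, g; split=> //; last exact: incidentl Eg.
apply/andP; split.
  apply/existsP; exists (Ordinal (size_uniq_lt Us)).
  apply/existsP; exists (in_tuple [:: w, q & s]); apply/and4P; split=> //.
  have : path adj w (rcons (q :: s) w).
    by rewrite rcons_path Pa; apply: (edge_adj adjC adjN Ey).
  by [].
apply/andP; split.
  apply/subsetP => f /EF[x [y [_ Df]]]; rewrite inE Df /orient.
  by case: ifP; rewrite eqxx ?orbT.
apply/forall_inP => f1 f1F; apply/forall_inP => f2 f2F; apply/implyP.
case/andP=> f12 /existsP[u /andP[uf1 uf2]]; apply: contraNneq f12 => D12.
(* Two cycle edges of equal color at [u] both leave or both enter it. Only [w] has two entering
   edges, and the cycle contains just the closing one of them, because its first edge [g] has color
   [d]. *)
have io f : f \in F -> incident u f ->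
    D f = orient d b w u \/ D f = orient b d w u.
  move=> /EF[x [y [Ef Df]]]; rewrite (incidentE _ Ef) => /orP[]/eqP->; first by left.
  by right; rewrite Df (orient_other _ _ _ Ef).
case: (io f1 f1F uf1) => D1.
  by rewrite (colored_at_le1 (eq_leq (uo u)) uf1 uf2 D1) // -D12.
have [uw|uw] := eqVneq u w; last first.
  by rewrite (colored_at_le1 (ui u uw) uf1 uf2 D1) // -D12.
subst u; rewrite /orient eqxx in D1.
have last_edge f : f \in F -> incident w f -> D f = b -> val f = [set w; last q s].
  have [t [z Es]] : exists t z, s = rcons t z.
    by case/lastP: (s) s0 => // t z; exists t, z.
  rewrite /F cycle_edgesE Es last_rcons => fF wf Df.
  have Us' : uniq [:: w, q & rcons t z] by rewrite -Es.
  case: (closed_walk_at Us' fF wf) => // Ef.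
  have Efg : f = g by apply/val_inj; rewrite Ef Eg.
  by move: Dg; rewrite -Efg Df => /eqP; rewrite db'.
by apply/eqP/val_inj; rewrite !last_edge // -D12.
Qed.

End Realizations.

(** * Diameter *)

Section Transitions.

Variables (V : finType) (adj : rel V) (k : nat).
Hypotheses (adjC : symmetric adj) (adjN : irreflexive adj).
Hypothesis (regG : regular adj k).
Implicit Types (e f g h : edge adj) (A B F T : {set edge adj}).
Implicit Types (u v w x y z p q : V) (s t : seq V) (a b c d : 'I_k).
Implicit Types (D : precoloring adj k) (C : coloring adj k).

Local Open Scope ring_scope.

Lemma way_prob_ge0 C C' (w : way adj k) : 0 <= way_prob C w C'.
Proof.
case: w => [|a b A F B|a b c A d F B].
- rewrite [way_prob _ _ _]/(_ * _); apply: (mulr_ge0 _ (ler0n _ _)).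
  rewrite /idle_prob; apply: addr_ge0; first apply: addr_ge0.
  + exact: invn_ge0.
  + by case: ifP => _; [apply: invn_ge0 | apply: lexx].
  + by case: ifP => _; [apply: invn_ge0 | apply: lexx].
- rewrite way_prob2E; apply: (mulr_ge0 _ (ler0n _ _)).
  apply: (mulr_ge0 _ (proj1 (subprob_eliminate _) _)).
  apply: (mulr_ge0 _ (proj1 (subprob_perturb2 _ _ _) _)).
  apply: (mulr_ge0 _ (proj1 (subprob_select2 _ _ _) _)).
  by apply: mulr_ge0; [apply: invn_ge0 | rewrite divr_ge0 ?ler0n].
rewrite way_prob3E; apply: (mulr_ge0 _ (ler0n _ _)).
apply: (mulr_ge0 _ (proj1 (subprob_eliminate _) _)).
apply: (mulr_ge0 _ (proj1 (subprob_perturb3 _ _ _ _) _)).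
apply: (mulr_ge0 _ (proj1 (subprob_select3 _ _ _) _)).
apply: mulr_ge0; first exact: invn_ge0.
by apply: mulr_ge0; [rewrite divr_ge0 ?ler0n | apply: invn_ge0].
Qed.

Lemma transition_gt0 C C' (w : way adj k) : 0 < way_prob C w C' ->
  0 < transition C C'.
Proof.
move=> H; rewrite /transition (bigD1 w) //=; apply: ltr_wpDr H.
by apply: sumr_ge0 => w' _; apply: way_prob_ge0.
Qed.

Lemma invn_gt0 m : (0 < m)%N -> 0 < 1 / m%:R :> rat.
Proof. by move=> m0; rewrite divr_gt0 ?ltr01 ?ltr0n. Qed.

Lemma perturb2_supportC D a b F : perturb2_support D a b F ->
  perturb2_support D b a F.
Proof. by rewrite /perturb2_support two_coloredC. Qed.

(** Selecting the arc [B] of the previous elimination leads from [C] back to [D]. Thus the deficient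
    state can be continued although the chain itself only visits proper colorings. *)
Lemma transition2 a b D e C C' : a != b -> perturb2_support D a b [set e] ->
  realizes a b D C -> realizes a b (flip a b [set e] D) C' -> 0 < transition C C'.
Proof.
(* Ways record an unordered pair of colors in increasing order, while the hypotheses are symmetric
   in [a] and [b]. *)
wlog lt_ab : a b / (a < b)%N.
  move=> IH ab; case: (ltngtP a b) => [lt_ab|lt_ba|/val_inj Eab]; first exact: IH.
    move=> /perturb2_supportC sup /realizesC rD /realizesC; rewrite flipC.
    by apply: IH => //; rewrite eq_sym.
  by rewrite Eab eqxx in ab.
move=> ab sup [B ED aB] [B' ED' aB'].
have pC : Defs.proper (val C) := valP C; have pC' : Defs.proper (val C') := valP C'.
have aC := proper_almost adjC adjN regG pC (a := a) (b := b).
have aD : almost D a b by rewrite ED; apply: almost_flip.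
apply: (@transition_gt0 _ _ (Way2 a b B [set e] B')).
rewrite way_prob2E -ED ED' flipK eqxx; apply: (mulr_gt0 _ ltr01).
apply: mulr_gt0; last first.
  by apply: lt_le_trans (eliminate_arc_ge adjC adjN regG ab pC' aB'); apply: invn_gt0.
apply: mulr_gt0; last first.
  have D2 : (#|deficients D| <= 2)%N by rewrite ED card_deficients_arc.
  have T2 : (#|two_colored D a b| <= 2 * #|V|)%N.
    by rewrite ED two_colored_flip card_two_colored.
  have [D0|D0] := eqVneq (deficients D) set0; last first.
    by apply: lt_le_trans (perturb2_ge adjC adjN regG ab aD D2 D0 sup); apply: invn_gt0.
  have V2 : (1 < #|V|)%N.
    have [u [v [_ Ee]]] := edge_ends e.
    by have := max_card (mem [set u; v]); rewrite cards2 (edge_neq adjN Ee).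
  have := perturb2_ge0 V2 ab D0 T2 sup; move: (perturb2 _ _ _ _) => r r1.
  rewrite -(pmulr_rgt0 _ (_ : 0 < 4 * #|V|%:R)); first exact: lt_le_trans r1.
  by rewrite -natrM ltr0n muln_gt0 (ltnW V2).
apply: mulr_gt0; last first.
  case: aB => [->|[x [y [s [W ->]]]]]; first by rewrite select2_0 invn_gt0.
  rewrite (select2E _ _ _ (walk_edges_neq0 W)) mulr_gt0 ?invn_gt0 //.
  by rewrite unif_gt0 walk_connected_subgraph.
apply: mulr_gt0; first exact: invn_gt0.
rewrite lt_ab divr_gt0 ?ltr01 // ltr0n bin_gt0.
by apply: leq_ltn_trans (ltn_ord b); apply: leq_trans lt_ab.
Qed.

(** As in [transition2], but [B] needs an even number of edges to be selectable in step (3); the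
    different counts of [a] at [v] and [w] guarantee this. *)
Lemma transition3 a b c d c' D F v w C C' : a != b -> d != a -> d != b ->
    almost D a b -> deficients D = [set v; w] ->
    #|colored_at D v a| != #|colored_at D w a| ->
    deficiency D w c c' -> alternating_cycle D c d F ->
    (exists2 g, g \in F & incident w g) ->
    realizes a b D C -> realizes a b (flip c d F D) C' ->
  0 < transition C C'.
Proof.
wlog lt_ab : a b / (a < b)%N.
  move=> IH ab da db; case: (ltngtP a b) => [lt_ab|lt_ba|/val_inj Eab].
  - exact: IH.
  - move=> aD defD vw def_c aF gF /realizesC rD /realizesC.
    apply: (IH b a) => //; first 1 [by rewrite eq_sym].
    + exact: almostC.
    + apply: contra vw => /eqP vw.
      have := almost_sum adjC adjN regG v ab aD.
      by have := almost_sum adjC adjN regG w ab aD; rewrite vw => <- /addIn->.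
  - by rewrite Eab eqxx in ab.
move=> ab da db aD defD vw def_c aF [g gF wg] [B ED aB] [B' ED' aB'].
have pC : Defs.proper (val C) := valP C; have pC' : Defs.proper (val C') := valP C'.
have D0 : deficients D != set0.
  by rewrite defD; apply/set0Pn; exists v; rewrite set21.
have [x [y [s [W EB]]]] : exists x y s,
    walk_in (two_colored (val C) a b) x y s /\ B = walk_edges adj [:: x, y & s].
  case: aB => // EB; move: D0.
  by rewrite ED EB flip0 (proper_deficients adjC adjN regG) ?eqxx.
have defD' := deficients_flip_walk adjC adjN regG ab pC W.
rewrite -EB -ED defD in defD'.
have odds : odd (size s).
  by apply: (uneven_ends_odd adjC adjN regG ab pC W defD'); rewrite -EB -ED.
have evenB : B \in even_subpaths (val C) a b.
  have [U P S] := W; rewrite inE EB (walk_is_path W) (walk_edges_neq0 W) S.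
  by rewrite (card_walk_edges P U) /= odds.
apply: (@transition_gt0 _ _ (Way3 a b d B c F B')).
rewrite way_prob3E -ED ED' flipK eqxx; apply: (mulr_gt0 _ ltr01).
apply: mulr_gt0; last first.
  by apply: lt_le_trans (eliminate_arc_ge adjC adjN regG ab pC' aB'); apply: invn_gt0.
apply: mulr_gt0; last first.
  rewrite /perturb3 D0; apply: lt_le_trans (bind_ge w _ _ _); last 2 first.
  - exact: subprob_unif.
  - by move=> u; apply: subprob_unif.
  apply: mulr_gt0; first by rewrite unif_gt0 defD set22.
  rewrite unif_gt0 inE /= aF; apply/and3P; split=> //.
    by apply/existsP; exists c'.
  by apply/exists_inP; exists g.
apply: mulr_gt0; last first.
  have B0 : B != set0 by rewrite EB (walk_edges_neq0 W).
  by rewrite (select3E _ _ _ B0) mulr_gt0 ?invn_gt0 // unif_gt0.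
apply: mulr_gt0; first exact: invn_gt0.
rewrite lt_ab da db; apply: mulr_gt0; last exact: invn_gt0.
rewrite divr_gt0 ?ltr01 // ltr0n bin_gt0.
(* Three distinct colors show that [k] is at least 3, so the binomial coefficient is positive. *)
have U : uniq [:: a; b; d].
  by rewrite /= !inE negb_or ab [a == d]eq_sym da [b == d]eq_sym db.
by have := max_card (mem [:: a; b; d]); rewrite (card_uniqP U) card_ord.
Qed.

End Transitions.

Lemma pred_triple_succ m : (3 * m.+1).-1 = (3 * m).+2.
Proof. by rewrite mulnS. Qed.

(** * Completing one color class of the target *)

Section VirtualWalk.

Variables (V : finType) (adj : rel V) (k : nat).
Hypotheses (adjC : symmetric adj) (adjN : irreflexive adj).
Hypothesis (regG : regular adj k).
Variable X : {set V}.
Hypothesis bipX : forall u v, adj u v -> (u \in X) != (v \in X).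
Implicit Types (e f g h : edge adj) (A B F T : {set edge adj}).
Implicit Types (u v w x y z p q : V) (s t : seq V) (a b c d : 'I_k).
Implicit Types (D : precoloring adj k) (C : coloring adj k).

Lemma reachable_in_cat m n C1 C2 C3 : reachable_in m C1 C2 ->
  reachable_in n C2 C3 -> reachable_in (m + n) C1 C3.
Proof.
elim: m C1 => [|m IH] C1 /=; first by move/eqP->.
case/existsP=> C /andP[C1C CC2] C23; apply/existsP; exists C.
by rewrite C1C IH.
Qed.

Lemma reachable_in1 C1 C2 : (0 < transition C1 C2)%R -> reachable_in 1 C1 C2.
Proof. by move=> H; apply/existsP; exists C2; rewrite H eqxx. Qed.

Lemma flip1E a b g D e :
  flip a b [set g] D e = if e == g then tperm a b (D e) else D e.
Proof. by rewrite ffunE inE. Qed.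

Lemma colored_at_flip1 a b g D v c : ~~ incident v g ->
  colored_at (flip a b [set g] D) v c = colored_at D v c.
Proof.
move=> vg; apply/setP => e; rewrite !inE flip1E; case: (e =P g) => [->|//].
by rewrite (negPf vg).
Qed.

Variables (tgt : precoloring adj k) (a : 'I_k) (P : pred 'I_k).
Hypotheses (ptgt : Defs.proper tgt) (Pa : ~~ P a).

(** [P] marks the finished colors. The condition covers edges of a finished color in either
    coloring, so a finished class has neither lost nor additional edges. *)
Definition agree D := forall e, P (tgt e) || P (D e) -> D e = tgt e.

(** The potential of the induction. Edges of color [a] outside the target class are not counted: in
    a proper coloring they disappear with the last missing edge. *)
Definition missing D := #|[set e | (tgt e == a) && (D e != a)]|.

(** An edge of the class being completed never carries a finished color, so the colors exchanged for
    its sake are still open. *)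
Lemma agree_notP D e : agree D -> tgt e = a -> ~~ P (D e).
Proof. by move=> aD Te; apply/negP => Pe; move: Pa; rewrite -Te -aD Pe ?orbT. Qed.

Lemma agree_flip b d F D : agree D -> ~~ P b -> ~~ P d ->
  F \subset two_colored D b d -> agree (flip b d F D).
Proof.
move=> aD Pb Pd sF e; rewrite ffunE; case: ifP => [/(subsetP sF)|_]; last exact: aD.
rewrite inE => De; have nP : ~~ P (D e) by case/orP: De => /eqP->.
have nT : ~~ P (tgt e).
  by apply/negP => PT; move: nP; rewrite (aD e) PT.
have nP' : ~~ P (tperm b d (D e)).
  by case/orP: De => /eqP->; rewrite ?tpermL ?tpermR.
by rewrite (negPf nT) (negPf nP').
Qed.

Lemma missing_flip b d F D : a != b -> a != d ->
  missing (flip b d F D) = missing D.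
Proof.
move=> ab ad; apply: eq_card => e; rewrite !inE ffunE; congr (_ && ~~ _).
case: ifP => // _; case: tpermP => [->|->|//].
  by rewrite ![_ == a]eq_sym (negPf ab) (negPf ad).
by rewrite ![_ == a]eq_sym (negPf ab) (negPf ad).
Qed.

Lemma missing_gain b g D : b != a -> tgt g = a -> D g = b ->
  missing D = (missing (flip a b [set g] D)).+1.
Proof.
move=> ba Tg Dg; rewrite /missing (cardsD1 g) inE Tg Dg eqxx ba add1n; congr _.+1.
apply: eq_card => e; rewrite !inE flip1E; case: (eqVneq e g) => [->|] //=.
by rewrite Dg tpermR eqxx andbF.
Qed.

Lemma missing_lose b h D : tgt h != a -> missing (flip a b [set h] D) = missing D.
Proof.
move=> Th; apply: eq_card => e; rewrite !inE flip1E.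
by case: (e =P h) => [->|] //; rewrite (negPf Th).
Qed.

(* In both states v repeats a; the other deficient vertex lacks a when it is on
   the side of v and repeats a when it is on the other side. *)
Definition same_side_state b D v w :=
  [/\ almost D a b, deficients D = [set v; w], (v \in X) = (w \in X),
      #|colored_at D v a| = 2 & #|colored_at D w a| = 0].

Definition cross_state b D v x :=
  [/\ almost D a b, deficients D = [set v; x], (v \in X) = (x \notin X),
      #|colored_at D v a| = 2 & #|colored_at D x a| = 2].

Lemma same_side_realization b D v w : a != b -> same_side_state b D v w ->
  exists C, realizes a b D C.
Proof.
move=> ab [aD defD vw va wa].
apply: (realization_exists adjC adjN regG bipX ab aD defD va).
by rewrite /orient vw eqxx.
Qed.

Lemma cross_realization b D v x : a != b -> cross_state b D v x ->
  exists C, realizes a b D C.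
Proof.
move=> ab [aD defD vx va xa].
apply: (realization_exists adjC adjN regG bipX ab aD defD va).
have := almost_sum adjC adjN regG x ab aD; rewrite xa /orient vx.
by case: (x \in X) => /= -[].
Qed.

(** An amortized bound: steps taken plus three per edge still missing stay within the budget [N], so
    it does not matter how early the deficiencies vanish. *)
Definition reaches N C := exists n C',
  [/\ reachable_in n C C', agree (val C') & n + 3 * missing (val C') <= N].

Lemma reaches_step N C C' : (0 < transition C C')%R -> reaches N C' ->
  reaches N.+1 C.
Proof.
move=> /reachable_in1 CC' [n [C'' [C'C'' aC'' le_n]]].
by exists n.+1, C''; split=> //; apply: (reachable_in_cat CC').
Qed.

Lemma reaches_leq M N C : M <= N -> reaches M C -> reaches N C.
Proof.
by move=> MN [n [C' [CC' aC' le_n]]]; exists n, C'; split=> //; apply: leq_trans MN.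
Qed.

Lemma almost_no_deficients b D : a != b -> almost D a b -> deficients D = set0 ->
  Defs.proper D.
Proof.
move=> ab aD D0; apply/(almost_properP adjC adjN regG ab aD) => v e f eT fT ef.
have E : edges_at (two_colored D a b) v = [set e; f].
  apply/esym/eqP; rewrite eqEcard cards2 ef.
  rewrite (almost_edges_at adjC adjN regG _ ab aD) andbT.
  by apply/subsetP => g /set2P[]->.
by rewrite -(almost_deficient_pair adjC adjN regG ab aD E ef) D0 inE.
Qed.

Lemma flip1_gain b D v g : a != b -> almost D a b -> v \notin deficients D ->
  incident v g -> D g = b -> #|colored_at (flip a b [set g] D) v a| = 2.
Proof.
move=> ab aD; rewrite (almost_deficient adjC adjN regG _ ab aD) negbK => /eqP va.
move=> vg Dg; have /colored_at_gt0[h [vh Dh]] : 0 < #|colored_at D v a| by rewrite va.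
have gh : g != h by apply: contraNneq ab => gh; rewrite -Dh -gh Dg.
have aD' := almost_flip [set g] aD.
have := almost_sum adjC adjN regG v ab aD'.
have : 1 < #|colored_at (flip a b [set g] D) v a|.
  apply: (colored_at_gt1 gh vg vh); first by rewrite flip1E eqxx Dg tpermR.
  by rewrite flip1E eq_sym (negPf gh).
by lia.
Qed.

(** The edge [h] that loses color [a] is not in the target class, which already has [g] at [x], so
    nothing gained is lost. The premise on same-side states is the induction hypothesis of
    [same_side_reaches], passed in because the two kinds of states alternate. *)
Lemma cross_step N b D v x g C : a != b -> ~~ P b ->
    (forall D w C, missing D <= N -> same_side_state b D v w -> agree D ->
       realizes a b D C -> reaches (3 * missing D) C) ->
    missing D <= N -> cross_state b D v x -> agree D ->
    incident x g -> tgt g = a -> D g = a -> realizes a b D C ->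
  reaches (3 * missing D).+1 C.
Proof.
move=> ab Pb IH mN [aD defD vxX va xa] agD xg Tg Dg rD.
have [h [gh xh Dh]] : exists h, [/\ g != h, incident x h & D h = a].
  have /eqP/cards2P[e1 [e2 [e12 E]]] := xa.
  have : g \in colored_at D x a by rewrite inE xg Dg eqxx.
  have : e1 \in colored_at D x a by rewrite E set21.
  have : e2 \in colored_at D x a by rewrite E set22.
  rewrite {3}E !inE => /andP[xe2 /eqP D2] /andP[xe1 /eqP D1] /orP[]/eqP->.
    by exists e2.
  by exists e1; rewrite eq_sym.
have Th : tgt h != a.
  by apply: contraNneq gh => Th; rewrite (proper_color_inj ptgt xg xh) // Tg Th.
have hT : h \in two_colored D a b by rewrite inE Dh eqxx.
set D3 := flip a b [set h] D.
have agD3 : agree D3 by apply: agree_flip; rewrite ?sub1set.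
have aD3 : almost D3 a b by apply: almost_flip.
have m3 : missing D3 = missing D by apply: missing_lose.
have [y Eh] := incident_other xh.
have yh := incidentr Eh; have xy := edge_neq adjN Eh.
have vx : v != x by apply: contra_eqN vxX => /eqP->; case: (x \in X).
have def3 u : (u \in deficients D3) = (u \in deficients D) (+) incident u h.
  exact: deficient_flip1.
have xD : x \in deficients D by rewrite defD set22.
have sup : perturb2_support D a b [set h].
  rewrite /perturb2_support; case: ifP => [/eqP D0|_]; first by rewrite D0 inE in xD.
  by exists x, h; split=> //; rewrite inE hT.
(* If the far end is the other deficient vertex, both deficiencies cancel and [D3] itself is a
   coloring. *)
have [yv|yv] := eqVneq y v.
  have p3 : Defs.proper D3.
    apply: (almost_no_deficients ab aD3); apply/setP => u.
    by rewrite def3 defD (incidentE _ Eh) yv !inE orbC addbb.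
  pose C3 : coloring adj k := exist (@Defs.proper V adj k) _ p3.
  exists 1, C3; split=> //; last by rewrite m3 add1n.
  apply/reachable_in1/(transition2 adjC adjN regG ab sup rD).
  exact: (proper_realizes a b C3).
have defD3 : deficients D3 = [set v; y].
  apply/setP => u; rewrite def3 defD (incidentE _ Eh) !inE.
  have [->|uv] := eqVneq u v; first by rewrite (negPf vx) [v == y]eq_sym (negPf yv).
  have [->|ux] := eqVneq u x; first by rewrite (negPf xy).
  by [].
have yD : y \notin deficients D by rewrite defD !inE negb_or yv eq_sym.
have S3 : same_side_state b D3 v y.
  split=> //.
  - by rewrite vxX (edge_sides adjC adjN bipX Eh) negbK.
  - rewrite colored_at_flip1 // (incidentE _ Eh) negb_or vx.
    by rewrite eq_sym.
  (* As [y] was not deficient, [h] was its only edge of color [a]. *)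
  apply/eqP; rewrite cards_eq0; apply/eqP/setP => e; rewrite !inE flip1E.
  apply/negP => /andP[ye]; case: (e =P h) => [->|/eqP eh].
    by rewrite Dh tpermL eq_sym (negPf ab).
  move=> /eqP De; move: yD.
  rewrite (almost_deficient adjC adjN regG _ ab aD) negbK => /eqP y1.
  by rewrite (colored_at_le1 (eq_leq y1) ye yh De Dh) eqxx in eh.
have [C3 rC3] := same_side_realization ab S3.
apply: reaches_step (transition2 adjC adjN regG ab sup rD rC3) _.
by rewrite -m3; apply: (IH _ y) => //; rewrite m3.
Qed.

(** The gained edge is worth three steps; its recoloring uses one and [cross_step] another. The one
    saved by [.-1] pays for a cycle flip that may have to come before. *)
Lemma same_side_matched N b D v w g C : a != b -> ~~ P b ->
    (forall D w C, missing D <= N -> same_side_state b D v w -> agree D ->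
       realizes a b D C -> reaches (3 * missing D) C) ->
    missing D <= N.+1 -> same_side_state b D v w -> agree D ->
    incident w g -> tgt g = a -> D g = b -> realizes a b D C ->
  reaches (3 * missing D).-1 C.
Proof.
move=> ab Pb IH mN [aD defD vwX va wa] agD wg Tg Dg rD.
have ba : b != a by rewrite eq_sym.
have gT : g \in two_colored D a b by rewrite inE Dg eqxx orbT.
set D2 := flip a b [set g] D.
have m2 : missing D = (missing D2).+1 by apply: missing_gain.
have agD2 : agree D2 by apply: agree_flip; rewrite ?sub1set.
have aD2 : almost D2 a b by apply: almost_flip.
have [x Eg] := incident_other wg.
have xg := incidentr Eg; have wx := edge_neq adjN Eg.
have wxX := edge_sides adjC adjN bipX Eg.
have vw : v != w by apply: contra_eqN va => /eqP->; rewrite wa.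
have vx : v != x by apply: contra_eqN vwX => /eqP->; rewrite wxX; case: (x \in X).
have def2 u : (u \in deficients D2) = (u \in deficients D) (+) incident u g.
  exact: deficient_flip1.
have wD : w \in deficients D by rewrite defD set22.
have xD : x \notin deficients D.
  by rewrite defD !inE negb_or ![x == _]eq_sym vx.
have sup : perturb2_support D a b [set g].
  rewrite /perturb2_support; case: ifP => [/eqP D0|_]; first by rewrite D0 inE in wD.
  by exists w, g; split=> //; rewrite inE gT.
have S2 : cross_state b D2 v x.
  split=> //.
  - apply/setP => u; rewrite def2 defD (incidentE _ Eg) !inE.
    have [->|uv] := eqVneq u v; first by rewrite (negPf vw) (negPf vx).
    by have [->|uw] := eqVneq u w; first by rewrite (negPf wx).
  - by rewrite vwX wxX.
  - by rewrite colored_at_flip1 // (incidentE _ Eg) negb_or vw.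
  - exact: flip1_gain.
have [C2 rC2] := cross_realization ab S2.
rewrite m2 pred_triple_succ.
apply: reaches_step (transition2 adjC adjN regG ab sup rD rC2) _.
apply: (cross_step ab Pb IH _ S2 agD2 xg Tg _ rC2); first by rewrite -ltnS -m2.
by rewrite flip1E eqxx Dg tpermR.
Qed.

Lemma same_side_reaches N b D v w C : a != b -> ~~ P b -> missing D <= N ->
    same_side_state b D v w -> agree D -> realizes a b D C ->
  reaches (3 * missing D) C.
Proof.
move=> ab Pb; elim: N D w C => [|N IH] D w C mN S agD rD.
all: have [aD defD vwX va wa] := S.
all: have [g [wg Tg]] : exists g, incident w g /\ tgt g = a
  by apply/colored_at_gt0; have /(proper_colored_at adjC adjN regG)-> := ptgt.
all: have Dga : D g != a
  by apply: contra_eqN wa => /eqP Dg; rewrite -lt0n; apply/colored_at_gt0; exists g.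
all: have m0 : 0 < missing D by rewrite card_gt0; apply/set0Pn; exists g;
  rewrite inE Tg eqxx.
  (* A same-side state is never complete: the target edge of color [a] at [w] is missing. *)
  by move: mN; rewrite leqNgt m0.
have [Dgb|Dgb] := eqVneq (D g) b.
  apply: reaches_leq (leq_pred _) _.
  exact: (same_side_matched ab Pb IH mN S agD wg Tg Dgb rD).
set d := D g; have Pd : ~~ P d by apply: agree_notP.
have vb : #|colored_at D v b| = 0.
  by have := almost_sum adjC adjN regG v ab aD; rewrite va !addSn => -[].
have wb : #|colored_at D w b| = 2.
  by have := almost_sum adjC adjN regG w ab aD; rewrite wa.
(* The cycle must pass through [g], the only [d]-edge at [w]; the flip gives it color [b] without
   moving the deficiencies. *)
have [F [g' [aF g'F wg' Dg']]] :=
  directed_cycle adjC adjN regG bipX ab Dga Dgb aD defD vwX vb wb.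
have gg' : g = g'.
  apply: (colored_at_le1 (eq_leq (aD w d _ _)) wg wg') => //.
subst g'; set D1 := flip b d F D.
have cnt u c : #|colored_at D1 u c| = #|colored_at D u c|.
  exact: card_colored_at_cycle.
have S1 : same_side_state b D1 v w.
  split=> //; rewrite ?cnt //; first exact: almost_flip_cycle.
  by rewrite deficients_flip_cycle.
have sF : F \subset two_colored D b d by case/and3P: aF.
have agD1 : agree D1 by apply: agree_flip.
have m1 : missing D1 = missing D by apply: missing_flip; rewrite // eq_sym.
have D1g : D1 g = b by rewrite /D1 ffunE g'F -/d tpermR.
have [C1 rC1] := same_side_realization ab S1.
have wdef : deficiency D w b a.
  by rewrite (almost_deficiency adjC adjN regG _ _ _ ab aD) wb !eqxx orbT.
have tr : (0 < transition C C1)%R.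
  apply: (transition3 adjC adjN regG ab _ _ aD defD _ wdef aF _ rD rC1) => //.
    by rewrite va wa.
  by exists g.
have -> : 3 * missing D = (3 * missing D).-1.+1 by rewrite prednK // muln_gt0.
apply: reaches_step tr _; rewrite -m1.
by apply: (same_side_matched ab Pb IH _ S1 agD1 wg Tg D1g rC1); rewrite m1.
Qed.

(** Recoloring a missing edge of a proper coloring makes both of its ends repeat [a], so the start
    is a cross state and no cycle flip is due. The step saved makes the bound strict, which forces
    the number of missing edges to drop. *)
Lemma proper_reaches C : agree (val C) -> 0 < missing (val C) ->
  reaches (3 * missing (val C)).-1 C.
Proof.
move=> agC; rewrite card_gt0 => /set0Pn[g]; rewrite inE => /andP[/eqP Tg Cg].
set D := val C; have pD : Defs.proper D := valP C.
set b := D g; have ba : b != a := Cg; have ab : a != b by rewrite eq_sym.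
have Pb : ~~ P b by apply: agree_notP.
have aD := proper_almost adjC adjN regG pD (a := a) (b := b).
have gT : g \in two_colored D a b by rewrite inE eqxx orbT.
have D0 : deficients D = set0 by rewrite (proper_deficients adjC adjN regG).
set D2 := flip a b [set g] D.
have m2 : missing D = (missing D2).+1 by apply: missing_gain.
have [v [x [_ Eg]]] := edge_ends g.
have S2 : cross_state b D2 v x.
  split.
  - exact: almost_flip.
  - apply/setP => u; rewrite (deficient_flip1 adjC adjN regG) // D0 (incidentE _ Eg).
    by rewrite !inE.
  - exact: (edge_sides adjC adjN bipX Eg).
  - by apply: flip1_gain; rewrite ?D0 ?inE // (incidentl Eg).
  - by apply: flip1_gain; rewrite ?D0 ?inE // (incidentr Eg).
have [C2 rC2] := cross_realization ab S2.
have sup : perturb2_support D a b [set g].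
  by rewrite /perturb2_support D0 eqxx; right; exists g.
rewrite m2 pred_triple_succ.
apply: reaches_step (transition2 adjC adjN regG ab sup (proper_realizes a b C) rC2) _.
apply: (cross_step (N := missing D2) ab Pb _ _ S2 _ (incidentr Eg) Tg _ rC2) => //.
- by move=> D' w C' mN S' agD' rD'; apply: (same_side_reaches ab Pb mN S').
- by apply: agree_flip; rewrite ?sub1set.
- by rewrite flip1E eqxx tpermR.
Qed.

Lemma reaches_matched C : agree (val C) -> exists n C',
  [/\ reachable_in n C C', agree (val C'), missing (val C') = 0 &
    n <= 3 * missing (val C)].
Proof.
move: {2}(missing _) (leqnn (missing (val C))) => m.
elim: m C => [|m IH] C le_m agC.
  by exists 0, C; split=> //; [apply: eqxx | apply/eqP; rewrite -leqn0].
have [m0|m0] := posnP (missing (val C)).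
  by exists 0, C; split=> //; apply: eqxx.
have [n [C' [CC' agC' le_n]]] := proper_reaches agC m0.
have [|n' [C'' [CC'' agC'' m'' le_n']]] := IH C' _ agC'; first by lia.
exists (n + n'), C''; split=> //; first exact: reachable_in_cat CC' CC''.
by lia.
Qed.

(** At each vertex the target edge of color [a] has color [a] in [D] as well, and a proper coloring
    has no second one there. *)
Lemma agree_matched D e : Defs.proper D -> missing D = 0 ->
  (tgt e == a) || (D e == a) -> D e = tgt e.
Proof.
move=> pD /eqP; rewrite cards_eq0 => /eqP/setP m0.
have Ta f : tgt f = a -> D f = a.
  by move=> Tf; have := m0 f; rewrite !inE Tf eqxx => /negbFE/eqP.
case/orP=> /eqP ea; first by rewrite Ta.
have [v [x [_ Ee]]] := edge_ends e; have ve := incidentl Ee.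
have [g [vg Tg]] : exists g, incident v g /\ tgt g = a.
  by apply/colored_at_gt0; have /(proper_colored_at adjC adjN regG)-> := ptgt.
by rewrite ea -Tg (proper_color_inj pD ve vg) // ea Ta.
Qed.

End VirtualWalk.

(** * Treating the color classes in turn *)

Section Diameter.

Variables (V : finType) (adj : rel V) (k : nat).
Hypotheses (adjC : symmetric adj) (adjN : irreflexive adj).
Hypothesis (regG : regular adj k).
Variable X : {set V}.
Hypothesis bipX : forall u v, adj u v -> (u \in X) != (v \in X).
Implicit Types (e : edge adj) (C : coloring adj k).

Lemma reachable_prefix C C2 j : j <= k -> exists n C',
  [/\ reachable_in n C C', agree (val C2) (fun c => c < j) (val C') &
    n <= 3 * #|[set e | val C2 e < j]|].
Proof.
have p2 : Defs.proper (val C2) := valP C2.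
elim: j => [|j IH] jk.
  by exists 0, C; split; [exact: eqxx | move=> e; rewrite !ltn0 | ].
have [n [C' [CC' agC' le_n]]] := IH (ltnW jk).
have Pj : ~~ (Ordinal jk < j) by rewrite ltnn.
have [n' [C'' [CC'' agC'' m0 le_n']]] :=
  reaches_matched adjC adjN regG bipX p2 Pj agC'.
exists (n + n'), C''; split.
- exact: reachable_in_cat CC' CC''.
- move=> e e_j; have [/agC''//|] := boolP ((val C2 e < j) || (val C'' e < j)).
  rewrite negb_or => /andP[/negPf nj2 /negPf nj''].
  apply: (agree_matched adjC adjN regG p2 (valP C'') m0).
  move: e_j; rewrite !ltnS (leq_eqVlt (val C2 e)) (leq_eqVlt (val C'' e)).
  by rewrite nj2 nj'' !orbF.
(* The target classes are disjoint, so their budgets of three steps per edge add up. *)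
have -> : #|[set e | val C2 e < j.+1]| =
    #|[set e | val C2 e < j]| + #|[set e | val C2 e == Ordinal jk]|.
  rewrite -cardsUI [_ :&: _](_ : _ = set0) ?cards0 ?addn0.
    apply: eq_card => e; rewrite !inE ltnS leq_eqVlt orbC; congr (_ || _).
  apply/setP => e; rewrite !inE; apply/negbTE/negP => /andP[+ /eqP E].
  by rewrite E ltnn.
have : missing (val C2) (Ordinal jk) (val C') <=
    #|[set e | val C2 e == Ordinal jk]|.
  by apply: subset_leq_card; apply/subsetP => e; rewrite !inE => /andP[].
by lia.
Qed.

Lemma reachable_within C C2 : exists2 n, reachable_in n C C2 & n <= 3 * #|{: edge adj}|.
Proof.
have [n [C' [CC' agC' le_n]]] := reachable_prefix C C2 (leqnn k).
have <- : C' = C2.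
  by apply/val_inj/ffunP => e; apply: agC'; rewrite ltn_ord.
by exists n => //; apply: leq_trans le_n _; rewrite leq_mul2l /= max_card.
Qed.

(** A diameter is a least bound on the distances; it is found by [ex_minnP], for which the bound is
    first expressed as a boolean predicate. *)
Lemma diameter_exists N : (forall C C2, exists2 n, reachable_in n C C2 & n <= N) ->
  exists D, is_diameter adj k D /\ D <= N.
Proof.
move=> reach.
pose P D := [forall C1 : coloring adj k, forall C2 : coloring adj k,
  exists n : 'I_D.+1, reachable_in n C1 C2].
have PP D : reflect (@distances_le V adj k D) (P D).
  apply: (iffP forallP) => [H C1 C2|H C1].
    have /forallP/(_ C2)/existsP[n Cn] := H C1.
    have ex : exists n, reachable_in n C1 C2 by exists n.
    case: (ex_minnP ex) => m Cm min_m; exists m; first by split.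
    by apply: leq_trans (min_m _ Cn) _; rewrite -ltnS.
  apply/forallP => C2; have [d [Cd _] dD] := H C1 C2.
  by apply/existsP; exists (Ordinal (dD : d < D.+1)).
have exP : exists D, P D.
  exists N; apply/forallP => C1; apply/forallP => C2.
  have [n Cn nN] := reach C1 C2.
  by apply/existsP; exists (Ordinal (nN : n < N.+1)).
case: (ex_minnP exP) => D PD minD; exists D; split.
  by split=> [|D' /PP/minD //]; apply/PP.
apply: minD; apply/forallP => C1; apply/forallP => C2.
have [n Cn nN] := reach C1 C2.
by apply/existsP; exists (Ordinal (nN : n < N.+1)).
Qed.

End Diameter.

Unset Implicit Arguments.
Set Strict Implicit.
Set Printing Implicit Defensive.

Local Open Scope ring_scope.

Theorem theorem4p4 (V : finType) (adj : rel V) (k : nat)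
    (hV : (0 < #|V|)%N)
    (hG : simple_graph adj)
    (hbip : balanced_bipartite adj)
    (hreg : regular adj k) :
  (exists D : nat, is_diameter adj k D /\ (D <= 3 * #|{: edge adj}|)%N)
  /\ (forall (C1 C2 : coloring adj k) (w : way adj k),
        0 < way_prob C1 w C2 ->
        0 < acceptance C1 w C2 /\
        (acceptance C1 w C2)^-1 <= 16%:R * #|V|%:R * (#|V|%:R - 1)).
Proof.
have [adjC adjN] := hG; have [X [bipX X2]] := hbip.
(* The two vertex classes have equal size and are not both empty. *)
have V2 : (1 < #|V|)%N by have := cardsC X; lia.
split; last exact: acceptance_bound.
apply: diameter_exists => C1 C2.
exact: (reachable_within adjC adjN hreg bipX C1 C2).
Qed.
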